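(* Assume that: (A1) there are positive numbers $\mu_{\min},\mu_{\max},\lambda_{\max}$ such that $0<\mu_{\min}\le\mu(\mathbf{x},\mathbf{y})\le\mu_{\max}$ and $0\le\lambda(\mathbf{x},\mathbf{z})\le\lambda_{\max}$ for all $\mathbf{x}\in\Omega$, $\mathbf{y},\mathbf{z}\in U$; (A2) $\|\psi_j\|_{L^\infty(\Omega)}\ge\|\psi_{j+1}\|_{L^\infty(\Omega)}$ and $\|\phi_j\|_{L^\infty(\Omega)}\ge\|\phi_{j+1}\|_{L^\infty(\Omega)}$ for $j\ge1$; (A3) $\sum_{j\ge1}\|\psi_j\|_{L^\infty(\Omega)}<\infty$ and $\sum_{j\ge1}\|\phi_j\|_{L^\infty(\Omega)}<\infty$. Then for $\mathbf{f}\in\mathbf{V}^*$, $\mathbf{y},\mathbf{z}\in U$ and $\boldsymbol{\alpha},\boldsymbol{\beta}\in\mathcal{S}$, the solution $\mathbf{u}(\cdot,\mathbf{y},\mathbf{z})$ of the parametric weak problem satisfies $$\big\|\boldsymbol{\varepsilon}\big(\partial^{\boldsymbol{\alpha},\boldsymbol{\beta}}_{\mathbf{y},\mathbf{z}}\mathbf{u}(\cdot,\mathbf{y},\mathbf{z})\big)\big\|\le(|\boldsymbol{\alpha}|+|\boldsymbol{\beta}|)!\;\widetilde{\mathbf{b}}^{\boldsymbol{\alpha}}\,\widehat{\mathbf{b}}^{\boldsymbol{\beta}}\,\|\boldsymbol{\varepsilon}(\mathbf{u})\|,$$ where $$\widetilde{\mathbf{b}}^{\boldsymbol{\alpha}}=\prod_{i\ge1}(\widetilde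 b_i)^{\alpha_i},\quad \widehat{\mathbf{b}}^{\boldsymbol{\beta}}=\prod_{i\ge1}(\widehat b_i)^{\beta_i},\quad \widetilde b_j=\frac{\|\psi_j\|_{L^\infty(\Omega)}}{\mu_{\min}},\quad \widehat b_j=\frac d2\,\frac{\|\phi_j\|_{L^\infty(\Omega)}}{\mu_{\min}}.$$ Consequently, $$\|\partial^{\boldsymbol{\alpha},\boldsymbol{\beta}}_{\mathbf{y},\mathbf{z}}\mathbf{u}(\cdot,\mathbf{y},\mathbf{z})\|_{\mathbf{V}}\le C\mu_{\min}^{-1}(|\boldsymbol{\alpha}|+|\boldsymbol{\beta}|)!\;\widetilde{\mathbf{b}}^{\boldsymbol{\alpha}}\,\widehat{\mathbf{b}}^{\boldsymbol{\beta}}\,\|\mathbf{f}\|_{\mathbf{V}^*},$$ where the constant $C$ depends on $\Omega$ only.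
   Context: $d\in\{2,3\}$ and $\Omega\subset\mathbb{R}^d$ is a bounded domain with polyhedral boundary. $\mathbf{V}=[H^1_0(\Omega)]^d$ with norm $\|\mathbf{w}\|_{\mathbf{V}}=(\sum_{i=1}^d\|w_i\|_{H^1(\Omega)}^2)^{1/2}$; $\mathbf{V}^*$ is its dual with respect to the $[L^2(\Omega)]^d$ inner product. $U=(-\frac12,\frac12)^{\mathbb{N}}$; for $\mathbf{y}=(y_j)_{j\ge1},\mathbf{z}=(z_j)_{j\ge1}\in U$, $\mu(\mathbf{x},\mathbf{y})=\mu_0(\mathbf{x})+\sum_{j\ge1}y_j\psi_j(\mathbf{x})$ and $\lambda(\mathbf{x},\mathbf{z})=\lambda_0(\mathbf{x})+\sum_{j\ge1}z_j\phi_j(\mathbf{x})$, where $\{\psi_j\}$, $\{\phi_j\}$ are orthogonal basis functions for $L^2(\Omega)$. With $\boldsymbol{\varepsilon}(\mathbf{v})=\frac12(\nabla\mathbf{v}+(\nabla\mathbf{v})^T)$ and $\|\boldsymbol{\varepsilon}(\mathbf{v})\|=(\int_\Omega\boldsymbol{\varepsilon}(\mathbf{v}):\boldsymbol{\varepsilon}(\mathbf{v})\,d\mathbf{x})^{1/2}$, the weak solution $\mathbf{u}(\cdot,\mathbf{y},\mathbf{z})\in\mathbf{V}$ is defined by $$\int_\Omega[2\mu\,\boldsymbol{\varepsilon}(\mathbf{u}):\boldsymbol{\varepsilon}(\mathbf{v})+\lambda\,\nabla\cdot\mathbf{u}\,\nabla\cdot\mathbf{v}]\,d\mathbf{x}=\langle\mathbf{f},\mathbf{v}\rangle\quad\text{for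 all }\mathbf{v}\in\mathbf{V},$$ where $\langle\mathbf{f},\mathbf{v}\rangle$ is the duality pairing extending $\int_\Omega\mathbf{f}\cdot\mathbf{v}\,d\mathbf{x}$. $\mathcal{S}$ is the set of sequences $\boldsymbol{\alpha}=(\alpha_j)_{j\ge1}$ of nonnegative integers with $|\boldsymbol{\alpha}|:=\sum_j\alpha_j<\infty$. $\partial^{\boldsymbol{\alpha},\boldsymbol{\beta}}_{\mathbf{y},\mathbf{z}}$ is the mixed partial derivative of order $\alpha_j$ in $y_j$ and $\beta_j$ in $z_j$ for all $j$, applied to the $\mathbf{V}$-valued map $(\mathbf{y},\mathbf{z})\mapsto\mathbf{u}(\cdot,\mathbf{y},\mathbf{z})$. *)

(* Defs.v *)
From HB Require Import structures.
From mathcomp Require Import all_boot all_order all_algebra finmap.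
From mathcomp Require Import all_classical all_reals all_analysis.

Set Implicit Arguments.
Unset Strict Implicit.
Unset Printing Implicit Defensive.
Import Order.TTheory GRing.Theory Num.Theory.
Import numFieldNormedType.Exports.

Local Open Scope classical_set_scope.
Local Open Scope ring_scope.

Definition rV_display : measure_display.
Proof. exact: default_measure_display. Qed.

Section rV_measurable.
Context (R : realType) (n : nat).

Definition rV_coord (i : 'I_n) (x : 'rV[R]_n) : R := x ord0 i.

Let rV_set0 : g_sigma_preimage rV_coord set0.
Proof. exact: sigma_algebra0. Qed.

Let rV_setC A : g_sigma_preimage rV_coord A -> g_sigma_preimage rV_coord (~` A).
Proof. exact: sigma_algebraC. Qed.

Let rV_bigcup (F : (set 'rV[R]_n)^nat) :
  (forall i, g_sigma_preimage rV_coord (F i)) ->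
  g_sigma_preimage rV_coord (\bigcup_i F i).
Proof. exact: sigma_algebra_bigcup. Qed.

(* Generated by the coordinates, as the library does for n.-tuple; this is the
   Borel sigma-algebra of 'rV[R]_n. *)
HB.instance Definition _ := @isMeasurable.Build rV_display
  'rV[R]_n (g_sigma_preimage rV_coord) rV_set0 rV_setC rV_bigcup.

Lemma measurable_rV_coord (i : 'I_n) : measurable_fun setT (rV_coord i).
Proof.
move=> _ Y mY; rewrite setTI; apply: sub_sigma_algebra => /=.
rewrite -bigcup_seq/=; exists i => /=; first by rewrite mem_index_enum.
by exists Y => //; rewrite setTI.
Qed.

Lemma measurable_fun_rV d (T : measurableType d) (f : T -> 'rV[R]_n) :
  (forall i, measurable_fun setT (fun t => f t ord0 i)) ->
  measurable_fun setT f.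
Proof.
move=> mf _ Y; rewrite setTI.
move: Y; apply: smallest_sub.
  split => [|A mA|A mA].
  - by rewrite /= preimage_set0.
  - by rewrite /= setTD preimage_setC; exact: measurableC.
  - by rewrite /= preimage_bigcup; apply: bigcup_measurable => k _; exact: mA.
move=> A; rewrite -bigcup_seq/= => -[i _] [B mB <-] /=.
by rewrite setTI; move: (mf i measurableT B mB); rewrite setTI.
Qed.

End rV_measurable.

Section rV_lebesgue.
Context (R : realType).

Definition rV_cons n (p : R * 'rV[R]_n) : 'rV[R]_n.+1 :=
  \row_i (if unlift ord0 i is Some j then p.2 ord0 j else p.1).

Definition rV_uncons n (x : 'rV[R]_n.+1) : R * 'rV[R]_n :=
  (x ord0 ord0, \row_j x ord0 (lift ord0 j)).

Lemma measurable_rV_cons n : measurable_fun setT (@rV_cons n).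
Proof.
apply: measurable_fun_rV => i.
under eq_fun do rewrite mxE.
case: (unlift ord0 i) => [j|]; last exact: measurable_fst.
exact: (measurableT_comp (measurable_rV_coord j) measurable_snd).
Qed.

Lemma measurable_rV_uncons n : measurable_fun setT (@rV_uncons n).
Proof.
apply: measurable_fun_pair; first exact: measurable_rV_coord.
apply: measurable_fun_rV => i.
under eq_fun do rewrite mxE.
exact: measurable_rV_coord.
Qed.

Lemma rV_consK n : cancel (@rV_cons n) (@rV_uncons n).
Proof.
case=> a v; congr pair; first by rewrite mxE unlift_none.
by apply/rowP => j; rewrite !mxE liftK.
Qed.

Section step.
Context n (mu : {sigma_finite_measure set 'rV[R]_n -> \bar R}).

Definition lebesgue_rV_step : set 'rV[R]_n.+1 -> \bar R :=
  pushforward (lebesgue_measure \x mu)%E (@rV_cons n).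

Let step_measure : {measure set 'rV[R]_n.+1 -> \bar R} :=
  measure_function_pushforward__canonical__measure_function_Measure
    (lebesgue_measure \x mu)%E (@measurable_rV_cons n).
HB.instance Definition _ := Measure.copy lebesgue_rV_step step_measure.

Let lebesgue_rV_step_sigma_finite : sigma_finite setT lebesgue_rV_step.
Proof.
have /sigma_finiteP[F [TF ndF mF]] := sigma_finiteT (@lebesgue_measure R).
have /sigma_finiteP[G [TG ndG mG]] := sigma_finiteT mu.
exists (fun k => @rV_uncons n @^-1` (F k `*` G k)).
  rewrite -preimage_bigcup (_ : \bigcup_k _ = setT) ?preimage_setT//.
  apply/seteqP; split => // -[x y] _.
  have [k _ Fkx] : (\bigcup_k F k) x by rewrite -TF.
  have [l _ Gly] : (\bigcup_k G k) y by rewrite -TG.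
  exists (maxn k l) => //; split => /=.
  - by move: x Fkx; exact/subsetPset/ndF/leq_maxl.
  - by move: y Gly; exact/subsetPset/ndG/leq_maxr.
move=> k; have [mFk Fk] := mF k; have [mGk Gk] := mG k; split.
  rewrite -[X in measurable X]setTI.
  by apply: measurable_rV_uncons => //; exact: measurableX.
rewrite /lebesgue_rV_step /pushforward -comp_preimage.
rewrite (_ : _ \o _ = id); last by apply/funext => p; exact: rV_consK.
rewrite preimage_id product_measure1E//.
by rewrite lte_mul_pinfty// ge0_fin_numE.
Qed.

HB.instance Definition _ := @Measure_isSigmaFinite.Build _ _ _
  lebesgue_rV_step lebesgue_rV_step_sigma_finite.

End step.

Fixpoint lebesgue_rV n : {sigma_finite_measure set 'rV[R]_n -> \bar R} :=
  match n with
  | 0 => \d_(0 : 'rV[R]_0)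
  | m.+1 => lebesgue_rV_step (lebesgue_rV m)
  end.

Lemma lebesgue_rV_box n (a b : 'I_n -> R) : (forall i, a i <= b i) ->
  lebesgue_rV n [set x | forall i, a i <= x ord0 i <= b i] =
  (\prod_(i < n) (b i - a i))%:E.
Proof.
elim: n a b => [|n IHn] a b ab.
  by rewrite big_ord0 /= diracE mem_set// => -[].
pose B := [set x : 'rV[R]_n | forall i : 'I_n,
  a (lift ord0 i) <= x ord0 i <= b (lift ord0 i)].
have mB : measurable B.
  rewrite (_ : B = \bigcap_(i in [set: 'I_n]) (rV_coord i @^-1`
      `[a (lift ord0 i), b (lift ord0 i)]%classic)); last first.
    apply/seteqP; split => x /= Bx i => [_|].
      by rewrite /= in_itv/=; exact: Bx.
    by have := Bx i Logic.I; rewrite /= in_itv.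
  apply: fin_bigcap_measurable => [|i _]; first exact: finite_finset.
  rewrite -[X in measurable X]setTI.
  by apply: measurable_rV_coord => //; exact: measurable_itv.
rewrite big_ord_recl /= /lebesgue_rV_step /pushforward.
rewrite (_ : _ @^-1` _ = `[a ord0, b ord0]%classic `*` B); last first.
  apply/seteqP; split => -[t x] /=.
    move=> H; split => [|i]; first by have := H ord0; rewrite mxE unlift_none in_itv.
    by have := H (lift ord0 i); rewrite mxE liftK.
  move=> [/= tab Bx] i; rewrite mxE; case: unliftP => [j ->|->]; first exact: Bx.
  by move: tab; rewrite in_itv.
rewrite product_measure1E//= lebesgue_measure_itv/= lte_fin.
rewrite IHn; last by move=> i; exact: ab.
rewrite EFinM; congr (_ * _)%E.
have := ab ord0; rewrite le_eqVlt => /orP[/eqP ->|->]; last by rewrite EFinB.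
by rewrite ltxx subrr.
Qed.

End rV_lebesgue.

Section domains.
Context (R : realType) (n : nat).
Implicit Type Omega : set 'rV[R]_n.

(* The rows of P are the vertices. *)
Definition polytope k (P : 'M[R]_(k, n)) : set 'rV[R]_n :=
  [set w *m P | w in [set w : 'rV[R]_k |
    (forall i, 0 <= w ord0 i) /\ \sum_i w ord0 i = 1]].

Definition affine_dim k (P : 'M[R]_(k.+1, n)) : nat :=
  \rank (\matrix_i (row i P - row ord0 P)).

(* The boundary is a finite union of (n-1)-dimensional convex polytopes; no
   Lipschitz condition is included. *)
Definition polyhedral_boundary Omega : Prop :=
  exists (N : nat) (k : 'I_N -> nat) (P : forall l, 'M[R]_((k l).+1, n)),
    (forall l, affine_dim (P l) = n.-1) /\
    closure Omega `\` Omega° = \bigcup_l polytope (P l).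

Definition bounded_polyhedral_domain Omega : Prop :=
  [/\ Omega !=set0, open Omega, connected Omega, bounded_set Omega &
      polyhedral_boundary Omega].

End domains.

(* Elements of L2, H1, H10 and V are represented by functions on R^n, of which
   only the values almost everywhere on Omega matter. *)

Section scalar_spaces.
Context (R : realType) (n : nat) (Omega : set 'rV[R]_n).
Local Notation leb := (lebesgue_rV R n).
Implicit Types f g w phi : 'rV[R]_n -> R.

Definition L2 f : Prop := (f \_ Omega) \in Lfun leb 2%:E.

Definition Linfty_norm f : \bar R := Lnorm leb +oo%E (EFin \o (f \_ Omega)).

Definition L2_orthogonal_basis (psi : nat -> 'rV[R]_n -> R) : Prop :=
  [/\ forall j, L2 (psi j),
      forall j, \int[leb]_(x in Omega) (psi j x) ^+ 2 != 0,
      forall i j, i != j -> \int[leb]_(x in Omega) (psi i x * psi j x) = 0 &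
      forall g, L2 g -> exists c : nat -> R,
        (fun N => \int[leb]_(x in Omega)
           (g x - \sum_(j < N) c j * psi j x) ^+ 2) @ \oo --> (0 : R)].

Definition pderiv (i : 'I_n) f : 'rV[R]_n -> R :=
  fun x => 'D_(delta_mx ord0 i) f x.

Definition smooth f : Prop := forall s : seq 'I_n,
  continuous (foldr pderiv f s) /\
  forall i x, derivable (foldr pderiv f s) x (delta_mx ord0 i).

Definition test_function phi : Prop :=
  let supp := closure [set x | phi x != 0] in
  [/\ smooth phi, compact supp & supp `<=` Omega].

Definition is_weak_pderiv (i : 'I_n) w g : Prop :=
  forall phi, test_function phi ->
    \int[leb]_(x in Omega) (w x * pderiv i phi x) =
    - \int[leb]_(x in Omega) (g x * phi x).

(* A representative of the weak derivative in L2, when there is one. *)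
Definition weak_pderiv (i : 'I_n) w : 'rV[R]_n -> R :=
  xget (cst 0) [set g | L2 g /\ is_weak_pderiv i w g].

Definition H1 w : Prop :=
  L2 w /\ forall i, exists g, L2 g /\ is_weak_pderiv i w g.

Definition H1_norm w : R :=
  Num.sqrt (\int[leb]_(x in Omega) (w x) ^+ 2 +
    \sum_(i < n) \int[leb]_(x in Omega) (weak_pderiv i w x) ^+ 2).

Definition H10 w : Prop :=
  H1 w /\ exists phi : nat -> 'rV[R]_n -> R,
    (forall k, test_function (phi k)) /\
    (fun k => H1_norm (fun x => w x - phi k x)) @ \oo --> (0 : R).

End scalar_spaces.

Section elasticity.
Context (R : realType) (n : nat) (Omega : set 'rV[R]_n).
Local Notation leb := (lebesgue_rV R n).
Local Notation field := ('rV[R]_n -> 'rV[R]_n).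
Implicit Types v w u : field.

Definition component v (i : 'I_n) : 'rV[R]_n -> R := fun x => v x ord0 i.

Definition V v : Prop := forall i, H10 Omega (component v i).

Definition V_norm v : R :=
  Num.sqrt (\sum_(i < n) (H1_norm Omega (component v i)) ^+ 2).

(* f is a map on representatives; the bound makes it depend only on the class. *)
Definition V_dual (f : field -> R) : Prop :=
  (forall (a : R) v w, V v -> V w -> f (fun x => a *: v x + w x) = a * f v + f w) /\
  (exists M : R, forall v, V v -> `|f v| <= M * V_norm v).

Definition V_dual_norm (f : field -> R) : R :=
  sup [set `|f v| | v in [set v | V v /\ V_norm v <= 1]].

Definition strain v (x : 'rV[R]_n) : 'M[R]_n :=
  \matrix_(i, j) (2^-1 * (weak_pderiv Omega i (component v j) x +
                          weak_pderiv Omega j (component v i) x)).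

Definition ddot (A B : 'M[R]_n) : R := \sum_i \sum_j A i j * B i j.

Definition diverg v (x : 'rV[R]_n) : R :=
  \sum_i weak_pderiv Omega i (component v i) x.

Definition strain_norm v : R :=
  Num.sqrt (\int[leb]_(x in Omega) ddot (strain v x) (strain v x)).

Definition weak_solution (mu lambda : 'rV[R]_n -> R) (f : field -> R) u : Prop :=
  V u /\ forall v, V v ->
    \int[leb]_(x in Omega) (2 * mu x * ddot (strain u x) (strain v x) +
                            lambda x * diverg u x * diverg v x) = f v.

End elasticity.

(* Sequences indexed by j >= 1 in the mathematics are indexed by j : nat. *)

Section parametric.
Context (R : realType).

Definition U : set (nat -> R) := [set y | forall j, - 2^-1 < y j < 2^-1].

(* limn is total: it has a junk value at points x where the series diverges,
   which form a null set when the sup norms of the a j are summable. *)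
Definition affine_coef n (a0 : 'rV[R]_n -> R) (a : nat -> 'rV[R]_n -> R)
    (y : nat -> R) (x : 'rV[R]_n) : R :=
  a0 x + limn (fun N => \sum_(j < N) y j * a j x).

Section V_valued.
Context n (Omega : set 'rV[R]_n).
Local Notation field := ('rV[R]_n -> 'rV[R]_n).

(* w is the derivative at t, for the norm of V, of a V-valued function. *)
Definition V_is_derive (g : R -> field) (t : R) (w : field) : Prop :=
  V Omega w /\
  (fun h : R => V_norm Omega (fun x => h^-1 *: (g (t + h) x - g t x) - w x))
    @ 0^' --> (0 : R).

Definition V_derivable g t : Prop := exists w, V_is_derive g t w.

Definition V_derive g t : field := xget (cst 0) (V_is_derive g t).

(* inl j is the direction y_j, and inr j the direction z_j. *)
Definition direction : choiceType := (nat + nat)%type.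

Definition set_coord (y : nat -> R) (j : nat) (t : R) : nat -> R :=
  fun k => if k == j then t else y k.

Definition slice (F : (nat -> R) -> (nat -> R) -> field) (i : direction)
    (y z : nat -> R) : R -> field :=
  match i with
  | inl j => fun t => F (set_coord y j t) z
  | inr j => fun t => F y (set_coord z j t)
  end.

Definition coordinate (i : direction) (y z : nat -> R) : R :=
  match i with inl j => y j | inr j => z j end.

Definition partial (i : direction) (F : (nat -> R) -> (nat -> R) -> field) :
    (nat -> R) -> (nat -> R) -> field :=
  fun y z => V_derive (slice F i y z) (coordinate i y z).

(* The last direction in s is differentiated first. *)
Definition partials (s : seq direction) F := foldr partial F s.

Fixpoint partials_exist (s : seq direction) F : Prop :=
  match s with
  | [::] => True
  | i :: s' => partials_exist s' F /\
      forall y z, U y -> U z ->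
        V_derivable (slice (partials s' F) i y z) (coordinate i y z)
  end.

End V_valued.

Local Open Scope fset_scope.

Definition multi_index := {fsfun nat -> nat with 0%N}.
Implicit Types alpha beta : multi_index.

Definition mi_order alpha : nat := (\sum_(j <- finsupp alpha) alpha j)%N.

Definition mi_pow (b : nat -> R) alpha : R :=
  \prod_(j <- finsupp alpha) b j ^+ alpha j.

(* The list with alpha_j occurrences of y_j and beta_j occurrences of z_j. *)
Definition mi_directions alpha beta : seq direction :=
  flatten [seq nseq (alpha j) (inl j : direction) | j <- finsupp alpha] ++
  flatten [seq nseq (beta j) (inr j : direction) | j <- finsupp beta].

End parametric.

(* Main.v *)
(* Differentiating the weak equation A(p) u(p) = f, in which A is affine in the
   parameters, and testing with the derivative itself gives by coercivity
     2 mu_min |e(d^s u)| <= sum over the entries i of s of |b_i| |e(d^(s - i) u)|,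
   because each derivative falls on A at most once; induction on |s| yields the
   factor |s|! and the product of the b_i.  The derivatives exist because the
   difference quotients satisfy the same kind of equation, so that they are Cauchy
   in the strain norm, and V is complete.  The strain norm controls the norm of V by
   Korn's inequality on H10 (the cross terms d_i v_j d_j v_i integrate to those of
   (div v)^2) and by Poincare's (integrate x_i d_i(phi^2) by parts).  Weak
   derivatives are unique almost everywhere by the fundamental lemma of the calculus
   of variations, tested with exponential bumps. *)

Require Import Defs.
From HB Require Import structures.
From mathcomp Require Import all_boot all_order all_algebra finmap.
From mathcomp Require Import all_classical all_reals all_analysis.
From mathcomp Require Import measurable_realfun ess_sup_inf ring lra.
Set Implicit Arguments.
Unset Strict Implicit.
Unset Printing Implicit Defensive.
Import Order.TTheory GRing.Theory Num.Theory.
Import numFieldNormedType.Exports.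

Local Open Scope classical_set_scope.
Local Open Scope ring_scope.

(** * Integration on open sets of row vectors *)

(** The induction runs over ordered lists [s] of directions, and its bound depends on [s] only up to
    permutation; multi-indices enter at the very end. One statement has to carry membership in [V],
    the equation, the bound and the existence of the derivative together, at all parameters at once,
    since each of them at order k + 1 uses the others at lower orders near the point. Fields are
    plain functions and [weak_pderiv] is a choice of representative, so linearity holds only almost
    everywhere and all norms are seminorms. The core is therefore proved for an abstract linear set
    [V] with two equivalent seminorms, [S] (strain) and [N] (the norm of V). Every constant is
    measured against the coercivity constant 2 mu_min. A direction y_j costs 2 |psi_j|, which gives
    [b_tilde]; a direction z_j costs d |phi_j|, because the divergence is a trace of d strain
    entries, which gives [b_hat] with its factor d/2. Korn's constant K is paid twice in the last
    estimate, once to bound f by the strain norm and once to return to the norm of V, hence C = K^2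
    + 1. *)

Lemma itv_swap (R : realType) (x q d : R) : x - d < q < x + d -> q - d < x < q + d.
Proof. by move=> /andP[? ?]; apply/andP; split; lra. Qed.

Lemma le_widen (R : realType) (x M N : R) : - M <= x -> x <= M -> M <= N -> - N <= x <= N.
Proof. by move=> ? ? ?; apply/andP; split; lra. Qed.

Lemma dist_via (R : realType) (x y q d e : R) : x - d < q < x + d -> q - d <= y <= q + d ->
  d < e / 2 -> `|x - y| < e.
Proof.
by move=> /andP[? ?] /andP[? ?] ?; rewrite ltr_norml; apply/andP; split; lra.
Qed.

Section rV_borel.
Context (R : realType).

Definition rect n (A : 'I_n -> set R) : set 'rV[R]_n :=
  [set x | forall i, A i (x ord0 i)].

Lemma measurable_rect n (A : 'I_n -> set R) : (forall i, measurable (A i)) ->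
  measurable (rect A).
Proof.
move=> mA.
rewrite (_ : rect A = \bigcap_(i in [set: 'I_n]) (@rV_coord R n i @^-1` A i)).
  apply: fin_bigcap_measurable => [|i _]; first exact: finite_finset.
  by rewrite -[X in measurable X]setTI; exact: measurable_rV_coord.
by apply/seteqP; split => x /= Ax i => [_|]; exact: Ax.
Qed.

(** Boxes with rational centres and radii 1/(k + 1) are countably many. Only those whose closed box
    lies in [A] are kept: bumps on such a box then have their support inside [A], which the
    fundamental lemma needs. *)
Lemma open_rV_cover n (A : set 'rV[R]_n) : open A ->
  exists (P : set nat) (a b : nat -> 'I_n -> R),
    (forall k, P k -> rect (fun i => `[a k i, b k i]%classic) `<=` A) /\
    A = \bigcup_(k in P) rect (fun i => `]a k i, b k i[%classic).
Proof.
move=> oA.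
pose T : countType := ({ffun 'I_n -> rat} * nat)%type.
pose a (q : T) i : R := ratr (q.1 i) - q.2.+1%:R^-1.
pose b (q : T) i : R := ratr (q.1 i) + q.2.+1%:R^-1.
pose good (q : T) := rect (fun i => `[a q i, b q i]%classic) `<=` A.
(* A number that codes nothing decodes to the box of radius 1 about the origin; it counts only if
   that box is itself good. *)
pose u k : T := odflt ([ffun=> 0], 0%N) (@choice.unpickle T k).
exists [set k | good (u k)], (a \o u), (b \o u); split => [k //|].
apply/seteqP; split => [x Ax|x [k gk xk]]; last first.
  by apply: gk => i; apply: subset_itv_oo_cc; exact: xk.
have /nbhs_ballP[e /= e0 eA] : nbhs x A by exact: open_nbhs_nbhs.
have [k ke] : exists k : nat, k.+1%:R^-1 < e / 2.
  have [k _ /(_ k (leqnn _)) /= H] := near_infty_natSinv_lt (PosNum (divr_gt0 e0 (ltr0n R 2))).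
  by exists k.
have qex i : exists q : rat, x ord0 i - k.+1%:R^-1 < ratr q < x ord0 i + k.+1%:R^-1.
  have : x ord0 i - k.+1%:R^-1 < x ord0 i + k.+1%:R^-1 :> R.
    by rewrite ltrD2l gt0_cp// invr_gt0.
  by move/rat_in_itvoo => [q]; rewrite in_itv/=; exists q.
pose q : {ffun 'I_n -> rat} := [ffun i => projT1 (cid (qex i))].
have Hq i : x ord0 i - k.+1%:R^-1 < ratr (q i) < x ord0 i + k.+1%:R^-1.
  by rewrite ffunE; case: cid.
have uq : u (@choice.pickle T (q, k)) = (q, k) by rewrite /u choice.pickleK.
exists (@choice.pickle T (q, k)) => /=; last first.
  by move=> i /=; rewrite uq /a /b /= in_itv/=; exact: itv_swap (Hq i).
rewrite /good uq => y Hy; apply: eA; split => // j i; rewrite ord1.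
have := Hy i; rewrite /a /b /= in_itv/= => Hyi.
exact: (dist_via (Hq i) Hyi ke).
Qed.

(** The sigma-algebra is generated by the coordinates, so openness becomes measurability only
    through a countable cover by boxes. *)
Lemma open_measurable_rV n (A : set 'rV[R]_n) : open A -> measurable A.
Proof.
move=> /open_rV_cover[P [a [b [_ ->]]]].
by apply: bigcup_measurable => k _; apply: measurable_rect => i; exact: measurable_itv.
Qed.

Lemma continuous_measurable_rV n (f : 'rV[R]_n -> R) :
  continuous f -> measurable_fun setT f.
Proof.
move=> /continuousP cf; apply: (measurability _ (RGenOpens.measurableE R)).
move=> _ [_ [a [b ->] <-]]; rewrite setTI; apply: open_measurable_rV.
exact/cf/interval_open.
Qed.

Definition box_supported n (M : R) (g : 'rV[R]_n -> R) :=
  forall x, g x != 0 -> forall i, `|x ord0 i| <= M.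

Let cbox n (M : R) : set 'rV[R]_n := [set x | forall i, `[- M, M]%classic (x ord0 i)].

Let mcbox n M : measurable (@cbox n M).
Proof. by apply: (measurable_rect (A := fun=> _)) => i; exact: measurable_itv. Qed.

Lemma cbox_finite n (M : R) :
  (lebesgue_rV R n [set x | forall i, (`[(- M)%R, M]%classic : set R) (x ord0 i)] < +oo)%E.
Proof.
have H : [set x : 'rV[R]_n | forall i, (`[- M, M]%classic : set R) (x ord0 i)] `<=`
   [set x | forall i, - Num.max M 0 <= x ord0 i <= Num.max M 0].
  move=> x /= Hx i; have := Hx i; rewrite in_itv/= => /andP[h1 h2].
  have : M <= Num.max M 0 by rewrite le_max lexx.
  exact: le_widen h1 h2.
apply: (@le_lt_trans _ _ (lebesgue_rV R n [set x | forall i, - Num.max M 0 <= x ord0 i <= Num.max M 0])).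
  apply: le_measure => //; rewrite inE; first exact: mcbox.
  rewrite [X in measurable X](_ : _ = @cbox n (Num.max M 0)); first exact: mcbox.
  by apply/seteqP; split => x /= Hx i; have := Hx i; rewrite /= in_itv.
rewrite lebesgue_rV_box ?ltry// => i.
by rewrite ge0_cp// le_max lexx orbT.
Qed.

Lemma continuous_box_bounded n (M : R) (g : 'rV[R]_n -> R) :
  continuous g -> box_supported M g -> exists C, forall x, `|g x| <= C.
Proof.
move=> cg bg.
have cK : compact (@cbox n M).
  by apply: (@rV_compact R n (fun=> `[- M, M]%classic)) => i; exact: segment_compact.
have : compact (g @` @cbox n M).
  by apply: continuous_compact => //; exact: continuous_subspaceT.
move=> /compact_bounded [C [_ HC]].
(* The maximum with 0 serves the points outside the box, where [g] vanishes and [C] says nothing. *)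
exists (Num.max 0 (C + 1)) => x; have [->|gx0] := eqVneq (g x) 0.
  by rewrite normr0 le_max lexx.
rewrite le_max; apply/orP; right; apply: HC; first by rewrite ltrDl.
exists x => // i; rewrite /= in_itv/= -ler_norml; exact: bg.
Qed.

Lemma continuous_box_integrable n (M : R) (g : 'rV[R]_n -> R) :
  continuous g -> box_supported M g ->
  (lebesgue_rV R n).-integrable setT (EFin \o g).
Proof.
move=> cg bg; have [C HC] := continuous_box_bounded cg bg.
have gE : EFin \o g = (EFin \o g) \_ (cbox M).
  apply/funext => x; rewrite patchE; case: ifPn => //; rewrite notin_setE => nx /=.
  have [->//|gx0] := eqVneq (g x) 0; exfalso; apply: nx => i.
  by rewrite /= in_itv/= -ler_norml; exact: bg.
rewrite gE; apply/(integrable_mkcond _ _).1; first exact: mcbox.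
apply: measurable_bounded_integrable; first exact: mcbox.
- exact: cbox_finite.
- by apply: measurable_funTS; exact: continuous_measurable_rV.
- exists C; split; first exact: num_real.
  by move=> y Cy x _ /=; apply: (le_trans (HC x)); exact: ltW.
Qed.

Lemma integrable_rV_cons n (g : 'rV[R]_n.+1 -> R) :
  (lebesgue_rV R n.+1).-integrable setT (EFin \o g) ->
  (lebesgue_measure \x lebesgue_rV R n)%E.-integrable setT (EFin \o g \o @rV_cons R n).
Proof.
(* The ascription fixes the measurable structure on the real line that [lebesgue_measure] uses, so
   that the pushforward lemmas unify. *)
have mcons : @measurable_fun _ _ (g_sigma_algebraType (R.-ocitv.-measurable) * 'rV[R]_n)%type 'rV[R]_n.+1 setT (@rV_cons R n) := @measurable_rV_cons R n.
move=> /integrableP[mg ig]; apply/integrableP; split.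
  move=> _ Y mY; rewrite setTI comp_preimage.
  by have := mg measurableT Y mY; rewrite setTI => /(mcons measurableT); rewrite setTI.
apply: le_lt_trans ig.
rewrite [leRHS](ge0_integral_pushforward mcons _ measurableT (f := abse \o (EFin \o g))).
- exact: lexx.
- exact: measurableT_comp.
- by move=> y _; exact: abse_ge0.

Qed.

Lemma integral_rV_cons n (g : 'rV[R]_n.+1 -> R) :
  (lebesgue_rV R n.+1).-integrable setT (EFin \o g) ->
  (\int[lebesgue_rV R n.+1]_x (g x)%:E =
   \int[(lebesgue_measure \x lebesgue_rV R n)%E]_p (g (rV_cons p))%:E)%E.
Proof.
move=> ig; have [mg _] := integrableP _ _ _ ig.
have igc := integrable_rV_cons ig.
have mcons : @measurable_fun _ _ (g_sigma_algebraType (R.-ocitv.-measurable) * 'rV[R]_n)%type 'rV[R]_n.+1 setT (@rV_cons R n) := @measurable_rV_cons R n.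
by rewrite [LHS](integral_pushforward mcons mg).
Qed.

Lemma rV_cons_shift0 n (h t : R) (x : 'rV[R]_n) :
  h *: delta_mx ord0 ord0 + rV_cons (t, x) = rV_cons (h + t, x).
Proof.
apply/rowP => k; rewrite !mxE eqxx/=.
case: unliftP => [j ->|->]; first by rewrite -(inj_eq val_inj)/= mulr0 add0r.
by rewrite eqxx mulr1.
Qed.

Lemma rV_cons_shift n (h t : R) (j : 'I_n) (x : 'rV[R]_n) :
  h *: delta_mx ord0 (lift ord0 j) + rV_cons (t, x) =
  rV_cons (t, h *: delta_mx ord0 j + x).
Proof.
apply/rowP => k; rewrite !mxE eqxx/=.
case: unliftP => [j' ->|->].
  by rewrite !mxE !eqxx/= (inj_eq (@lift_inj _ _)).
by rewrite -(inj_eq val_inj)/= mulr0 add0r.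
Qed.

Lemma rV_cons_continuousl n (x : 'rV[R]_n) : continuous (fun t => rV_cons (t, x)).
Proof.
move=> t; apply/cvgrPdist_lt => e e0; near=> s.
rewrite /Num.Def.normr/= mx_normrE; apply/bigmax_ltP; split => // -[a k] _ /=.
rewrite !mxE; case: unliftP => [j _|_]; first by rewrite subrr normr0.
near: s; exact: (@cvgr_dist_lt _ R _ _ _ id t).
Unshelve. all: by end_near. Qed.

Lemma rV_cons_continuousr n (t : R) : continuous (fun x : 'rV[R]_n => rV_cons (t, x)).
Proof.
move=> x; apply/(@cvgrPdist_lt _ _ _ (nbhs x)) => e e0; near=> y.
rewrite /Num.Def.normr/= mx_normrE; apply/bigmax_ltP; split => // -[a k] _ /=.
rewrite !mxE; case: unliftP => [j _|_]; last by rewrite subrr normr0.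
have : `|x - y| < e by near: y; exact: cvgr_dist_lt.
by rewrite {1}/Num.Def.normr/= mx_normrE => /bigmax_ltP[_ /(_ (ord0, j) isT)]; rewrite !mxE.
Unshelve. all: by end_near. Qed.

(** If one coordinate of x exceeds M in absolute value, so does that coordinate of every nearby
    point; the difference quotient is then eventually 0. *)
Lemma box_supported_pderiv n M i (g : 'rV[R]_n -> R) :
  box_supported M g -> box_supported M (pderiv i g).
Proof.
move=> bg x; apply: contra_neqP => /existsNP[k /negP]; rewrite -ltNge => Mx.
have g0 (y : 'rV[R]_n) : M < `|y ord0 k| -> g y = 0.
  by move=> My; apply: contraTeq My => /bg/(_ k); rewrite -leNgt.
apply/cvg_lim => //; apply: cvg_near_cst; near=> h.
rewrite /= !g0 ?subr0 ?scaler0//= !mxE.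
have : `|h| < `|x ord0 k| - M.
  near: h; apply: dnbhs0_lt; by rewrite subr_gt0.
set c := (X in `|h * X + _|).
have : `|c| <= 1 by rewrite /c; case: (_ && _); rewrite ?normr1 ?normr0.
move=> c1 hM; rewrite addrC.
have := lerB_dist (x ord0 k) (- (h * c)); rewrite opprK normrN normrM => H.
apply: lt_le_trans H; rewrite ltrBrDr -ltrBrDl; apply: le_lt_trans hM.
by rewrite ler_piMr.
Unshelve. all: by end_near. Qed.

(** The fundamental theorem of calculus on [-N, N] with N = |M| + 1: this lies strictly beyond the
    support, so [f] vanishes at both ends and its derivative vanishes outside. *)
Lemma integral_derive1_box (M : R) (f : R -> R) :
  (forall t, derivable f t 1) -> continuous (derive1 f) ->
  (forall t, f t != 0 -> `|t| <= M) ->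
  (\int[lebesgue_measure]_t (derive1 f t)%:E = 0)%E.
Proof.
move=> df cf' bf; pose N := `|M| + 1.
have f0 t : N <= `|t| -> f t = 0.
  move=> Nt; apply: contraTeq Nt => /bf tM; rewrite -ltNge (le_lt_trans tM)//.
  by rewrite /N; have := ler_norm M; lra.
have f'0 t : N < `|t| -> derive1 f t = 0.
  move=> Nt; rewrite derive1E; apply/cvg_lim => //.
  apply: cvg_near_cst; near=> h.
  rewrite /= (f0 t (ltW Nt)) f0 ?subr0 ?scaler0// /GRing.scale/= mulr1 addrC.
  have : `|h| < `|t| - N by near: h; apply: dnbhs0_lt; rewrite subr_gt0.
  by have := lerB_dist t (- h); rewrite opprK normrN; lra.
have N0 : 0 < N by rewrite /N; have := normr_ge0 M; lra.
have cf : continuous f.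
  by move=> t; apply: differentiable_continuous; apply/derivable1_diffP.
transitivity (\int[lebesgue_measure]_(t in `[(- N)%R, N]) (derive1 f t)%:E)%E.
  rewrite [RHS]integral_mkcond; apply: eq_integral => t _; rewrite patchE.
  case: ifPn => //; rewrite notin_setE/= in_itv/= -ler_norml => /negP.
  by rewrite -ltNge => /f'0 ->.
rewrite (@continuous_FTC2 _ (derive1 f) f); last first.
- by move=> t _.
- split.
  + by move=> t _; exact: df.
  + by apply: cvg_at_right_filter; exact: cf.
  + by apply: cvg_at_left_filter; exact: cf.
- exact: continuous_subspaceT.
- by lra.
by rewrite !f0 ?subee// ?normrN ger0_norm// ltW.
Unshelve. all: by end_near. Qed.

(** Fubini after splitting off coordinate 0. If i is that coordinate, the inner integral is
    one-dimensional and vanishes; otherwise the inner integral runs over the remaining coordinates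
    and vanishes by induction. In dimension 0 there is no index i. *)
Lemma integral_pderiv n M i (g : 'rV[R]_n -> R) : continuous g ->
  (forall x, derivable g x (delta_mx ord0 i)) -> continuous (pderiv i g) ->
  box_supported M g -> (\int[lebesgue_rV R n]_x (pderiv i g x)%:E = 0)%E.
Proof.
elim: n => [|n IHn] in i g *; first by case: i.
move=> cg dg cdg bg.
have ig := continuous_box_integrable cdg (box_supported_pderiv bg).
rewrite integral_rV_cons//; have igc := integrable_rV_cons ig.
have [j ij|i0] := unliftP ord0 i; last first.
  rewrite -(integral21_prod_meas1 igc); apply: integral0_eq => x _.
  pose f t := g (rV_cons (t, x)).
  have fE : (fun t => pderiv i g (rV_cons (t, x))) = derive1 f.
    apply/funext => t; rewrite derive1E /pderiv /derive i0.
    do 2!f_equal; apply/funext => h /=; rewrite rV_cons_shift0 /f.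
    by rewrite /GRing.scale/= mulr1.
  transitivity (\int[lebesgue_measure]_t (derive1 f t)%:E)%E.
    by apply: eq_integral => t _; rewrite -fE.
  apply: (@integral_derive1_box M).
  - move=> t; have := dg (rV_cons (t, x)); rewrite /derivable i0.
    set F := (X in cvg (X @ _)); set G := (X in _ -> cvg (X @ _)).
    suff -> : F = G by [].
    by apply/funext => h; rewrite /F /G /= rV_cons_shift0 /f /GRing.scale/= mulr1.
  - rewrite -fE => t; apply: continuous_comp; [exact: rV_cons_continuousl|exact: cdg].
  - by move=> t /bg /(_ ord0); rewrite mxE unlift_none.
rewrite -(integral12_prod_meas1 igc); apply: integral0_eq => t _.
pose f x := g (rV_cons (t, x)).
have fE : (fun x => pderiv i g (rV_cons (t, x))) = pderiv j f.
  apply/funext => x; rewrite /pderiv /derive ij.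
  by do 2!f_equal; apply/funext => h /=; rewrite rV_cons_shift.
transitivity (\int[lebesgue_rV R n]_x (pderiv j f x)%:E)%E.
  by apply: eq_integral => x _; rewrite -fE.
apply: IHn.
- by move=> x; apply: continuous_comp; [exact: rV_cons_continuousr|exact: cg].
- move=> x; have := dg (rV_cons (t, x)); rewrite /derivable ij.
  set F := (X in cvg (X @ _)); set G := (X in _ -> cvg (X @ _)).
  suff -> : F = G by [].
  by apply/funext => h; rewrite /F /G /= rV_cons_shift.
- by rewrite -fE => x; apply: continuous_comp; [exact: rV_cons_continuousr|exact: cdg].
- by move=> x /bg bx k; have := bx (lift ord0 k); rewrite mxE liftK.
Qed.

End rV_borel.

(** * Bump functions and the fundamental lemma *)

Lemma is_derive_slice (R : realType) n (f : 'rV[R]_n -> R) (x v : 'rV[R]_n) (d : R) :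
  is_derive (0 : R) 1 (fun h : R => f (h *: v + x)) d -> is_derive x v f d.
Proof.
move=> [fxv <-]; apply: DeriveDef; first exact/derivable1P.
rewrite /derive; set F := (X in lim (X @ _)); set G := (X in _ = lim (X @ _)).
suff -> : F = G by [].
by apply/funext => h; rewrite /F /G /= addr0 scale0r add0r [_%:A]mulr1.
Qed.

Section bump1.
Context (R : realType) (a b c : R).
Hypothesis c0 : 0 < c.

(* With q = c (t - a) (b - t), the derivative of p q^-m exp(-1/q) is
   (p' q^2 - m p q q' + p q') q^-(m+2) exp(-1/q), of the same shape. *)
Definition bumpq : {poly R} := c *: (('X - a%:P) * (b%:P - 'X)).

Definition bump1 (p : {poly R}) m (t : R) : R :=
  if (a < t < b) then p.[t] * (bumpq.[t])^-1 ^+ m * expR (- (bumpq.[t])^-1) else 0.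

Definition bump1_next (p : {poly R}) m : {poly R} :=
  p^`() * bumpq ^+ 2 - (p * bumpq^`() * bumpq) *+ m + p * bumpq^`().

Lemma bumpqE t : bumpq.[t] = c * ((t - a) * (b - t)).
Proof. by rewrite /bumpq !hornerE. Qed.

Lemma bumpq_gt0 t : a < t < b -> 0 < bumpq.[t].
Proof.
move=> /andP[at_ tb]; rewrite bumpqE mulr_gt0// mulr_gt0//; lra.
Qed.

(** The term of degree m + 2 of the exponential series already dominates. Two degrees more than m
    are taken so that r = 1/q leaves a factor q^2. *)
Lemma expRN_le (r : R) m : 0 < r -> r ^+ m * expR (- r) <= m.+2`!%:R * r^-1 ^+ 2.
Proof.
move=> r0; rewrite expRN ler_pdivrMr ?expR_gt0//.
have rm : 0 < r ^+ m.+2 / m.+2`!%:R.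
  by rewrite divr_gt0 ?exprn_gt0// ltr0n fact_gt0.
have := expR_ge1Dxn m.+1 (ltW r0) => H.
have H2 : r ^+ m.+2 / m.+2`!%:R <= expR r by apply: le_trans H; rewrite lerDr.
have f0 : m.+2`!%:R != 0 :> R by rewrite pnatr_eq0 -lt0n fact_gt0.
rewrite (_ : r ^+ m = m.+2`!%:R * r^-1 ^+ 2 * (r ^+ m.+2 / m.+2`!%:R)).
  by rewrite ler_pM2l// mulr_gt0 ?ltr0n ?fact_gt0// exprn_gt0// invr_gt0.
have r00 : r != 0 by rewrite gt_eqF.
have -> : r ^+ m.+2 = r ^+ m * r ^+ 2 by rewrite -exprD addn2.
by rewrite exprVn; field; rewrite f0 r00.
Qed.

(* This quadratic decay makes bump1 differentiable at the end points. *)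
Lemma bump1_le p m : exists2 K, 0 <= K &
  forall t x, ~~ (a < x < b) -> `|bump1 p m t| <= K * (t - x) ^+ 2.
Proof.
have [Kp HKp] := poly_itv_bound p a b.
pose K := `|Kp| * (m.+2`!%:R * (c * (b - a)) ^+ 2).
have K0 : 0 <= K by rewrite /K mulr_ge0// mulr_ge0// ?ler0n// sqr_ge0.
exists K => // t x xab; rewrite /bump1; case: ifPn => tab; last first.
  by rewrite normr0 mulr_ge0// sqr_ge0.
have q0 := bumpq_gt0 tab; have /andP[at_ tb] := tab.
rewrite -mulrA normrM (ger0_norm (x := _ ^+ m * _)); last first.
  by rewrite mulr_ge0 ?expR_ge0// exprn_ge0// invr_ge0 ltW.
rewrite /K -(mulrA `|Kp|) -(mulrA _%:R); apply: ler_pM => //.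
- by rewrite mulr_ge0 ?expR_ge0// exprn_ge0// invr_ge0 ltW.
- apply: le_trans (ler_norm _); apply: HKp; lra.
apply: (le_trans (expRN_le m _)); first by rewrite invr_gt0.
(* It remains to see that q <= c (b - a) |t - x|: the factor of q for the end point between t and x
   is at most |t - x|, and the other one is at most b - a. *)
rewrite invrK ler_wpM2l ?ler0n// -exprMn -ler_sqrt ?sqr_ge0// !sqrtr_sqr.
rewrite (ger0_norm (ltW q0)) normrM (ger0_norm (x := c * _)); last first.
  by rewrite mulr_ge0 ?ltW//; lra.
rewrite bumpqE -mulrA ler_pM2l//.
have [xa|xa] := leP x a.
  apply: (@le_trans _ _ ((b - a) * (t - x))); last by rewrite ler_pM2l ?ler_norm//; lra.
  by rewrite mulrC ler_pM//; lra.
have xb : b <= x by rewrite leNgt; apply: contra xab => ->; rewrite xa.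
apply: (@le_trans _ _ ((b - a) * (x - t))); first by rewrite ler_pM//; lra.
by rewrite distrC ler_pM2l ?ler_norm//; lra.
Qed.

Lemma is_derive_bump1 p m (t : R) :
  is_derive t (1 : R) (bump1 p m) (bump1 (bump1_next p m) m.+2 t).
Proof.
have [tab|tab] := boolP (a < t < b); last first.
  have [K K0 HK] := bump1_le p m.
  have f0 : bump1 p m t = 0 by rewrite /bump1 (negbTE tab).
  have -> : bump1 (bump1_next p m) m.+2 t = 0 by rewrite /bump1 (negbTE tab).
  suff H : h^-1 *: ((bump1 p m \o shift t) (h *: 1) - bump1 p m t) @[h --> (0:R)^'] --> (0 : R).
    by apply: DeriveDef; [exact: cvgP H|exact: cvg_lim H].
  apply/cvgr0Pnorm_le => e e0; near=> h.
  rewrite f0 subr0 /= /GRing.scale/= mulr1 normrM normrV ?unitfE; last by near: h; exact: nbhs_dnbhs_neq.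
  have h0 : 0 < `|h| by rewrite normr_gt0; near: h; exact: nbhs_dnbhs_neq.
  rewrite mulrC ler_pdivrMr//; apply: (le_trans (HK (h + t) t tab)).
  rewrite addrK -real_normK ?num_real// expr2 mulrA ler_pM2r//.
  have : `|h| <= e / (K + 1) by near: h; apply: dnbhs0_le; rewrite divr_gt0//; lra.
  rewrite ler_pdivlMr; last lra.
  by apply: le_trans; rewrite mulrC ler_pM2l//; lra.
have q0 := bumpq_gt0 tab.
have qn0 : bumpq.[t] != 0 by rewrite gt_eqF.
pose r := fun t => (bumpq.[t])^-1.
have dq : is_derive t (1:R) (horner bumpq) (bumpq^`().[t]) := is_derive_poly _ _.
have dr : is_derive t (1:R) r (- (bumpq.[t]) ^- 2 *: bumpq^`().[t]).
  by apply: DeriveDef; [exact: derivableV|rewrite /r deriveV// derive_val].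
have dp : is_derive t (1:R) (horner p) (p^`().[t]) := is_derive_poly _ _.
have de : is_derive t (1:R) (expR \o (- r)) (expR (- r t) * - (- (bumpq.[t]) ^- 2 *: bumpq^`().[t])).
  by apply: is_derive1_comp.
have dF : is_derive t (1:R) (horner p * r ^+ m * (expR \o (- r))) (bump1 (bump1_next p m) m.+2 t).
  apply: is_derive_eq; rewrite /bump1 tab /bump1_next.
  rewrite !fctE/= -/(r t) /GRing.scale/=.
  rewrite !(hornerD, hornerN, hornerM, hornerMn, horner_exp).
  rewrite /r; set q := bumpq.[t] in qn0 *; set e := expR _.
  set q' := bumpq^`().[t]; set p0 := p.[t]; set p' := p^`().[t].
  have rm : forall k, (q^-1) ^+ k.+2 = q^-1 ^+ k * q^-1 ^+ 2 by move=> k; rewrite -exprD addn2.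
  rewrite rm -(mulr_natl (p0 * q' * q)).
  (* The power rule produces [m.-1]; at m = 0 the truncated exponent is harmless because of the
     factor m. *)
  have mE : m%:R * q^-1 ^+ m.-1 = m%:R * q * q^-1 ^+ m.
    by case: (m) => [|k]; rewrite ?mul0r//= exprS; field.
  rewrite mE; set Q := q^-1 ^+ m.
  by field.
apply: near_eq_is_derive dF.
near=> s; rewrite /bump1 ifT.
  by rewrite !fctE.
near: s.
have := @near_in_itvoo R a b t; rewrite in_itv/= => /(_ tab).
by apply: filterS => s; rewrite in_itv.
Unshelve. all: by end_near. Qed.

Lemma bump1_continuous p m : continuous (bump1 p m).
Proof.
move=> t; apply: differentiable_continuous; apply/derivable1_diffP.
by have [] := is_derive_bump1 p m t.
Qed.

End bump1.

Lemma bump1_1_bound (R : realType) (a b c : R) t : 0 < c -> 0 <= bump1 a b c 1 0 t <= 1.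
Proof.
move=> c0; rewrite /bump1; case: ifPn => [tab|_]; last by rewrite lexx ler01.
rewrite hornerC expr0 !mul1r expR_ge0 -[leRHS]expR0 ler_expR oppr_le0 invr_ge0.
by rewrite ltW// bumpq_gt0.
Qed.

(** The parameter c enters only through exp(-1/(c d)) with d = (t - a)(b - t) fixed, so a growing c
    flattens the bump to 1 inside the interval. *)
Lemma bump1_1_cvg (R : realType) (a b : R) t : a < t < b ->
  (fun k : nat => bump1 a b k.+1%:R 1 0 t) @ \oo --> (1 : R).
Proof.
move=> tab; rewrite /bump1 tab.
pose d := (t - a) * (b - t).
have d0 : d != 0 by apply: lt0r_neq0; rewrite mulr_gt0//; move: tab => /andP[? ?]; lra.
rewrite -[X in _ --> X](expR0 R).
under eq_fun do rewrite hornerC expr0 !mul1r bumpqE invfM -/d.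
apply: continuous_cvg; first exact: continuous_expR.
rewrite -oppr0; apply: cvgN; rewrite -(mul0r d^-1).
by apply: cvgMl => //; exact: cvg_harmonic.
Qed.

Section bump.
Context (R : realType) (n : nat).
Implicit Types (a b : 'I_n -> R) (c : R) (p : 'I_n -> {poly R}) (m : 'I_n -> nat).

Definition bump a b c p m (x : 'rV[R]_n) : R :=
  \prod_i bump1 (a i) (b i) c (p i) (m i) (x ord0 i).

Lemma is_derive_bump a b c p m j (x : 'rV[R]_n) : 0 < c ->
  is_derive x (delta_mx ord0 j) (bump a b c p m)
    (bump a b c (fun i => if i == j then bump1_next (a i) (b i) c (p i) (m i) else p i)
       (fun i => if i == j then (m i).+2 else m i) x).
Proof.
move=> c0; apply: is_derive_slice.
pose rest := \prod_(i | i != j) bump1 (a i) (b i) c (p i) (m i) (x ord0 i).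
have -> : (fun h : R => bump a b c p m (h *: delta_mx ord0 j + x)) =
    rest \*: (bump1 (a j) (b j) c (p j) (m j) \o +%R^~ (x ord0 j)).
  apply/funext => h; rewrite /bump (bigD1 j)//= mulrC /rest /GRing.scale/=.
  rewrite !mxE !eqxx mulr1; congr (_ * _); apply: eq_bigr => i ij.
  by rewrite !mxE eqxx (negbTE ij) mulr0 add0r.
rewrite /bump (bigD1 j)//= eqxx mulrC.
rewrite [X in X * _](_ : _ = rest); last first.
  by apply: eq_bigr => i ij; rewrite (negbTE ij).
have H : is_derive (0 : R) 1 (bump1 (a j) (b j) c (p j) (m j) \o +%R^~ (x ord0 j))
    (bump1 (a j) (b j) c (bump1_next (a j) (b j) c (p j) (m j)) (m j).+2 (x ord0 j) * 1).
  apply: is_derive1_comp.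
    by rewrite add0r; exact: is_derive_bump1.
  exact: is_derive_shift.
by apply: is_derive_eq; rewrite mulr1.
Qed.

Lemma bump_continuous a b c p m : 0 < c -> continuous (bump a b c p m).
Proof.
move=> c0; rewrite /bump; elim: (index_enum _) => [|i s IHs].
  by under eq_fun do rewrite big_nil; exact: cst_continuous.
under eq_fun do rewrite big_cons.
move=> x; apply: (@cvgM _ _ (nbhs x)); last exact: IHs.
apply: (@continuous_comp _ _ _ (fun x : 'rV[R]_n => x ord0 i)).
  exact: coord_continuous.
exact: bump1_continuous.
Qed.

(** A partial derivative changes the polynomial and the exponent of one factor only. The family is
    thus stable under differentiation, and each iterated derivative is again a bump. *)
Lemma smooth_bump a b c p m : 0 < c -> smooth (bump a b c p m).
Proof.
move=> c0 s; suff [p' [m' ->]] : exists p' m',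
    foldr (@pderiv R n) (bump a b c p m) s = bump a b c p' m'.
  split; first exact: bump_continuous.
  by move=> i x; have [] := is_derive_bump a b p' m' i x c0.
elim: s => [|i s [p' [m' IHs]]]; first by exists p, m.
rewrite /= IHs; eexists; eexists; apply/funext => x.
by rewrite /pderiv; have [_ ->] := is_derive_bump a b p' m' i x c0.
Qed.

Lemma closed_rect_itvcc a b : closed (rect (fun i => `[a i, b i]%classic)).
Proof.
apply: compact_closed; first exact: norm_hausdorff.
by apply: (@rV_compact R n (fun i => `[a i, b i]%classic)) => i; exact: segment_compact.
Qed.

Lemma bump_test_function (Omega : set 'rV[R]_n) a b c p m : 0 < c ->
  rect (fun i => `[a i, b i]%classic) `<=` Omega ->
  test_function Omega (bump a b c p m).
Proof.
move=> c0 abO; set K := rect _ in abO.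
have cK : compact K.
  by apply: (@rV_compact R n (fun i => `[a i, b i]%classic)) => i; exact: segment_compact.
have suppK : closure [set x | bump a b c p m x != 0] `<=` K.
  rewrite [X in _ `<=` X]((closure_id K).1 (@closed_rect_itvcc a b)).
  apply: closure_subset => x /=; rewrite /bump => /prodf_neq0 H i /=.
  have := H i isT; rewrite /bump1; case: ifPn => [/andP[? ?] _|]; last by rewrite eqxx.
  by rewrite in_itv/=; apply/andP; split; exact: ltW.
split; first exact: smooth_bump.
- by apply: (subclosed_compact _ cK suppK); exact: closed_closure.
- exact: subset_trans abO.
Qed.

Lemma bump_bound a b c x : 0 < c ->
  0 <= bump a b c (fun=> 1) (fun=> 0%N) x <= 1.
Proof.
move=> c0; rewrite /bump; apply/andP; split.
  by apply: prodr_ge0 => i _; have /andP[] := bump1_1_bound (a i) (b i) (x ord0 i) c0.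
apply: prodr_ile1 => i _; exact: bump1_1_bound.
Qed.

Lemma bump_cvg a b x :
  (fun k : nat => bump a b k.+1%:R (fun=> 1) (fun=> 0%N) x) @ \oo -->
  (\1_(rect (fun i => `]a i, b i[%classic)) x : R).
Proof.
rewrite indicE; case: (boolP (x \in _)).
  rewrite inE => xab; rewrite /bump (_ : true%:R = 1 :> R)//.
  have : forall i, (fun k : nat => bump1 (a i) (b i) k.+1%:R 1 0 (x ord0 i)) @ \oo --> (1 : R).
    by move=> i; apply: bump1_1_cvg; have := xab i; rewrite /= in_itv.
  move=> H; elim: (index_enum _) => [|i s IHs].
    by under eq_fun do rewrite big_nil; exact: cvg_cst.
  under eq_fun do rewrite big_cons.
  have G := cvgM (H i) IHs; rewrite mulr1 in G; exact: G.
rewrite notin_setE => /existsNP[i /negP xi].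
apply: cvg_near_cst; apply: nearW => k; rewrite /bump (bigD1 i)//= /bump1 ifF ?mul0r//.
by apply: contraNF xi; rewrite in_itv.
Qed.

End bump.

Section fundamental_lemma.
Context (R : realType) (n : nat) (Omega : set 'rV[R]_n).
Local Notation leb := (lebesgue_rV R n).

(** A side may be the whole line, so that the preimage of an interval under a single coordinate
    belongs to the family; it remains stable under intersection because empty intervals are allowed
    too. *)
Definition open_rects : set (set 'rV[R]_n) :=
  [set rect A | A in [set A : 'I_n -> set R |
    forall i, A i = setT \/ exists a b, A i = `]a, b[%classic]].

Lemma setI_itvoo (a b c d : R) :
  `]a, b[%classic `&` `]c, d[%classic = `]Num.max a c, Num.min b d[%classic.
Proof.
apply/seteqP; split => x /=; rewrite !in_itv/= gt_max lt_min.
  by move=> [/andP[-> ->] /andP[-> ->]].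
by move=> /andP[/andP[-> ->] /andP[-> ->]].
Qed.

Lemma setI_closed_open_rects : setI_closed open_rects.
Proof.
move=> _ _ [A HA <-] [B HB <-]; exists (fun i => A i `&` B i); last first.
  apply/seteqP; split => x; first by move=> H; split => i; have [] := H i.
  by move=> [H1 H2] i; split; [exact: H1|exact: H2].
move=> i; have [->|[a [b ->]]] := HA i; have [->|[c [d ->]]] := HB i.
- by left; rewrite setTI.
- by right; exists c, d; rewrite setTI.
- by right; exists a, b; rewrite setIT.
- by right; exists (Num.max a c), (Num.min b d); rewrite setI_itvoo.
Qed.

Lemma measurable_open_rects : @measurable _ 'rV[R]_n = <<s open_rects >>.
Proof.
apply/seteqP; split.
  apply: smallest_sub; first exact: smallest_sigma_algebra.
  move=> A; rewrite -bigcup_seq/= => -[i _] [B mB <-] /=.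
  pose f : g_sigma_algebraType open_rects -> R := fun x => x ord0 i.
  suff mf : measurable_fun setT f by exact: mf.
  apply: (measurability _ (RGenOpens.measurableE R)).
  move=> _ [_ [a [b ->] <-]]; rewrite setTI; apply: sub_sigma_algebra.
  exists (fun j => if j == i then `]a, b[%classic else setT).
    by move=> j; case: eqP => _; [right; exists a, b|left].
  apply/seteqP; split => x /=; first by move=> /(_ i); rewrite eqxx.
  by move=> xab j; case: eqP => [->//|_].
apply: smallest_sub; first exact: sigma_algebra_measurable.
move=> _ [A HA <-]; apply: measurable_rect => i.
by have [->|[a [b ->]]] := HA i.
Qed.

Lemma fundamental_lemma_box a b (g : 'rV[R]_n -> R) :
  measurable Omega ->
  rect (fun i => `[a i, b i]%classic) `<=` Omega ->
  leb.-integrable Omega (EFin \o g) ->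
  (forall phi, test_function Omega phi -> \int[leb]_(x in Omega) (g x * phi x) = 0) ->
  (\int[leb]_(x in rect (fun i => `]a i, b i[%classic)) (g x)%:E = 0)%E.
Proof.
(* Bumps with c = k + 1 increase to the indicator of the open box. *)
move=> mO abO ig Hg; set B := rect _.
have mB : measurable B by apply: measurable_rect => i; exact: measurable_itv.
have BO : B `<=` Omega.
  by apply: subset_trans abO => x Bx i; apply: subset_itv_oo_cc; exact: Bx.
have mg : measurable_fun Omega g by apply/measurable_EFinP; exact: measurable_int ig.
pose phi k := bump a b k.+1%:R (fun=> 1) (fun=> 0%N) : 'rV[R]_n -> R.
have tphi k : test_function Omega (phi k) by exact: bump_test_function.
have mphi k : measurable_fun Omega (phi k).
  apply: measurable_funTS; apply: continuous_measurable_rV.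
  by have [/(_ [::])[]] := tphi k.
pose f_ k x := (g x * phi k x)%:E.
have mf_ k : measurable_fun Omega (f_ k).
  by apply/measurable_EFinP; exact: measurable_funM.
have mf : measurable_fun Omega (fun x => (g x * \1_B x)%:E).
  apply/measurable_EFinP; apply: measurable_funM => //.
have cv : {ae leb, forall x, Omega x -> f_ ^~ x @ \oo --> (g x * \1_B x)%:E}.
  apply: aeW => x _; apply: cvg_EFin; first exact: nearW.
  by apply: cvgMr; exact: bump_cvg.
have bd : {ae leb, forall x k, Omega x -> (`|f_ k x| <= (abse \o EFin \o g) x)%E}.
  apply: aeW => x k _; rewrite /= lee_fin normrM ler_piMr//.
  have /andP[p0 p1] := bump_bound a b x (ltr0Sn R k).
  by rewrite /phi ger0_norm.
have iag : leb.-integrable Omega (abse \o EFin \o g) by exact: integrable_abse.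
have [_ _ H] := dominated_convergence mO mf_ mf cv iag bd.
have -> : (\int[leb]_(x in B) (g x)%:E = \int[leb]_(x in Omega) (g x * \1_B x)%:E)%E.
  rewrite integral_mkcond [RHS]integral_mkcond; apply: eq_integral => x _.
  rewrite !patchE indicE; case: (boolP (x \in B)) => xB.
    by rewrite ifT ?mulr1// inE; apply: BO; rewrite inE in xB.
  by rewrite mulr0; case: ifP.
have H0 : [sequence (\int[leb]_(x in Omega) f_ k x)%E]_k = cst 0%E.
  (* A real-valued integral is also 0 when the extended one is infinite; integrability of g phi_k
     rules this out. *)
  apply/funext => k /=; have := Hg _ (tphi k); rewrite /Rintegral => /eqP.
  rewrite fine_eq0; first by move/eqP.
  apply: integrable_fin_num => //.
  apply: (le_integrable mO (mf_ k) _ iag) => x Ox /=.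
  rewrite lee_fin normr_id normrM ler_piMr//.
  have /andP[p0 p1] := bump_bound a b x (ltr0Sn R k).
  by rewrite /phi ger0_norm.
rewrite -(cvg_lim _ H)// H0; exact: lim_cst.
Qed.

(** On each box of the countable cover, the measurable sets over which [g] integrates to 0 form a
    Dynkin system that contains the open rectangles, hence contains everything; so [g] is 0 almost
    everywhere on the box. *)
Lemma fundamental_lemma (g : 'rV[R]_n -> R) :
  open Omega -> leb.-integrable Omega (EFin \o g) ->
  (forall phi, test_function Omega phi -> \int[leb]_(x in Omega) (g x * phi x) = 0) ->
  {ae leb, forall x, Omega x -> g x = 0}.
Proof.
move=> oO ig Hg; have mO := open_measurable_rV oO.
have [P [a [b [abO OE]]]] := open_rV_cover oO.
have BO k : P k -> rect (fun i => `]a k i, b k i[%classic) `<=` Omega.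
  by move=> Pk; apply: subset_trans (abO _ Pk) => x Bx i; apply: subset_itv_oo_cc; exact: Bx.
suff Hk k : P k -> {ae leb, forall x, rect (fun i => `]a k i, b k i[%classic) x -> g x = 0}.
  have : {ae leb, forall x k, P k -> rect (fun i => `]a k i, b k i[%classic) x -> g x = 0}.
    apply: ae_foralln => k; case: (pselect (P k)) => [Pk|nPk].
      by apply: filterS (Hk _ Pk) => x Hx _.
    by apply: aeW => x /nPk.
  by apply: filterS => x Hx; rewrite {1}OE => -[k Pk xk]; exact: Hx xk.
move=> Pk; set B := rect _.
have mB : measurable B by apply: measurable_rect => i; exact: measurable_itv.
have igB : leb.-integrable B (EFin \o g) by apply: integrableS ig => //; exact: BO.
pose f := (EFin \o g) \_ B.
have igf : leb.-integrable setT f by apply/(integrable_mkcond _ _).1.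
have H0 A : measurable A -> (\int[leb]_(x in A) f x = 0)%E.
  rewrite measurable_open_rects.
  apply: (dynkin_induction measurable_open_rects setI_closed_open_rects (P := fun A => \int[leb]_(x in A) f x = 0)%E) => {A}.
  - rewrite -integral_mkcond; exact: fundamental_lemma_box (abO _ Pk) ig Hg.
  - move=> _ [A HA <-].
    (* Cutting a rectangle by the box gives a box again, whose closed version still lies in [Omega].
       Crossed end points are allowed and describe the empty set. *)
    have /choice[q Hq] : forall i, exists q : R * R,
        A i `&` `]a k i, b k i[%classic = `]q.1, q.2[%classic /\
        `[q.1, q.2]%classic `<=` `[a k i, b k i]%classic.
      move=> i; have [->|[c [d ->]]] := HA i.
        by exists (a k i, b k i); rewrite setTI; split.
      exists (Num.max c (a k i), Num.min d (b k i)); rewrite setI_itvoo; split => // x /=.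
      by rewrite !in_itv/= ge_max le_min => /andP[/andP[_ ->] /andP[_ ->]].
    rewrite -integral_mkcondr (_ : _ `&` B = rect (fun i => `](q i).1, (q i).2[%classic)).
      apply: (@fundamental_lemma_box (fun i => (q i).1) (fun i => (q i).2)) => //.
      by apply: subset_trans (abO _ Pk) => x Hx i; have [_] := Hq i; apply; exact: Hx.
    apply/seteqP; split => x.
      by move=> [Ax Bx] i; have [<- _] := Hq i; split; [exact: Ax|exact: Bx].
    move=> Hx.
    have Hi i : (A i `&` `]a k i, b k i[%classic) (x ord0 i).
      by have [-> _] := Hq i; exact: Hx.
    by split => i; have [] := Hi i.
  - move=> A mA A0.
    have T0 : (\int[leb]_x f x = 0)%E.
      by rewrite -integral_mkcond; exact: fundamental_lemma_box (abO _ Pk) ig Hg.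
    move: T0; rewrite -(setvU A) setUC integral_setU ?A0 ?add0e//.
    - exact: measurableC.
    - by apply: measurable_funTS; exact: measurable_int igf.
    - by apply/disj_set2P; rewrite setICr.
  - move=> F mF tF F0; rewrite integral_bigcup//; last first.
      by apply: integrableS igf => //; exact: bigcup_measurable.
    by apply: eseries0 => i _ _; exact: F0.
have : ae_eq leb setT f (cst 0%E).
  apply: integral_ae_eq => // A _ mA.
  by rewrite H0// integral_cst// mul0e.
apply: filterS => x /(_ Logic.I); rewrite /f patchE => + Bx.
by rewrite mem_set// => -[].
Qed.

End fundamental_lemma.

(** * Square-integrable functions *)

Section psd.
Context (R : realType) (E : lmodType R) (V : set E) (B : E -> E -> R).
Hypothesis V_lin : forall (a : R) u v, V u -> V v -> V (a *: u + v).
Hypothesis B_lin : forall (a : R) u v w, V u -> V v -> V w ->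
  B (a *: u + v) w = a * B u w + B v w.
Hypothesis B_sym : forall u v, V u -> V v -> B u v = B v u.
Hypothesis B_ge0 : forall u, V u -> 0 <= B u u.

Lemma psd_expand (a : R) u v : V u -> V v ->
  B (a *: u + v) (a *: u + v) = a ^+ 2 * B u u + 2 * a * B u v + B v v.
Proof.
move=> Vu Vv; have Vw := V_lin a Vu Vv.
rewrite B_lin// (B_sym Vu Vw) (B_sym Vv Vw) !B_lin// (B_sym Vv Vu); ring.
Qed.

(** The minimum over a of B(a u + v, a u + v) is nonnegative; it is attained at a = - B(u,v)/B(u,u).
    The form is only semidefinite, so B(u,u) = 0 is a separate case, in which the expression is
    affine in a. *)
Lemma psd_CS2 u v : V u -> V v -> B u v ^+ 2 <= B u u * B v v.
Proof.
move=> Vu Vv.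
have H a : 0 <= a ^+ 2 * B u u + 2 * a * B u v + B v v.
  by rewrite -psd_expand//; apply: B_ge0; exact: V_lin.
have [u0|u0] := eqVneq (B u u) 0.
  rewrite u0 mul0r; have [->|uv0] := eqVneq (B u v) 0; first by rewrite expr0n.
  (* This value of a makes the affine expression equal to -1, a contradiction. *)
  have := H (- (B v v + 1) / (2 * B u v)); rewrite u0.
  rewrite (_ : _ + _ = -1); first lra.
  by field.
have u1 : 0 < B u u by rewrite lt_neqAle eq_sym u0 B_ge0.
have := H (- B u v / B u u).
rewrite (_ : _ + _ = (B u u * B v v - B u v ^+ 2) / B u u); last by field.
by rewrite pmulr_lge0 ?invr_gt0// subr_ge0.
Qed.

Lemma psd_CS u v : V u -> V v -> `|B u v| <= Num.sqrt (B u u) * Num.sqrt (B v v).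
Proof.
move=> Vu Vv; rewrite -sqrtrM ?B_ge0// -sqrtr_sqr ler_wsqrtr//.
exact: psd_CS2.
Qed.

Lemma psd_triangle u v : V u -> V v ->
  Num.sqrt (B (u + v) (u + v)) <= Num.sqrt (B u u) + Num.sqrt (B v v).
Proof.
move=> Vu Vv; have := psd_expand 1 Vu Vv; rewrite scale1r => ->.
rewrite -[leRHS]ger0_norm ?addr_ge0 ?sqrtr_ge0// -sqrtr_sqr ler_wsqrtr//.
rewrite sqrrD !sqr_sqrtr ?B_ge0//.
have := le_trans (ler_norm _) (psd_CS Vu Vv).
by rewrite expr1n mul1r mulr1 -mulr_natl; lra.
Qed.

Lemma psd_scale a u : V u -> Num.sqrt (B (a *: u) (a *: u)) = `|a| * Num.sqrt (B u u).
Proof.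
move=> Vu.
have V0 : V 0 by have := V_lin (-1) Vu Vu; rewrite scaleN1r addNr.
have B0 w : V w -> B 0 w = 0.
  by move=> Vw; have := B_lin (-1) Vu Vu Vw; rewrite scaleN1r addNr => ->; ring.
have := psd_expand a Vu V0; rewrite addr0 => ->.
by rewrite (B_sym Vu V0) !B0// mulr0 !addr0 sqrtrM ?sqr_ge0// sqrtr_sqr.
Qed.

End psd.

Lemma cvg_series_nneseries (R : realType) (u : nat -> R) : (forall k, 0 <= u k) ->
  (\sum_(0 <= k <oo) (u k)%:E < +oo)%E -> cvgn (series u).
Proof.
move=> u0 us; apply: nondecreasing_is_cvgn.
  by move=> m n mn; exact: nondecreasing_series.
have sfin : (\sum_(0 <= k <oo) (u k)%:E)%E \is a fin_num.
  by rewrite ge0_fin_numE// nneseries_ge0// => k _ _; rewrite lee_fin.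
exists (fine (\sum_(0 <= k <oo) (u k)%:E)%E) => _ [n _ <-].
rewrite -lee_fin fineK// /series/= -sumEFin.
by apply: nneseries_lim_ge => k _ _; rewrite lee_fin.
Qed.

(* Locked, like the other integrals below: otherwise unification unfolds them. *)
HB.lock Definition sqdot d (T : measurableType d) (R : realType)
    (mu : {measure set T -> \bar R}) (D : set T) (f g : T -> R) : R :=
  \int[mu]_(x in D) (f x * g x).

Section square_integrable.
Context d (T : measurableType d) (R : realType) (mu : {measure set T -> \bar R}).
Context (D : set T) (mD : measurable D).
Implicit Types f g h : T -> R.

Definition sqint f : Prop :=
  measurable_fun D f /\ mu.-integrable D (EFin \o (fun x => f x ^+ 2)).

Local Notation sqdot := (sqdot mu D).

Lemma sqint_mul f g : sqint f -> sqint g -> mu.-integrable D (fun x => (f x * g x)%:E).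
Proof.
move=> [mf f2] [mg g2].
apply: (le_integrable mD (g := fun x => (f x ^+ 2)%:E + (g x ^+ 2)%:E)%E).
- by apply/measurable_EFinP; exact: measurable_funM.
- move=> x _; rewrite -EFinD /= lee_fin normrM [leRHS]ger0_norm ?addr_ge0 ?sqr_ge0//.
  rewrite -[f x ^+ 2]real_normK ?num_real// -[g x ^+ 2]real_normK ?num_real//.
  have := sqr_ge0 (`|f x| - `|g x|); have := mulr_ge0 (normr_ge0 (f x)) (normr_ge0 (g x)).
  by rewrite sqrrB -mulr_natl; lra.
- exact: integrableD.
Qed.

Lemma sqint_lin (a : R) f g : sqint f -> sqint g -> sqint (fun x => a * f x + g x).
Proof.
move=> Sf Sg; have [mf f2] := Sf; have [mg g2] := Sg.
split; first by apply: measurable_funD => //; exact: measurable_funM.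
rewrite (_ : _ \o _ = fun x => ((a ^+ 2)%:E * (f x ^+ 2)%:E + ((2 * a)%:E * (f x * g x)%:E + (g x ^+ 2)%:E))%E).
  apply: integrableD => //; first exact: integrableZl.
  by apply: integrableD => //; apply: integrableZl => //; exact: sqint_mul.
by apply/funext => x /=; rewrite -!EFinM -!EFinD; congr EFin; ring.
Qed.

Lemma ae_le_integrable f g : measurable_fun D f -> mu.-integrable D (EFin \o g) ->
  {ae mu, forall x, D x -> `|f x| <= g x} -> mu.-integrable D (EFin \o f).
Proof.
move=> mf ig fg; have /integrableP[mg Hg] := ig.
have iag := integrable_abse ig; have /integrableP[mag Hag] := iag.
apply/integrableP; split; first exact/measurable_EFinP.
apply: le_lt_trans Hg; apply: ae_ge0_le_integral => //.
- by apply: measurableT_comp => //; exact/measurable_EFinP.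
- apply: filterS fg => x H Dx; rewrite /= lee_fin.
  by apply: le_trans (H Dx) _; exact: ler_norm.
Qed.

Lemma sqint_bddM (C : R) f g : sqint f -> measurable_fun D g ->
  {ae mu, forall x, D x -> `|g x| <= C} -> sqint (fun x => g x * f x).
Proof.
move=> [mf f2] mg bg; split; first exact: measurable_funM.
apply: (@ae_le_integrable _ (fun x => C ^+ 2 * f x ^+ 2)).
- by apply: measurable_funX; exact: measurable_funM.
- exact: (integrableZl _ (C ^+ 2)%R f2).
- apply: filterS bg => x H Dx; have gC := H Dx.
  rewrite ger0_norm ?sqr_ge0// exprMn ler_wpM2r ?sqr_ge0//.
  by rewrite -real_normK ?num_real// ler_sqr ?nnegrE// (le_trans _ gC).
Qed.

Lemma ae_eq_Rintegral f g : measurable_fun D f -> measurable_fun D g ->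
  {ae mu, forall x, D x -> f x = g x} ->
  \int[mu]_(x in D) f x = \int[mu]_(x in D) g x.
Proof.
move=> mf mg fg; rewrite /Rintegral; congr fine; apply: ae_eq_integral => //.
- exact/measurable_EFinP.
- exact/measurable_EFinP.
- by apply: filterS fg => x H Dx; rewrite H.
Qed.

Lemma sqdotC f g : sqdot f g = sqdot g f.
Proof. by rewrite sqdot.unlock; apply: eq_Rintegral => x _; rewrite mulrC. Qed.

Lemma sqdot_lin (a : R) f g h : sqint f -> sqint g -> sqint h ->
  sqdot (fun x => a * f x + g x) h = a * sqdot f h + sqdot g h.
Proof.
move=> Sf Sg Sh; rewrite sqdot.unlock -RintegralZl//; last exact: sqint_mul.
rewrite -RintegralD//; last 2 first.
- exact: (integrableZl _ a (sqint_mul Sf Sh)).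
- exact: sqint_mul.
by apply: eq_Rintegral => x _; rewrite mulrDl mulrA.
Qed.

Lemma sqdot_ge0 f : 0 <= sqdot f f.
Proof. by rewrite sqdot.unlock; apply: Rintegral_ge0 => x _; rewrite -expr2 sqr_ge0. Qed.

Lemma sqdotE f : sqint f -> (\int[mu]_(x in D) (f x ^+ 2)%:E = (sqdot f f)%:E)%E.
Proof.
by move=> [mf f2]; rewrite sqdot.unlock /Rintegral fineK//; exact: integrable_fin_num.
Qed.

Lemma sqdot_ae f f' g g' : sqint f -> sqint f' -> sqint g -> sqint g' ->
  {ae mu, forall x, D x -> f x = f' x} -> {ae mu, forall x, D x -> g x = g' x} ->
  sqdot f g = sqdot f' g'.
Proof.
move=> [mf _] [mf' _] [mg _] [mg' _] ff' gg'; rewrite sqdot.unlock; apply: ae_eq_Rintegral.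
- exact: measurable_funM.
- exact: measurable_funM.
- by apply: filterS2 ff' gg' => x H1 H2 Dx; rewrite H1 ?H2.
Qed.

Let psdE : lmodType R := (T -> R).

Lemma sqdot_CS f g : sqint f -> sqint g ->
  `|sqdot f g| <= Num.sqrt (sqdot f f) * Num.sqrt (sqdot g g).
Proof.
move=> Sf Sg; apply: (@psd_CS R psdE sqint sqdot) => //.
- by move=> a u v; exact: sqint_lin.
- by move=> a u v w; exact: sqdot_lin.
- by move=> u v _ _; exact: sqdotC.
- by move=> u _; exact: sqdot_ge0.
Qed.

Lemma sqdot_triangle f g : sqint f -> sqint g ->
  Num.sqrt (sqdot (fun x => f x + g x) (fun x => f x + g x)) <=
  Num.sqrt (sqdot f f) + Num.sqrt (sqdot g g).
Proof.
move=> Sf Sg; apply: (@psd_triangle R psdE sqint sqdot) => //.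
- by move=> a u v; exact: sqint_lin.
- by move=> a u v w; exact: sqdot_lin.
- by move=> u v _ _; exact: sqdotC.
- by move=> u _; exact: sqdot_ge0.
Qed.

Lemma sqintB f g : sqint f -> sqint g -> sqint (fun x => f x - g x).
Proof.
move=> Sf Sg; have := sqint_lin (-1) Sg Sf; congr sqint.
by apply/funext => x; rewrite mulN1r addrC.
Qed.

Let sqd f g := sqdot (fun x => f x - g x) (fun x => f x - g x).

(** Riesz-Fischer. A subsequence [G] with squared gaps at most 4^-k converges almost everywhere, and
    Fatou's lemma turns the Cauchy estimate into an estimate of the distance to the pointwise limit.
    The weight 2^k keeps the integrals of the squared gaps summable, as 2^k 4^-k = 2^-k. *)
Lemma sqint_complete (F : nat -> T -> R) : (forall k, sqint (F k)) ->
  (forall e, 0 < e -> exists N, forall m n, (N <= m)%N -> (N <= n)%N ->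
     sqdot (fun x => F m x - F n x) (fun x => F m x - F n x) <= e) ->
  exists2 f, sqint f &
    (fun k => sqdot (fun x => F k x - f x) (fun x => F k x - f x)) @ \oo --> (0 : R).
Proof.
move=> SF cF.
have /choice[N0 HN0] : forall k : nat, exists N, forall m n, (N <= m)%N -> (N <= n)%N ->
    sqd (F m) (F n) <= 4^-1 ^+ k.
  by move=> k; apply: cF; rewrite exprn_gt0.
(* The running maximum makes the indices nondecreasing, so that each later index meets all earlier
   tolerances. *)
pose N := fix N k := if k is k'.+1 then maxn (N k') (N0 k) else N0 0%N.
have N0N k : (N0 k <= N k)%N by case: k => [|k] //=; rewrite leq_maxr.
have Nhomo : {homo N : m n / (m <= n)%N}.
  by apply: homo_leq => //= [? ? ?|k]; [exact: leq_trans|rewrite leq_maxl].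
pose G k := F (N k).
have HG k m : (N k <= m)%N -> sqd (G k) (F m) <= 4^-1 ^+ k.
  by move=> km; apply: HN0; rewrite ?(leq_trans (N0N k)).
pose dG k x := G k.+1 x - G k x.
have dGpos k x : 0 <= 2 ^+ k * dG k x ^+ 2 by rewrite mulr_ge0 ?sqr_ge0// exprn_ge0.
have SdG k : sqint (dG k) by apply: sqintB; exact: SF.
have dGle k : sqdot (dG k) (dG k) <= 4^-1 ^+ k.
  by apply: HN0; rewrite ?N0N// (leq_trans (N0N k))// Nhomo.
have i1 : (\int[mu]_(x in D) (\sum_(0 <= k <oo) (2 ^+ k * dG k x ^+ 2)%:E) < +oo)%E.
  have mdG k : measurable_fun D (fun x => (2 ^+ k * dG k x ^+ 2)%:E).
    apply/measurable_EFinP; apply: measurable_funM => //; apply: measurable_funX.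
    by have [] := SdG k.
  rewrite integral_nneseries//; last first.
    by move=> k x _; rewrite lee_fin dGpos.
  apply: (@le_lt_trans _ _ (\sum_(0 <= k <oo) (2^-1 ^+ k)%:E)%E).
    apply: lee_nneseries => [k _ _|k _].
      by apply: integral_ge0 => x _; rewrite lee_fin dGpos.
    under eq_integral do rewrite EFinM.
    rewrite integralZl//; last by have [] := SdG k.
    rewrite sqdotE// -EFinM lee_fin.
    apply: (le_trans (y := 2 ^+ k * 4^-1 ^+ k)); first by rewrite ler_pM2l ?exprn_gt0.
    by rewrite -exprMn lerXn2r ?nnegrE//; lra.
  have -> : (\sum_(0 <= k <oo) (2^-1 ^+ k)%:E = \sum_(0 <= k <oo) (2 / (2 ^ k.+1)%:R)%:E :> \bar R)%E.
    apply: eq_eseriesr => k _; congr EFin.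
    by rewrite natrX exprS invfM mulrA divff// mul1r exprVn.
  by apply: le_lt_trans (ltry 2); exact: epsilon_trick0.
have mS : measurable_fun D (fun x => \sum_(0 <= k <oo) (2 ^+ k * dG k x ^+ 2)%:E)%E.
  apply: ge0_emeasurable_sum => [k x _ _|k _].
    by rewrite lee_fin dGpos.
  apply/measurable_EFinP; apply: measurable_funM => //; apply: measurable_funX.
  by have [] := SdG k.
have iS : mu.-integrable D (fun x => \sum_(0 <= k <oo) (2 ^+ k * dG k x ^+ 2)%:E)%E.
  apply/integrableP; split => //; under eq_integral.
    move=> x _; rewrite gee0_abs; last first.
      by apply: nneseries_ge0 => k _ _; rewrite lee_fin dGpos.
    over.
  exact: i1.
have : {ae mu, forall x, D x -> cvgn (G ^~ x)}.
  apply: filterS (integrable_ae mD iS) => x H Dx.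
  have H1 : cvgn (series (fun k => 2 ^+ k * dG k x ^+ 2)).
    apply: cvg_series_nneseries => [k|]; first exact: dGpos.
    by rewrite ltey_eq H.
  have H2 : cvgn (series (geometric 1 (2^-1 : R))).
    by apply: is_cvg_geometric_series; rewrite ger0_norm//; lra.
  have H3 : cvgn (series (dG ^~ x)).
    have gE k : (geometric 1 (2^-1 : R) + (fun k => 2 ^+ k * dG k x ^+ 2)) k =
        (2 ^+ k)^-1 + 2 ^+ k * dG k x ^+ 2.
      by rewrite {1}/GRing.add/= mul1r exprVn.
    have p0 k : 0 < 2 ^+ k :> R by rewrite exprn_gt0.
    apply: normed_cvg; apply: series_le_cvg (is_cvg_seriesD H2 H1) => k //=.
      by rewrite gE addr_ge0// invr_ge0 ltW.
    (* A gap is either at most 2^-k or at most 2^k times its own square; both alternatives are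
       summable. *)
    rewrite gE; have [le1|ge1] := leP `|dG k x| (2 ^+ k)^-1.
      by apply: (le_trans le1); rewrite lerDl.
    rewrite -[dG k x ^+ 2]real_normK ?num_real// expr2.
    apply: (@le_trans _ _ (2 ^+ k * (`|dG k x| * `|dG k x|))); last by rewrite lerDr invr_ge0 ltW.
    by rewrite mulrA ler_peMl// -(ler_pdivrMl _ _ (p0 k)) mulr1 ltW.
  rewrite (_ : G ^~ x = fun k => G 0%N x + series (dG ^~ x) k).
    by apply: is_cvgD => //; exact: is_cvg_cst.
  by apply/funext => k; rewrite (@eq_sum_telescope R (G ^~ x) k).
move=> [Z [mZ Z0 DZ]].
(* Multiplying by the indicator of the complement of the null set [Z] makes the limit exist at every
   point of [D], which gives its measurability. *)
pose chi : T -> R := \1_(~` Z).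
have mchi : measurable_fun D chi by apply: measurable_indic; exact: measurableC.
have aechi : {ae mu, forall x, chi x = 1}.
  exists Z; split => // x /= nx; apply: contrapT => nZ; apply: nx.
  by rewrite /chi indicE mem_set.
have cG x : D x -> cvgn (fun k => G k x * chi x).
  move=> Dx; rewrite /chi indicE; case: (boolP (x \in ~` Z)) => xZ.
    apply: is_cvgM; last exact: is_cvg_cst.
    by apply: contrapT => nc; rewrite inE in xZ; apply: xZ; apply: DZ => /(_ Dx).
  by under eq_fun do rewrite mulr0; exact: is_cvg_cst.
pose f x := limn (fun k => G k x * chi x).
have mF k : measurable_fun D (F k) by have [] := SF k.
have mf : measurable_fun D f.
  apply: (@measurable_fun_cvg _ _ _ D (fun k x => G k x * chi x)) => [k|x Dx].
    by apply: measurable_funM => //; exact: mF.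
  exact: cG.
(* The subsequence is shifted by j, so that all its indices are at least [N j] and every integral in
   Fatou's lemma is bounded by 4^-j. *)
have fatouG j m : (N j <= m)%N -> (\int[mu]_(x in D) ((F m x - f x) ^+ 2)%:E <= (4^-1 ^+ j)%:E)%E.
  move=> jm.
  pose h k x := (((F m x - G (k + j)%N x) * chi x) ^+ 2)%:E.
  have mh k : measurable_fun D (h k).
    apply/measurable_EFinP; apply: measurable_funX; apply: measurable_funM => //.
    by apply: measurable_funB; exact: mF.
  have h0 k x : D x -> (0 <= h k x)%E by move=> _; rewrite lee_fin sqr_ge0.
  have := @fatou _ _ _ mu D mD h mh h0.
  rewrite (_ : (\int[mu]_(x in D) limn_einf (h^~ x) = \int[mu]_(x in D) ((F m x - f x) ^+ 2)%:E)%E).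
    move=> H; apply: (le_trans H); rewrite limn_einf_lim; apply: lime_le; first exact: is_cvg_einfs.
    apply: nearW => k; apply: (@le_trans _ _ (\int[mu]_(x in D) h k x)%E).
      by apply: ereal_inf_lbound; exists k => //=.
    apply: (@le_trans _ _ (\int[mu]_(x in D) ((F m x - G (k + j)%N x) ^+ 2)%:E)%E).
      apply: ge0_le_integral => //.
      - by move=> x _; rewrite lee_fin sqr_ge0.
      - by apply/measurable_EFinP; apply: measurable_funX; apply: measurable_funB; exact: mF.
      - move=> x _; rewrite lee_fin exprMn ler_piMr ?sqr_ge0//.
        by rewrite /chi indicE; case: (_ \in _); rewrite ?expr1n ?expr0n.
    rewrite sqdotE; last by apply: sqintB; exact: SF.
    rewrite lee_fin; apply: HN0; first exact: leq_trans jm.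
    by rewrite (leq_trans (N0N j))// Nhomo// leq_addl.
  transitivity (\int[mu]_(x in D) ((F m x * chi x - f x) ^+ 2)%:E)%E.
    apply: eq_integral => x; rewrite inE => Dx.
    have : h ^~ x @ \oo --> ((F m x * chi x - f x) ^+ 2)%:E.
      apply: cvg_EFin; first exact: nearW.
      rewrite /h /=; under eq_fun do rewrite mulrBl.
      have HG' : (fun k => G (k + j)%N x * chi x) @ \oo --> f x.
        by have := cG _ Dx; rewrite -(cvg_shiftn j).
      by rewrite expr2; under eq_fun do rewrite expr2; apply: cvgM; apply: cvgB => //; exact: cvg_cst.
    by move/cvg_limn_einf_sup => [-> _].
  apply: ae_eq_integral => //.
  - by apply/measurable_EFinP; apply: measurable_funX; apply: measurable_funB => //; exact: measurable_funM.
  - by apply/measurable_EFinP; apply: measurable_funX; apply: measurable_funB.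
  - by apply: filterS aechi => x -> _; rewrite mulr1.
have SFf m j : (N j <= m)%N -> sqint (fun x => F m x - f x).
  move=> jm; split; first exact: measurable_funB.
  apply/integrableP; split.
    by apply/measurable_EFinP; apply: measurable_funX; exact: measurable_funB.
  apply: le_lt_trans (ltry (4^-1 ^+ j)); apply: le_trans (fatouG _ _ jm).
  by under eq_integral do rewrite /= ger0_norm ?sqr_ge0//.
exists f.
  have := sqintB (SF (N 0%N)) (SFf _ _ (leqnn (N 0%N))); congr sqint.
  by apply/funext => x; rewrite opprB addrC subrK.
apply/cvgr0Pnorm_le => e e0.
have [j je] : exists j : nat, 4^-1 ^+ j <= e.
  have : (fun j => (4^-1 : R) ^+ j) @ \oo --> (0 : R) by apply: cvg_expr; rewrite ger0_norm//; lra.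
  move=> /cvgr0Pnorm_le /(_ e e0) [j _ /(_ j (leqnn j))] /=.
  by rewrite ger0_norm ?exprn_ge0// => ?; exists j.
exists (N j) => // m /= jm; rewrite ger0_norm ?sqdot_ge0//; apply: le_trans je.
by rewrite -lee_fin -sqdotE; [exact: fatouG|exact: SFf jm].
Qed.

End square_integrable.

(** * Test functions *)

Lemma mul2I (R : realType) (a b h : R) : 0 < h -> a * h * h = b * h * h -> a = b.
Proof. by move=> h0 /(mulIf (lt0r_neq0 h0)) /(mulIf (lt0r_neq0 h0)). Qed.

Lemma half_close (R : realType) (a b c e : R) :
  `|a - c| < e / 2 -> `|b - c| < e / 2 -> `|a - b| <= e.
Proof.
move=> ac bc; rewrite (_ : a - b = (a - c) - (b - c)); last ring.
by apply: (le_trans (ler_normB _ _)); lra.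
Qed.

Section smooth_functions.
Context (R : realType) (n : nat).
Implicit Types (f g : 'rV[R]_n -> R) (Omega : set 'rV[R]_n).

Lemma smooth_continuous f : smooth f -> continuous f.
Proof. by move=> /(_ [::])[]. Qed.

Lemma smooth_derivable f i x : smooth f -> derivable f x (delta_mx ord0 i).
Proof. by move=> /(_ [::])[_]; exact. Qed.

Lemma smooth_pderiv f i : smooth f -> smooth (pderiv i f).
Proof. by move=> sf s; have := sf (rcons s i); rewrite foldr_rcons. Qed.

Lemma pderiv_lin (a : R) f g i x : derivable f x (delta_mx ord0 i) ->
  derivable g x (delta_mx ord0 i) ->
  pderiv i (fun y => a * f y + g y) x = a * pderiv i f x + pderiv i g x.
Proof.
move=> df dg; rewrite /pderiv.
have H := deriveD (derivableZ (k := a) df) dg.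
by rewrite [LHS]H (deriveZ _ df).
Qed.

Lemma smooth_lin (a : R) f g : smooth f -> smooth g -> smooth (fun x => a * f x + g x).
Proof.
move=> sf sg s.
have -> : foldr (@pderiv R n) (fun x => a * f x + g x) s =
    fun x => a * foldr (@pderiv R n) f s x + foldr (@pderiv R n) g s x.
  elim: s => [//|i s IHs] /=; rewrite IHs; apply/funext => x.
  by rewrite pderiv_lin//; [have [_] := sf s|have [_] := sg s]; apply.
split => [x|i x].
  apply: (@cvgD _ _ _ (nbhs x)); last by have [/(_ x)] := sg s.
  by apply: (@cvgMr _ _ (nbhs x)); have [/(_ x)] := sf s.
apply: (@derivableD _ _ _ (a \*: foldr (@pderiv R n) f s)).
  by apply: derivableZ; have [_] := sf s; apply.
by have [_] := sg s; apply.
Qed.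

Lemma is_derive_line f i (x : 'rV[R]_n) (s : R) :
  (forall y, derivable f y (delta_mx ord0 i)) ->
  is_derive s (1 : R) (fun s => f (s *: delta_mx ord0 i + x))
    (pderiv i f (s *: delta_mx ord0 i + x)).
Proof.
move=> df; set v := delta_mx ord0 i.
have E : (fun h => h^-1 *: (((fun s => f (s *: v + x)) \o shift s) (h *: (1 : R)) - f (s *: v + x))) =
   (fun h => h^-1 *: ((f \o shift (s *: v + x)) (h *: v) - f (s *: v + x))).
  by apply/funext => h; rewrite /= [h%:A]mulr1 scalerDl addrA.
have H : derivable (fun s : R => f (s *: v + x)) s 1 by rewrite /derivable E; exact: df.
by apply: DeriveDef => //; rewrite /derive E.
Qed.

Lemma MVT_line f i (x : 'rV[R]_n) (h : R) : 0 < h ->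
  (forall y, derivable f y (delta_mx ord0 i)) ->
  exists2 s, 0 < s < h & f (h *: delta_mx ord0 i + x) - f x =
    pderiv i f (s *: delta_mx ord0 i + x) * h.
Proof.
move=> h0 df.
have [|s] := @MVT R (fun s => f (s *: delta_mx ord0 i + x))
  (fun s => pderiv i f (s *: delta_mx ord0 i + x)) 0 h h0 (fun s _ => is_derive_line x s df).
  apply: continuous_subspaceT => s; apply: differentiable_continuous; apply/derivable1_diffP.
  by have [] := is_derive_line x s df.
by rewrite in_itv/= scale0r add0r subr0; exists s.
Qed.

(* Both iterated second differences equal Delta(h)/h^2 at nearby points. *)
Lemma pderivC f i j x : smooth f -> pderiv i (pderiv j f) x = pderiv j (pderiv i f) x.
Proof.
move=> sf.
pose e (k : 'I_n) : 'rV[R]_n := delta_mx ord0 k.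
have key (k l : 'I_n) (h : R) : 0 < h -> exists s t : R, [/\ 0 < s < h, 0 < t < h &
    f (h *: e k + (h *: e l + x)) - f (h *: e l + x) - (f (h *: e k + x) - f x) =
    pderiv l (pderiv k f) (t *: e l + (s *: e k + x)) * h * h].
  move=> h0.
  (* The second difference of f is the first difference of g along e_k; the mean value theorem is
     applied to g, then to the k-th derivative of f along e_l. *)
  pose g y := -1 * f y + f (h *: e l + y).
  have dg y : derivable g y (e k).
    apply: (@derivableD _ _ _ (-1 \*: f)).
      by apply: derivableZ; exact: smooth_derivable.
    apply/derivable1P; have /derivable1P := @smooth_derivable f k (h *: e l + y) sf.
    by under eq_fun do rewrite addrCA.
  have [s s0 Es] := MVT_line x h0 dg.
  have dk y : derivable (pderiv k f) y (e l) by apply: smooth_derivable; exact: smooth_pderiv.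
  have [t t0 Et] := MVT_line (s *: e k + x) h0 dk.
  exists s, t; split => //; rewrite -Et.
  have -> : (pderiv k f (h *: e l + (s *: e k + x)) - pderiv k f (s *: e k + x)) =
      pderiv k g (s *: e k + x).
    rewrite /g pderiv_lin; last 2 first.
    - exact: smooth_derivable.
    - apply/derivable1P; have /derivable1P := @smooth_derivable f k (h *: e l + (s *: e k + x)) sf.
      by under eq_fun do rewrite addrCA.
    rewrite mulN1r [RHS]addrC; apply: (congr1 (fun z => z - _)).
    rewrite /pderiv /derive; set F := (X in lim (X @ _)); set G := (X in _ = lim (X @ _)).
    suff -> : F = G by [].
    by apply/funext => r; rewrite /F /G /= addrCA.
  rewrite -Es /g; rewrite (addrCA (h *: e l)); ring.
have cij k l : continuous (pderiv k (pderiv l f)).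
  by apply: smooth_continuous; do 2!apply: smooth_pderiv.
apply/eqP; rewrite -subr_eq0 -normr_le0; apply/ler_addgt0Pr => eps eps0; rewrite add0r.
have e2 : 0 < eps / 2 by rewrite divr_gt0.
have near_x k l : exists2 del, 0 < del & forall y, `|x - y| < del ->
    `|pderiv k (pderiv l f) x - pderiv k (pderiv l f) y| < eps / 2.
  have /cvgrPdist_lt/(_ _ e2)/nbhs_normP[del /= d0 H] := cij k l x.
  by exists del => // y xy; exact: H.
have [d1 d10 H1] := near_x i j; have [d2 d20 H2] := near_x j i.
have [h [h0 hd1 hd2]] : exists h : R, [/\ 0 < h, h + h < d1 & h + h < d2].
  exists (Num.min d1 d2 / 3).
  have : 0 < Num.min d1 d2 by rewrite lt_min d10 d20.
  have : Num.min d1 d2 <= d1 by rewrite ge_min lexx.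
  have : Num.min d1 d2 <= d2 by rewrite ge_min lexx orbT.
  by move=> ? ? ?; split; lra.
have e1 k : `|e k| <= 1.
  rewrite /Num.Def.normr/= mx_normrE; apply/bigmax_leP; split => // -[a b] _ /=.
  by rewrite mxE; case: (_ && _); rewrite ?normr1 ?normr0.
have close (k l : 'I_n) (s t : R) : 0 < s < h -> 0 < t < h ->
    `|x - (t *: e l + (s *: e k + x))| <= h + h.
  move=> /andP[s0 sh] /andP[t0 th].
  rewrite addrA opprD addrCA subrr addr0 normrN.
  apply: (le_trans (ler_normD _ _)); apply: lerD.
    by rewrite normrZ gtr0_norm// (le_trans _ (ltW th))// ler_piMr// ltW.
  by rewrite normrZ gtr0_norm// (le_trans _ (ltW sh))// ler_piMr// ltW.
have [s [t [s0 t0 E1]]] := key i j h h0.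
have [s' [t' [s0' t0' E2]]] := key j i h h0.
have E : pderiv j (pderiv i f) (t *: e j + (s *: e i + x)) =
    pderiv i (pderiv j f) (t' *: e i + (s' *: e j + x)).
  have aux (a b c c' : R) : a - b - (c - c') = a - c - (b - c') by ring.
  have EE : pderiv j (pderiv i f) (t *: e j + (s *: e i + x)) * h * h =
      pderiv i (pderiv j f) (t' *: e i + (s' *: e j + x)) * h * h.
    rewrite -[LHS]E1 -[RHS]E2 (addrCA (h *: e i)); exact: aux.
  exact: (mul2I h0 EE).
have := H1 _ (le_lt_trans (close j i s' t' s0' t0') hd1).
have := H2 _ (le_lt_trans (close i j s t s0 t0) hd2).
by rewrite E => K2 K1; exact: (half_close K1 K2).
Qed.

End smooth_functions.

Section test_functions.
Context (R : realType) (n : nat) (Omega : set 'rV[R]_n).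
Hypothesis oO : open Omega.
Local Notation leb := (lebesgue_rV R n).
Let mO : measurable Omega := open_measurable_rV oO.

Lemma test_function_smooth phi : test_function Omega phi -> smooth phi.
Proof. by case. Qed.

Lemma test_function_outside phi x : test_function Omega phi -> ~ Omega x -> phi x = 0.
Proof.
move=> [_ _ sO] nO; apply: contrapT => /eqP p0; apply/nO/sO.
exact: subset_closure.
Qed.

Lemma closed_support_sub (f g : 'rV[R]_n -> R) :
  (forall x, f x != 0 -> closure [set x | g x != 0] x) ->
  closure [set x | f x != 0] `<=` closure [set x | g x != 0].
Proof.
move=> fg; have := closure_subset fg.
by rewrite -(closure_id (closure [set x | g x != 0])).1//; exact: closed_closure.
Qed.

Lemma test_function_sub (f g : 'rV[R]_n -> R) : smooth f -> test_function Omega g ->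
  (forall x, f x != 0 -> closure [set x | g x != 0] x) -> test_function Omega f.
Proof.
move=> sf [_ cg gO] /closed_support_sub fg; split => //.
- by apply: (subclosed_compact _ cg fg); exact: closed_closure.
- exact: subset_trans gO.
Qed.

Lemma test_function_pderiv phi i : test_function Omega phi ->
  test_function Omega (pderiv i phi).
Proof.
move=> tp; apply: (test_function_sub _ tp).
  by apply: smooth_pderiv; exact: test_function_smooth tp.
move=> x; apply: contra_neqP => nx; rewrite /pderiv.
rewrite (_ : 0 = 'D_(delta_mx ord0 i) (cst (0 : R)) x); last by rewrite derive_cst.
apply: near_eq_derive.
have : nbhs x (~` closure [set x | phi x != 0]).
  by apply: open_nbhs_nbhs; split => //; apply: closed_openC; exact: closed_closure.
apply: filterS => y ny; apply: contrapT => /eqP py; apply: ny.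
exact: subset_closure.
Qed.

Lemma test_function_lin a f g : test_function Omega f -> test_function Omega g ->
  test_function Omega (fun x => a * f x + g x).
Proof.
move=> [sf cf fO] [sg cg gO].
have H : closure [set x | a * f x + g x != 0] `<=`
    closure [set x | f x != 0] `|` closure [set x | g x != 0].
  rewrite -closureU; apply: closure_subset => x /=.
  have [->|] := eqVneq (f x) 0; last by left.
  by rewrite mulr0 add0r; right.
split; first exact: smooth_lin.
- apply: (subclosed_compact _ (compactU cf cg) H); exact: closed_closure.
- by move=> x /H[/fO|/gO].
Qed.

End test_functions.

(** * Weak derivatives and scalar Sobolev spaces *)

HB.lock Definition wpderiv (R : realType) n (Omega : set 'rV[R]_n) i (w : 'rV[R]_n -> R) :
  'rV[R]_n -> R := weak_pderiv Omega i w.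

HB.lock Definition H1dot (R : realType) n (Omega : set 'rV[R]_n) (w v : 'rV[R]_n -> R) : R :=
  sqdot (lebesgue_rV R n) Omega w v +
  \sum_(i < n) sqdot (lebesgue_rV R n) Omega (wpderiv Omega i w) (wpderiv Omega i v).

Section sobolev.
Context (R : realType) (n : nat) (Omega : set 'rV[R]_n) (M : R).
Hypothesis oO : open Omega.
Hypothesis bO : forall x, Omega x -> forall i, `|x ord0 i| <= M.
Local Notation leb := (lebesgue_rV R n).
Local Notation fn := ('rV[R]_n -> R).
Implicit Types (f g v w phi : fn).

Local Notation L2O := (sqint leb Omega).
Local Notation dot := (sqdot leb Omega).

Let mO : measurable Omega := open_measurable_rV oO.

Lemma Omega_finite : (leb Omega < +oo)%E.
Proof.
apply: le_lt_trans (cbox_finite n M); apply: le_measure; rewrite ?inE//.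
  by apply: (measurable_rect (A := fun=> _)) => i; exact: measurable_itv.
by move=> x Ox i; rewrite /= in_itv/= -ler_norml; exact: bO.
Qed.

(** Replaces the norm of the extension by zero by measurability and integrability of the square on
    [Omega], the form in which all later estimates are done. *)
Lemma L2P f : L2 Omega f <-> L2O f.
Proof.
rewrite /L2 /sqint; split => [fL|[mf f2]].
  have := fL; rewrite inE => /andP[]; rewrite inE/= => mfO _.
  split; first by apply/measurable_restrictT.
  have := Lfun2_integrable_sqr fL; rewrite (_ : _ \o _ = (EFin \o (fun x => f x ^+ 2)) \_ Omega).
    by move/(integrable_mkcond _ mO).
  by apply/funext => x /=; rewrite !patchE; case: ifP => // _; rewrite expr0n.
have mfO : measurable_fun setT (f \_ Omega) by apply/(measurable_restrictT f mO).
rewrite inE; apply/andP; split; rewrite inE//=.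
rewrite /finite_norm unlock; apply: poweR_lty.
rewrite (_ : (\int[leb]_x _)%E = (\int[leb]_(x in Omega) `|(f x ^+ 2)%:E|)%E).
  by have /integrableP[] := f2.
rewrite [RHS]integral_mkcond; apply: eq_integral => x _ /=.
rewrite !patchE; case: ifP => _ /=.
  by rewrite powR_mulrn// normrX.
by rewrite /point/= normr0 powR0.
Qed.

Lemma bounded_sqint f C : measurable_fun Omega f -> (forall x, Omega x -> `|f x| <= C) -> L2O f.
Proof.
move=> mf fC; split => //; apply: measurable_bounded_integrable => //.
- exact: Omega_finite.
- exact: measurable_funX.
- exists (C ^+ 2); split; first exact: num_real.
  move=> y Cy x Ox /=; apply: (le_trans _ (ltW Cy)).
  by rewrite normrX ler_pXn2r// ?nnegrE// ?fC// (le_trans _ (fC _ Ox)).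
Qed.

Lemma sqint_integrable f : L2O f -> leb.-integrable Omega (EFin \o f).
Proof.
move=> Sf; have S1 : L2O (cst 1).
  by apply: (@bounded_sqint _ 1) => // x _; rewrite normr1.
have := sqint_mul mO Sf S1; congr (_.-integrable _ _).
by apply/funext => x /=; rewrite mulr1.
Qed.

Lemma test_box_supported phi : test_function Omega phi -> box_supported M phi.
Proof.
move=> tp x px; apply: bO; apply: contrapT => nO.
by move/eqP: px; apply; exact: test_function_outside tp nO.
Qed.

Lemma test_sqint phi : test_function Omega phi -> L2O phi.
Proof.
move=> tp; have cp := smooth_continuous (test_function_smooth tp).
have [C HC] := continuous_box_bounded cp (test_box_supported tp).
apply: (@bounded_sqint _ C) => //.
by apply: measurable_funTS; exact: continuous_measurable_rV.
Qed.

(** The product f phi has bounded support, so its derivative integrates to 0 over the whole space.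
    The factor f is arbitrary outside the support of phi; Poincare's inequality takes f = x_i
    phi. *)
Lemma test_ibp f phi i : continuous f -> (forall x, derivable f x (delta_mx ord0 i)) ->
  continuous (pderiv i f) -> test_function Omega phi ->
  dot f (pderiv i phi) = - dot (pderiv i f) phi.
Proof.
move=> cf df cdf tp.
have sp := test_function_smooth tp.
have cp := smooth_continuous sp; have cdp := smooth_continuous (smooth_pderiv i sp).
have dp x := @smooth_derivable _ _ phi i x sp.
have tdp := test_function_pderiv i tp.
pose g x := f x * phi x.
have cg : continuous g by move=> x; apply: (@cvgM _ _ (nbhs x)); [exact: cf|exact: cp].
have dgE x : pderiv i g x = f x * pderiv i phi x + pderiv i f x * phi x.
  rewrite /pderiv (deriveM (df x) (dp x)) addrC; rewrite /GRing.scale/=.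
  by rewrite addrC [X in _ + X]mulrC.
have c1 : continuous (fun x => f x * pderiv i phi x).
  by move=> x; apply: (@cvgM _ _ (nbhs x)); [exact: cf|exact: cdp].
have c2 : continuous (fun x => pderiv i f x * phi x).
  by move=> x; apply: (@cvgM _ _ (nbhs x)); [exact: cdf|exact: cp].
have i1 : leb.-integrable setT (EFin \o (fun x => f x * pderiv i phi x)).
  apply: (continuous_box_integrable (M := M) c1) => x; rewrite mulf_eq0 negb_or => /andP[_].
  exact: (test_box_supported tdp).
have i2 : leb.-integrable setT (EFin \o (fun x => pderiv i f x * phi x)).
  apply: (continuous_box_integrable (M := M) c2) => x; rewrite mulf_eq0 negb_or => /andP[_].
  exact: (test_box_supported tp).
have I0 : \int[leb]_x (f x * pderiv i phi x + pderiv i f x * phi x) = 0.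
  rewrite /Rintegral; under eq_integral do rewrite -dgE.
  have cdg : continuous (pderiv i g).
    rewrite (_ : pderiv i g = fun x => f x * pderiv i phi x + pderiv i f x * phi x).
      by move=> x; apply: (@cvgD _ _ _ (nbhs x)); [exact: c1|exact: c2].
    by apply/funext => x; exact: dgE.
  have bg : box_supported M g.
    move=> x; rewrite /g mulf_eq0 negb_or => /andP[_].
    exact: (test_box_supported tp).
  have dg x : derivable g x (delta_mx ord0 i) by exact: (derivableM (df x) (dp x)).
  by have -> := integral_pderiv cg dg cdg bg.
(* Both integrands carry a factor supported in [Omega], so the integrals over [Omega] and over the
   whole space agree. *)
have restr h : (forall x, ~ Omega x -> h x = 0) ->
    \int[leb]_(x in Omega) h x = \int[leb]_x h x.
  move=> h0; rewrite [LHS]Rintegral_mkcond; apply: eq_Rintegral => x _.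
  by rewrite patchE; case: ifPn => //; rewrite notin_setE => /h0.
rewrite sqdot.unlock !restr; last 2 first.
- by move=> x nO; rewrite (test_function_outside tp nO) mulr0.
- by move=> x nO; rewrite (test_function_outside tdp nO) mulr0.
by apply/eqP; rewrite -addr_eq0 -RintegralD// I0.
Qed.

Lemma test_weak_pderiv phi i : test_function Omega phi ->
  is_weak_pderiv Omega i phi (pderiv i phi).
Proof.
move=> tp psi tpsi; have := test_ibp.
rewrite sqdot.unlock => ibp; have sp := test_function_smooth tp.
apply: (ibp _ _ _ _ _ _ tpsi).
- exact: smooth_continuous.
- by move=> x; exact: smooth_derivable.
- by apply: smooth_continuous; exact: smooth_pderiv.
Qed.

Lemma weak_pderiv_uniq i w g g' : L2O g -> L2O g' ->
  is_weak_pderiv Omega i w g -> is_weak_pderiv Omega i w g' ->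
  {ae leb, forall x, Omega x -> g x = g' x}.
Proof.
move=> Sg Sg' wg wg'.
have := @fundamental_lemma _ _ Omega (fun x => g x - g' x) oO.
have Sgg := sqintB mO Sg Sg'.
move=> /(_ (sqint_integrable Sgg)).
have H phi : test_function Omega phi -> \int[leb]_(x in Omega) ((g x - g' x) * phi x) = 0.
  move=> tp; have := sqdot_lin mO (-1) Sg' Sg (test_sqint tp).
  have := wg _ tp; rewrite (wg' _ tp) => /oppr_inj E.
  rewrite sqdot.unlock E mulN1r addNr => <-.
  by apply: eq_Rintegral => x _; rewrite mulN1r (addrC (- _)).
move=> /(_ H); apply: filterS => x E Ox.
by apply/eqP; rewrite -subr_eq0; apply/eqP; exact: E.
Qed.

Lemma weak_pderivP i w : H1 Omega w ->
  L2O (wpderiv Omega i w) /\ is_weak_pderiv Omega i w (wpderiv Omega i w).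
Proof.
move=> [_ /(_ i) Hw]; rewrite wpderiv.unlock /weak_pderiv.
have [/L2P H1 H2] := xgetPex (cst 0) Hw.
by split.
Qed.

(** The chosen representative of a weak derivative is known only through this comparison: whenever a
    candidate is found, it may replace the choice almost everywhere. *)
Lemma weak_pderiv_ae i w g : L2O g -> is_weak_pderiv Omega i w g ->
  L2O (wpderiv Omega i w) /\
  {ae leb, forall x, Omega x -> wpderiv Omega i w x = g x}.
Proof.
move=> Sg wg; have Hw : exists g, L2 Omega g /\ is_weak_pderiv Omega i w g.
  by exists g; split => //; apply/L2P.
rewrite wpderiv.unlock; have [/L2P S1 H2] : (L2 Omega `&` is_weak_pderiv Omega i w) (weak_pderiv Omega i w).
  exact: (xgetPex (cst 0) Hw).
by split => //; exact: weak_pderiv_uniq H2 wg.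
Qed.

Lemma is_weak_pderiv_lin i (a : R) w v g h : L2O w -> L2O v -> L2O g -> L2O h ->
  is_weak_pderiv Omega i w g -> is_weak_pderiv Omega i v h ->
  is_weak_pderiv Omega i (fun x => a * w x + v x) (fun x => a * g x + h x).
Proof.
move=> Sw Sv Sg Sh wg vh phi tp.
have Sp := test_sqint tp; have Sdp := test_sqint (test_function_pderiv i tp).
have E f g' : \int[leb]_(x in Omega) (f x * g' x) = dot f g' by rewrite sqdot.unlock.
rewrite !E !sqdot_lin//.
have -> : dot w (pderiv i phi) = - dot g phi by rewrite -!E; exact: wg.
have -> : dot v (pderiv i phi) = - dot h phi by rewrite -!E; exact: vh.
by rewrite mulrN opprD.
Qed.

Lemma H1_L2 w : H1 Omega w -> L2O w.
Proof. by move=> [/L2P]. Qed.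

Lemma H1_lin (a : R) w v : H1 Omega w -> H1 Omega v -> H1 Omega (fun x => a * w x + v x).
Proof.
move=> Hw Hv; split; first by apply/L2P; apply: sqint_lin => //; exact: H1_L2.
move=> i; have [Sg wg] := weak_pderivP i Hw; have [Sh vh] := weak_pderivP i Hv.
exists (fun x => a * wpderiv Omega i w x + wpderiv Omega i v x); split.
  by apply/L2P; exact: sqint_lin.
by apply: is_weak_pderiv_lin => //; exact: H1_L2.
Qed.

Lemma weak_pderiv_lin i (a : R) w v : H1 Omega w -> H1 Omega v ->
  {ae leb, forall x, Omega x -> wpderiv Omega i (fun x => a * w x + v x) x =
     a * wpderiv Omega i w x + wpderiv Omega i v x}.
Proof.
move=> Hw Hv; have [Sg wg] := weak_pderivP i Hw; have [Sh vh] := weak_pderivP i Hv.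
apply: (weak_pderiv_ae (sqint_lin mO a Sg Sh) _).2.
by apply: is_weak_pderiv_lin => //; exact: H1_L2.
Qed.

Lemma test_H1 phi : test_function Omega phi -> H1 Omega phi.
Proof.
move=> tp; split; first by apply/L2P; exact: test_sqint.
move=> i; exists (pderiv i phi); split; last exact: test_weak_pderiv.
by apply/L2P; apply: test_sqint; exact: test_function_pderiv.
Qed.

Lemma test_weak_pderiv_ae i phi : test_function Omega phi ->
  {ae leb, forall x, Omega x -> wpderiv Omega i phi x = pderiv i phi x}.
Proof.
move=> tp; apply: (weak_pderiv_ae _ (test_weak_pderiv i tp)).2.
by apply: test_sqint; exact: test_function_pderiv.
Qed.

Local Notation H1dot := (H1dot Omega).

Lemma H1_normE w : H1_norm Omega w = Num.sqrt (H1dot w w).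
Proof.
rewrite /H1_norm H1dot.unlock sqdot.unlock wpderiv.unlock; congr (Num.sqrt (_ + _)).
Qed.

Lemma H1dotC w v : H1dot w v = H1dot v w.
Proof.
by rewrite H1dot.unlock; apply: congr2; [exact: sqdotC|apply: eq_bigr => i _; exact: sqdotC].
Qed.

Lemma H1dot_ge0 w : 0 <= H1dot w w.
Proof. by rewrite H1dot.unlock addr_ge0 ?sqdot_ge0// sumr_ge0// => i _; exact: sqdot_ge0. Qed.

Lemma dot_weak_lin i (a : R) w v h : H1 Omega w -> H1 Omega v -> L2O h ->
  dot (wpderiv Omega i (fun x => a * w x + v x)) h =
  a * dot (wpderiv Omega i w) h + dot (wpderiv Omega i v) h.
Proof.
move=> Hw Hv Sh; have [Sg _] := weak_pderivP i Hw; have [Sg' _] := weak_pderivP i Hv.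
rewrite -sqdot_lin//; apply: sqdot_ae => //.
- by have [] := weak_pderivP i (H1_lin a Hw Hv).
- exact: sqint_lin.
- exact: weak_pderiv_lin.
- exact: aeW.
Qed.

Lemma H1dot_lin (a : R) w v h : H1 Omega w -> H1 Omega v -> H1 Omega h ->
  H1dot (fun x => a * w x + v x) h = a * H1dot w h + H1dot v h.
Proof.
move=> Hw Hv Hh; rewrite H1dot.unlock sqdot_lin//; try exact: H1_L2.
rewrite mulrDr addrACA mulr_sumr -big_split/=; congr (_ + _); apply: eq_bigr => i _.
by rewrite dot_weak_lin//; have [] := weak_pderivP i Hh.
Qed.

Let fnE : lmodType R := fn.

Lemma H1_norm_triangle w v : H1 Omega w -> H1 Omega v ->
  H1_norm Omega (fun x => w x + v x) <= H1_norm Omega w + H1_norm Omega v.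
Proof.
move=> Hw Hv; rewrite 3!H1_normE.
exact: (@psd_triangle R fnE (H1 Omega) H1dot H1_lin H1dot_lin
  (fun u1 u2 _ _ => H1dotC u1 u2) (fun u1 _ => H1dot_ge0 u1) w v Hw Hv).
Qed.

Lemma H1_norm_scale (a : R) w : H1 Omega w ->
  H1_norm Omega (fun x => a * w x) = `|a| * H1_norm Omega w.
Proof.
move=> Hw; rewrite 2!H1_normE.
exact: (@psd_scale R fnE (H1 Omega) H1dot H1_lin H1dot_lin
  (fun u1 u2 _ _ => H1dotC u1 u2) a w Hw).
Qed.

Lemma H1B w v : H1 Omega w -> H1 Omega v -> H1 Omega (fun x => w x - v x).
Proof.
move=> Hw Hv; have := H1_lin (-1) Hv Hw; congr (H1 _ _).
by apply/funext => x; rewrite mulN1r addrC.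
Qed.

Lemma H1_norm_distC w v : H1 Omega w -> H1 Omega v ->
  H1_norm Omega (fun x => w x - v x) = H1_norm Omega (fun x => v x - w x).
Proof.
move=> Hw Hv; have := H1_norm_scale (-1) (H1B Hv Hw); rewrite normrN1 mul1r => <-.
by apply: congr1; apply/funext => x; rewrite mulN1r opprB.
Qed.

Definition L2norm f : R := Num.sqrt (dot f f).

Lemma L2norm_H1 w : L2norm w <= H1_norm Omega w.
Proof.
rewrite H1_normE ler_wsqrtr// H1dot.unlock lerDl.
by apply: sumr_ge0 => i _; exact: sqdot_ge0.
Qed.

Lemma L2norm_weak_H1 i w : L2norm (wpderiv Omega i w) <= H1_norm Omega w.
Proof.
rewrite H1_normE ler_wsqrtr// H1dot.unlock (bigD1 i)//= addrCA lerDl addr_ge0 ?sqdot_ge0//.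
by apply: sumr_ge0 => j _; exact: sqdot_ge0.
Qed.

Lemma weak_pderivB_ae i w v : H1 Omega w -> H1 Omega v ->
  {ae leb, forall x, Omega x -> wpderiv Omega i (fun x => w x - v x) x =
     wpderiv Omega i w x - wpderiv Omega i v x}.
Proof.
move=> Hw Hv; have := weak_pderiv_lin i (-1) Hv Hw.
rewrite (_ : (fun x => -1 * v x + w x) = fun x => w x - v x); last first.
  by apply/funext => x; rewrite mulN1r addrC.
by apply: filterS => x H Ox; rewrite H// mulN1r addrC.
Qed.

Lemma H10_approx w e : H10 Omega w -> 0 < e ->
  exists2 phi, test_function Omega phi & H1_norm Omega (fun x => w x - phi x) <= e.
Proof.
move=> [Hw [phi [tp cphi]]] e0.
have /cvgr0Pnorm_le/(_ e e0)[k _ /(_ k (leqnn k))] /= := cphi.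
by rewrite ger0_norm ?sqrtr_ge0//; exists (phi k).
Qed.

Lemma H10_intro w : H1 Omega w ->
  (forall e, 0 < e -> exists2 phi, test_function Omega phi &
    H1_norm Omega (fun x => w x - phi x) <= e) -> H10 Omega w.
Proof.
move=> Hw ap; split => //.
have divr_gt0' (k : nat) : 0 < k.+1%:R^-1 :> R by rewrite invr_gt0.
have /choice[phi Hphi] : forall k : nat, exists phi, test_function Omega phi /\
    H1_norm Omega (fun x => w x - phi x) <= k.+1%:R^-1.
  by move=> k; have [phi tp Hp] := ap k.+1%:R^-1 (divr_gt0' k); exists phi.
exists phi; split; first by move=> k; have [] := Hphi k.
apply/cvgr0Pnorm_le => e e0; near=> k.
rewrite ger0_norm ?sqrtr_ge0//; have [_ /le_trans] := Hphi k; apply.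
by apply: ltW; near: k; exact: (near_infty_natSinv_lt (PosNum e0)).
Unshelve. all: by end_near. Qed.

Lemma H10_H1 w : H10 Omega w -> H1 Omega w.
Proof. by case. Qed.

Lemma H10_lin (a : R) w v : H10 Omega w -> H10 Omega v -> H10 Omega (fun x => a * w x + v x).
Proof.
move=> H0w H0v; have Hw := H10_H1 H0w; have Hv := H10_H1 H0v.
apply: H10_intro; first exact: H1_lin.
move=> e e0; have d0 : 0 < e / (`|a| + 1) by rewrite divr_gt0// ltr_wpDl.
have [phi tp Hp] := H10_approx H0w (divr_gt0 d0 (ltr0n _ 2)).
have [psi tq Hq] := H10_approx H0v (divr_gt0 e0 (ltr0n _ 2)).
exists (fun x => a * phi x + psi x); first exact: test_function_lin.
rewrite (_ : (fun x => _) = fun x => a * (w x - phi x) + (v x - psi x)); last first.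
  by apply/funext => x; ring.
have H1p := H1B Hw (test_H1 tp); have H1q := H1B Hv (test_H1 tq).
have H1ap : H1 Omega (fun x => a * (w x - phi x)).
  have := H1_lin (a - 1) H1p H1p; congr (H1 _ _); apply/funext => x; ring.
apply: (le_trans (H1_norm_triangle H1ap H1q)); rewrite H1_norm_scale//.
rewrite [leRHS](splitr e); apply: lerD => //.
apply: (@le_trans _ _ ((`|a| + 1) * (e / (`|a| + 1) / 2))).
  by apply: ler_pM => //; rewrite ?sqrtr_ge0// lerDl.
by rewrite mulrA [_ * (e / _)]mulrC divfK// gt_eqF// ltr_wpDl.
Qed.

(** Density of the test functions in [H10]. The sign of [C] is unknown, so |C| + 1 is used as a
    positive bound. *)
Lemma linear_bounded_zero (T : fn -> R) (C : R) :
  (forall w v, H1 Omega w -> H1 Omega v -> T (fun x => w x - v x) = T w - T v) ->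
  (forall w, H1 Omega w -> `|T w| <= C * H1_norm Omega w) ->
  (forall phi, test_function Omega phi -> T phi = 0) ->
  forall w, H10 Omega w -> T w = 0.
Proof.
move=> TB TC T0 w Hw; apply/eqP; rewrite -normr_le0; apply/ler_addgt0Pr => e e0; rewrite add0r.
have d0 : 0 < e / (`|C| + 1) by rewrite divr_gt0// ltr_wpDl.
have [phi tp Hp] := H10_approx Hw d0.
have := TB _ _ (H10_H1 Hw) (test_H1 tp); rewrite (T0 _ tp) subr0 => <-.
apply: (le_trans (TC _ (H1B (H10_H1 Hw) (test_H1 tp)))).
apply: (@le_trans _ _ ((`|C| + 1) * (e / (`|C| + 1)))).
  apply: (@le_trans _ _ ((`|C| + 1) * H1_norm Omega (fun x => w x - phi x))).
    apply: ler_wpM2r; first exact: sqrtr_ge0.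
    by rewrite (le_trans (ler_norm C))// lerDl.
  by apply: ler_wpM2l => //; rewrite addr_ge0.
by rewrite mulrC divfK// gt_eqF// ltr_wpDl.
Qed.

Lemma dot_test_symm i j phi psi : test_function Omega phi -> test_function Omega psi ->
  dot (pderiv i phi) (pderiv j psi) = dot (pderiv j phi) (pderiv i psi).
Proof.
move=> tp tq; have sp := test_function_smooth tp; have sq := test_function_smooth tq.
have ibp k l : dot (pderiv k phi) (pderiv l psi) = - dot (pderiv l (pderiv k phi)) psi.
  apply: test_ibp => //; first exact/smooth_continuous/smooth_pderiv.
    by move=> x; apply: smooth_derivable; exact: smooth_pderiv.
  by apply: smooth_continuous; do 2!apply: smooth_pderiv.
have E : pderiv j (pderiv i phi) = pderiv i (pderiv j phi).
  by apply/funext => x; exact: pderivC.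
by rewrite (ibp i j) (ibp j i) E.
Qed.

(** For test functions both sides are integrated by parts and second derivatives commute. The
    difference [T] of the two sides is continuous in the H1 norm, so it vanishes on [H10] by
    density, one argument at a time. This is the exchange behind Korn's inequality. *)
Lemma weak_symm i j w v : H10 Omega w -> H10 Omega v ->
  dot (wpderiv Omega i w) (wpderiv Omega j v) =
  dot (wpderiv Omega j w) (wpderiv Omega i v).
Proof.
pose T w v := dot (wpderiv Omega i w) (wpderiv Omega j v) -
  dot (wpderiv Omega j w) (wpderiv Omega i v).
have TB w1 w2 v1 : H1 Omega w1 -> H1 Omega w2 -> H1 Omega v1 ->
    T (fun x => w1 x - w2 x) v1 = T w1 v1 - T w2 v1.
  move=> H1 H2 Hv; rewrite /T.
  rewrite (_ : (fun x => w1 x - w2 x) = fun x => -1 * w2 x + w1 x); last first.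
    by apply/funext => x; rewrite mulN1r addrC.
  have [Si _] := weak_pderivP i Hv; have [Sj _] := weak_pderivP j Hv.
  have aux (a b c e : R) : -1 * a + b - (-1 * c + e) = b - e - (a - c) by ring.
  have E1 := dot_weak_lin i (-1) H2 H1 Sj; have E2 := dot_weak_lin j (-1) H2 H1 Si.
  exact: (etrans (congr2 (fun a b => a - b) E1 E2) (aux _ _ _ _)).
have TC w1 v1 : H1 Omega w1 -> H1 Omega v1 ->
    `|T w1 v1| <= (2 * H1_norm Omega v1) * H1_norm Omega w1.
  move=> Hw Hv.
  have [Si _] := weak_pderivP i Hv; have [Sj _] := weak_pderivP j Hv.
  have [Swi _] := weak_pderivP i Hw; have [Swj _] := weak_pderivP j Hw.
  apply: (le_trans (ler_normB _ _)); rewrite -mulrA mulr_natl mulr2n; apply: lerD.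
    apply: (le_trans (sqdot_CS mO Swi Sj)); rewrite mulrC.
    by apply: ler_pM; rewrite ?sqrtr_ge0//; exact: L2norm_weak_H1.
  apply: (le_trans (sqdot_CS mO Swj Si)); rewrite mulrC.
  by apply: ler_pM; rewrite ?sqrtr_ge0//; exact: L2norm_weak_H1.
have Ttest phi psi : test_function Omega phi -> test_function Omega psi -> T phi psi = 0.
  move=> tp tq; rewrite /T.
  have E k l : dot (wpderiv Omega k phi) (wpderiv Omega l psi) =
      dot (pderiv k phi) (pderiv l psi).
    apply: sqdot_ae => //.
    - by have [] := weak_pderivP k (test_H1 tp).
    - by apply: test_sqint; exact: test_function_pderiv.
    - by have [] := weak_pderivP l (test_H1 tq).
    - by apply: test_sqint; exact: test_function_pderiv.
    - exact: test_weak_pderiv_ae.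
    - exact: test_weak_pderiv_ae.
  by rewrite !E dot_test_symm// subrr.
have Ttest2 psi w1 : test_function Omega psi -> H10 Omega w1 -> T w1 psi = 0.
  move=> tq Hw1; apply: (@linear_bounded_zero (T ^~ psi) (2 * H1_norm Omega psi)) => //.
  - by move=> w2 v2 H2 Hv2; apply: TB => //; exact: test_H1.
  - by move=> w2 Hw2; apply: TC => //; exact: test_H1.
  - by move=> phi tp; exact: Ttest.
(* Antisymmetry of [T] turns the second argument into the first one, so the density argument in the
   first argument serves for both. *)
have TS w1 v1 : T v1 w1 = - T w1 v1.
  rewrite /T opprB; apply: congr2; first exact: sqdotC.
  by apply: congr1; exact: sqdotC.
move=> Hw Hv; apply/eqP; rewrite -subr_eq0 -/(T w v) -oppr_eq0 -TS; apply/eqP.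
have Hw1 := H10_H1 Hw.
apply: (@linear_bounded_zero (T ^~ w) (2 * H1_norm Omega w)) => //.
- by move=> w2 v2 H2 Hv2; exact: TB.
- by move=> w2 Hw2; exact: TC.
- by move=> phi tp; rewrite TS Ttest2// oppr0.
Qed.

End sobolev.

(** * Poincare, Korn and completeness *)

Lemma sum_CS (R : realType) (I : finType) (a b : I -> R) :
  `|\sum_i a i * b i| <= Num.sqrt (\sum_i a i ^+ 2) * Num.sqrt (\sum_i b i ^+ 2).
Proof.
pose B (f g : I -> R) := \sum_i f i * g i.
have BE f : B f f = \sum_i f i ^+ 2 by apply: eq_bigr => i _; rewrite expr2.
rewrite -!BE.
apply: (@psd_CS R (I -> R : lmodType R) setT B) => //.
- move=> c u v w _ _ _; rewrite /B mulr_sumr -big_split/=; apply: eq_bigr => i _.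
  by rewrite /GRing.add/= /GRing.scale/= mulrDl mulrA.
- by move=> u v _ _; apply: eq_bigr => i _; rewrite mulrC.
- by move=> u _; rewrite BE sumr_ge0// => i _; rewrite sqr_ge0.
Qed.

Lemma cvg_sum0 (R : realType) (I : Type) (s : seq I) (a : I -> nat -> R) :
  (forall i, a i @ \oo --> (0 : R)) ->
  (fun k => \sum_(i <- s) a i k) @ \oo --> (0 : R).
Proof.
move=> a0; elim: s => [|i s IHs].
  by under eq_fun do rewrite big_nil; exact: cvg_cst.
under eq_fun do rewrite big_cons.
have G := cvgD (a0 i) IHs; rewrite addr0 in G; exact: G.
Qed.

Lemma sqrtr_le_sqr (R : rcfType) (a e : R) : 0 <= e -> a <= e ^+ 2 -> Num.sqrt a <= e.
Proof. by move=> e0 H; rewrite -[leRHS](ger0_norm e0) -sqrtr_sqr ler_wsqrtr. Qed.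

Section sqdot_sum.
Context d (T : measurableType d) (R : realType) (mu : {measure set T -> \bar R}).
Context (D : set T) (mD : measurable D).
Local Notation dot := (sqdot mu D).
Local Notation S := (sqint mu D).
Implicit Types f g h : T -> R.

Lemma sqint0 : S (cst 0).
Proof.
split => //; rewrite (_ : _ \o _ = cst 0%E); first exact: integrable0.
by apply/funext => x /=; rewrite expr0n.
Qed.

Lemma sqintZ (a : R) f : S f -> S (fun x => a * f x).
Proof.
move=> Sf; have := sqint_lin mD a Sf sqint0; congr sqint.
by apply/funext => x /=; rewrite addr0.
Qed.

Lemma sqintD f g : S f -> S g -> S (fun x => f x + g x).
Proof.
move=> Sf Sg; have := sqint_lin mD 1 Sf Sg; congr sqint.
by apply/funext => x /=; rewrite mul1r.
Qed.

Lemma sqdotD f g h : S f -> S g -> S h ->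
  dot (fun x => f x + g x) h = dot f h + dot g h.
Proof.
move=> Sf Sg Sh; have := sqdot_lin mD 1 Sf Sg Sh; rewrite mul1r => <-.
by congr sqdot; apply/funext => x; rewrite mul1r.
Qed.

Lemma sqdot0l h : S h -> dot (cst 0) h = 0.
Proof.
move=> Sh; have := sqdotD sqint0 sqint0 Sh.
rewrite (_ : (fun x : T => cst 0 x + cst 0 x) = cst 0).
  by move/eqP; rewrite -subr_eq0 opprD addNKr oppr_eq0 => /eqP.
by apply/funext => x /=; rewrite addr0.
Qed.

Lemma sqdotZ (a : R) f h : S f -> S h -> dot (fun x => a * f x) h = a * dot f h.
Proof.
move=> Sf Sh; have := sqdot_lin mD a Sf sqint0 Sh; rewrite sqdot0l// addr0 => <-.
by congr sqdot; apply/funext => x /=; rewrite addr0.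
Qed.

Lemma sqint_sum (I : Type) (s : seq I) (f : I -> T -> R) :
  (forall i, S (f i)) -> S (fun x => \sum_(i <- s) f i x).
Proof.
move=> Sf; elim: s => [|i s IHs].
  by under eq_fun do rewrite big_nil; exact: sqint0.
by under eq_fun do rewrite big_cons; exact: sqintD.
Qed.

Lemma sqdot_sum (I : Type) (s : seq I) (f : I -> T -> R) h :
  (forall i, S (f i)) -> S h -> dot (fun x => \sum_(i <- s) f i x) h = \sum_(i <- s) dot (f i) h.
Proof.
move=> Sf Sh; elim: s => [|i s IHs].
  by under eq_fun do rewrite big_nil; rewrite big_nil sqdot0l.
by under eq_fun do rewrite big_cons; rewrite big_cons sqdotD ?IHs//; exact: sqint_sum.
Qed.

Lemma sqdot_le f g : S f -> S g -> {ae mu, forall x, D x -> `|f x| <= `|g x|} ->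
  dot f f <= dot g g.
Proof.
move=> Sf Sg fg; rewrite -lee_fin -!sqdotE//.
have [mf _] := Sf; have [mg _] := Sg.
apply: ae_ge0_le_integral => //.
- by move=> x _; rewrite lee_fin sqr_ge0.
- by apply/measurable_EFinP; exact: measurable_funX.
- by move=> x _; rewrite lee_fin sqr_ge0.
- by apply/measurable_EFinP; exact: measurable_funX.
apply: filterS fg => x H Dx; rewrite lee_fin.
by rewrite -[leLHS]real_normK ?num_real// -[leRHS]real_normK ?num_real// ler_sqr ?nnegrE ?H.
Qed.

Lemma sqdot_bddM (C : R) f g : 0 <= C -> S f -> measurable_fun D g ->
  {ae mu, forall x, D x -> `|g x| <= C} ->
  Num.sqrt (dot (fun x => g x * f x) (fun x => g x * f x)) <= C * Num.sqrt (dot f f).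
Proof.
move=> C0 Sf mg gC; have SCf := sqintZ C Sf.
have E : dot (fun x => C * f x) (fun x => C * f x) = C ^+ 2 * dot f f.
  by rewrite sqdotZ// sqdotC sqdotZ// mulrA expr2.
rewrite -[X in X * Num.sqrt _](ger0_norm C0) -sqrtr_sqr -sqrtrM ?sqr_ge0// -E ler_wsqrtr//.
apply: sqdot_le => //; first exact: sqint_bddM gC.
apply: filterS gC => x H Dx; rewrite !normrM ler_wpM2r// (le_trans (H Dx))//.
exact: ler_norm.
Qed.

(** Cauchy-Schwarz for the norms of the f_i against the constant family 1. The factor n obtained
    here is the d in [b_hat]. *)
Lemma sqdot_sum_sqr n (f : 'I_n -> T -> R) : (forall i, S (f i)) ->
  dot (fun x => \sum_i f i x) (fun x => \sum_i f i x) <= n%:R * \sum_i dot (f i) (f i).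
Proof.
move=> Sf; have Ss : S (fun x => \sum_i f i x) by exact: sqint_sum.
rewrite sqdot_sum//; under eq_bigr do rewrite sqdotC sqdot_sum//.
pose N i := Num.sqrt (dot (f i) (f i)).
apply: (@le_trans _ _ (\sum_i \sum_j N i * N j)).
  apply: ler_sum => i _; apply: ler_sum => j _.
  by rewrite mulrC; apply: le_trans (sqdot_CS mD (Sf j) (Sf i)); exact: ler_norm.
have -> : \sum_i \sum_j N i * N j = (\sum_i 1 * N i) ^+ 2.
  rewrite expr2 mulr_suml; apply: eq_bigr => i _; rewrite mulr_sumr; apply: eq_bigr => j _.
  by rewrite !mul1r.
have := sum_CS (fun _ : 'I_n => 1) N.
have -> : \sum_(i < n) (1 : R) ^+ 2 = n%:R.
  by under eq_bigr do rewrite expr1n; rewrite sumr_const card_ord.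
have -> : \sum_(i < n) N i ^+ 2 = \sum_i dot (f i) (f i).
  by apply: eq_bigr => i _; rewrite sqr_sqrtr// sqdot_ge0.
have nn : 0 <= \sum_i dot (f i) (f i) by apply: sumr_ge0 => i _; exact: sqdot_ge0.
rewrite -sqrtrM ?ler0n// => H.
rewrite -real_normK ?num_real// -[leRHS]sqr_sqrtr ?mulr_ge0 ?ler0n//.
by rewrite ler_sqr ?nnegrE// sqrtr_ge0.
Qed.

End sqdot_sum.

Section poincare.
Context (R : realType) (n : nat) (Omega : set 'rV[R]_n) (M : R).
Hypothesis oO : open Omega.
Hypothesis bO : forall x, Omega x -> forall i, `|x ord0 i| <= M.
Hypothesis M0 : 0 <= M.
Local Notation leb := (lebesgue_rV R n).
Local Notation fn := ('rV[R]_n -> R).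
Local Notation L2O := (sqint leb Omega).
Local Notation dot := (sqdot leb Omega).
Local Notation L2norm := (L2norm Omega).

Let mO : measurable Omega := open_measurable_rV oO.

Lemma is_derive_coord (i : 'I_n) (x : 'rV[R]_n) :
  is_derive x (delta_mx ord0 i) (fun x : 'rV[R]_n => x ord0 i) (1 : R).
Proof.
apply: is_derive_slice.
have -> : (fun h : R => (h *: delta_mx ord0 i + x) ord0 i) = (+%R^~ (x ord0 i)).
  by apply/funext => h; rewrite !mxE !eqxx mulr1.
exact: is_derive_shift.
Qed.

Lemma poincare_test (i : 'I_n) phi : test_function Omega phi ->
  L2norm phi <= 2 * M * L2norm (pderiv i phi).
Proof.
move=> tp; have sp := test_function_smooth tp; have tdp := test_function_pderiv i tp.
have cp := smooth_continuous sp; have cdp := smooth_continuous (smooth_pderiv i sp).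
pose X : fn := fun x => x ord0 i.
have cX : continuous X by exact: coord_continuous.
have mX : measurable_fun Omega X by apply: measurable_funTS; exact: continuous_measurable_rV.
(* Integrating f = x_i phi by parts against phi itself gives |phi|^2 = -2 <x_i phi, d_i phi>; as
   |x_i| <= M, the constant 2 M follows after division by |phi|. *)
pose f : fn := fun x => X x * phi x.
have cf : continuous f by move=> x; apply: (@cvgM _ _ (nbhs x)); [exact: cX|exact: cp].
have dX x : derivable X x (delta_mx ord0 i) by have [] := is_derive_coord i x.
have dp x := @smooth_derivable _ _ phi i x sp.
have df x : derivable f x (delta_mx ord0 i) := derivableM (dX x) (dp x).
have dfE : pderiv i f = fun x => X x * pderiv i phi x + phi x.
  apply/funext => x; rewrite /pderiv (deriveM (dX x) (dp x)); congr (_ + _).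
  by have [_ ->] := is_derive_coord i x; rewrite /GRing.scale/= mulr1.
have cdf : continuous (pderiv i f).
  rewrite dfE => x; apply: (@cvgD _ _ _ (nbhs x)); last exact: cp.
  by apply: (@cvgM _ _ (nbhs x)); [exact: cX|exact: cdp].
have bX : {ae leb, forall x, Omega x -> `|X x| <= M} by apply: aeW => x Ox; exact: bO.
have Sp : L2O phi := test_sqint oO bO tp.
have Sdp : L2O (pderiv i phi) := test_sqint oO bO tdp.
have SXdp : L2O (fun x => X x * pderiv i phi x) := sqint_bddM mO Sdp mX bX.
have := test_ibp bO cf df cdf tp.
rewrite dfE sqdotD//.
have -> : dot (fun x => X x * pderiv i phi x) phi = dot f (pderiv i phi).
  by rewrite sqdot.unlock; apply: eq_Rintegral => x _; rewrite /f mulrAC.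
move=> E.
have Sf : L2O f := sqint_bddM mO Sp mX bX.
have E2 : dot phi phi = - (2 * dot f (pderiv i phi)) by move: E; lra.
have H : dot phi phi <= 2 * (M * L2norm phi * L2norm (pderiv i phi)).
  rewrite E2 -mulrN ler_pM2l//; apply: (le_trans (ler_norm _)); rewrite normrN.
  apply: (le_trans (sqdot_CS mO Sf Sdp)); apply: ler_wpM2r; first exact: sqrtr_ge0.
  exact: sqdot_bddM bX.
have [p0|p0] := eqVneq (L2norm phi) 0.
  by rewrite p0 !mulr_ge0// sqrtr_ge0.
have pgt : 0 < L2norm phi by rewrite lt_neqAle eq_sym p0 sqrtr_ge0.
rewrite -(ler_pM2l pgt).
have -> : L2norm phi * L2norm phi = dot phi phi by rewrite -expr2 sqr_sqrtr// sqdot_ge0.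
by apply: (le_trans H); rewrite le_eqVlt; apply/orP; left; apply/eqP; ring.
Qed.

Lemma L2normB_le f g : L2O f -> L2O g -> L2norm f <= L2norm (fun x => f x - g x) + L2norm g.
Proof.
move=> Sf Sg; have := sqdot_triangle mO (sqintB mO Sf Sg) Sg.
by rewrite (_ : (fun x => _ - _ + _) = f)//; apply/funext => x; rewrite subrK.
Qed.

Lemma L2norm_ae f g : L2O f -> L2O g -> {ae leb, forall x, Omega x -> f x = g x} ->
  L2norm f = L2norm g.
Proof. by move=> Sf Sg fg; exact: (congr1 Num.sqrt (sqdot_ae mO Sf Sg Sf Sg fg fg)). Qed.

Lemma L2norm_distC f g : L2norm (fun x => f x - g x) = L2norm (fun x => g x - f x).
Proof.
apply: (congr1 Num.sqrt); rewrite sqdot.unlock; apply: eq_Rintegral => x _.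
by rewrite -mulrNN !opprB.
Qed.

Lemma poincare_H10 (i : 'I_n) w : H10 Omega w -> L2norm w <= 2 * M * L2norm (wpderiv Omega i w).
Proof.
move=> H0w; have Hw := H10_H1 H0w; apply/ler_addgt0Pr => e e0.
(* An approximation error delta costs delta for the function and 2 M delta for its derivative, so
   delta = e / (2 M + 1). *)
have D0 : 0 < 2 * M + 1 by rewrite ltr_wpDl// mulr_ge0.
have [phi tp Hp] := H10_approx H0w (divr_gt0 e0 D0).
have Hphi := test_H1 oO bO tp.
have [Sw _] := weak_pderivP oO i Hw; have [Sphi _] := weak_pderivP oO i Hphi.
have Sdp : L2O (pderiv i phi) := test_sqint oO bO (test_function_pderiv i tp).
have L1 := L2normB_le (H1_L2 oO Hw) (H1_L2 oO Hphi).
have L2 := le_trans (L2norm_H1 Omega (fun x => w x - phi x)) Hp.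
have L3 := poincare_test i tp.
have L4 : L2norm (pderiv i phi) <= L2norm (wpderiv Omega i w) + e / (2 * M + 1).
  rewrite -(L2norm_ae Sphi Sdp (test_weak_pderiv_ae oO bO i tp)).
  apply: (le_trans (L2normB_le Sphi Sw)); rewrite addrC lerD2l L2norm_distC.
  apply: le_trans Hp; apply: le_trans (L2norm_weak_H1 Omega i (fun x => w x - phi x)).
  rewrite le_eqVlt; apply/orP; left; apply/eqP; apply: L2norm_ae.
  - exact: sqintB.
  - by have [] := weak_pderivP oO i (H1B oO bO Hw Hphi).
  - apply: filterS (weak_pderivB_ae oO bO i Hw Hphi) => x Hx Ox.
    by rewrite Hx.
have L5 : 2 * M * (e / (2 * M + 1)) + e / (2 * M + 1) = e by field; rewrite gt_eqF.
have L6 := ler_wpM2l (mulr_ge0 (ler0n _ 2) M0) L4.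
move: L1 L2 L3 L6; rewrite mulrDr; move: (e / _) L5 => t L5.
move: (L2norm w) (L2norm _) (L2norm phi) (L2norm _) (L2norm _) => a b c p q; lra.
Qed.

End poincare.

Section vector_fields.
Context (R : realType) (n : nat) (Omega : set 'rV[R]_n) (M : R).
Hypothesis oO : open Omega.
Hypothesis bO : forall x, Omega x -> forall i, `|x ord0 i| <= M.
Hypothesis M0 : 0 <= M.
Local Notation leb := (lebesgue_rV R n).
Local Notation fn := ('rV[R]_n -> R).
Local Notation field := ('rV[R]_n -> 'rV[R]_n).
Local Notation L2O := (sqint leb Omega).
Local Notation dot := (sqdot leb Omega).
Implicit Types u v w : field.

Let mO : measurable Omega := open_measurable_rV oO.

Definition grad v i j : fn := wpderiv Omega i (component v j).
Definition symgrad v i j : fn := fun x => 2^-1 * (grad v i j x + grad v j i x).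
Definition divg v : fn := fun x => \sum_i grad v i i x.

Definition Vdot u v : R := \sum_j H1dot Omega (component u j) (component v j).
Definition Sdot u v : R := \sum_i \sum_j dot (symgrad u i j) (symgrad v i j).
Definition Snorm v : R := Num.sqrt (Sdot v v).

Lemma V_H1 v j : V Omega v -> H1 Omega (component v j).
Proof. by move=> /(_ j)/H10_H1. Qed.

Lemma grad_sqint v i j : V Omega v -> L2O (grad v i j).
Proof. by move=> Vv; have [] := weak_pderivP oO i (V_H1 j Vv). Qed.

Lemma ee_sqint v i j : V Omega v -> L2O (symgrad v i j).
Proof.
by move=> Vv; apply: sqintZ => //; apply: sqintD => //; exact: grad_sqint.
Qed.

Lemma dv_sqint v : V Omega v -> L2O (divg v).
Proof. by move=> Vv; apply: sqint_sum => // i; exact: grad_sqint. Qed.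

Lemma V_lin (a : R) u v : V Omega u -> V Omega v -> V Omega (a *: u + v).
Proof.
move=> Vu Vv j; have := H10_lin oO bO a (Vu j) (Vv j); congr (H10 _ _).
by apply/funext => x; rewrite /component !mxE.
Qed.

Lemma componentD (a : R) u v j :
  component (a *: u + v) j = fun x => a * component u j x + component v j x.
Proof. by apply/funext => x; rewrite /component !mxE. Qed.

Lemma grad_lin (a : R) u v i j : V Omega u -> V Omega v ->
  {ae leb, forall x, Omega x -> grad (a *: u + v) i j x = a * grad u i j x + grad v i j x}.
Proof.
move=> Vu Vv; rewrite /grad componentD.
exact: (weak_pderiv_lin oO bO i a (V_H1 j Vu) (V_H1 j Vv)).
Qed.

Lemma ee_lin (a : R) u v i j : V Omega u -> V Omega v ->
  {ae leb, forall x, Omega x -> symgrad (a *: u + v) i j x = a * symgrad u i j x + symgrad v i j x}.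
Proof.
move=> Vu Vv; apply: filterS2 (grad_lin a i j Vu Vv) (grad_lin a j i Vu Vv) => x H1 H2 Ox.
rewrite /symgrad H1// H2//; move: (grad u i j x) (grad u j i x) (grad v i j x) (grad v j i x).
by move=> *; field.
Qed.

Lemma dv_lin (a : R) u v : V Omega u -> V Omega v ->
  {ae leb, forall x, Omega x -> divg (a *: u + v) x = a * divg u x + divg v x}.
Proof.
move=> Vu Vv.
have : {ae leb, forall x, forall i, Omega x -> grad (a *: u + v) i i x = a * grad u i i x + grad v i i x}.
  by apply: filter_forall => i; exact: grad_lin.
apply: filterS => x H Ox; rewrite /divg mulr_sumr -big_split/=.
by apply: eq_bigr => i _; exact: H.
Qed.

Lemma dot_ee_lin (a : R) u v i j h : V Omega u -> V Omega v -> L2O h ->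
  dot (symgrad (a *: u + v) i j) h = a * dot (symgrad u i j) h + dot (symgrad v i j) h.
Proof.
move=> Vu Vv Sh; have Vw := V_lin a Vu Vv.
have Su := ee_sqint i j Vu; have Sv := ee_sqint i j Vv; have Sw := ee_sqint i j Vw.
rewrite -(sqdot_lin mO a Su Sv Sh); apply: (sqdot_ae mO Sw (sqint_lin mO a Su Sv) Sh Sh).
  exact: ee_lin.
exact: aeW.
Qed.

Lemma Sdot_lin (a : R) u v w : V Omega u -> V Omega v -> V Omega w ->
  Sdot (a *: u + v) w = a * Sdot u w + Sdot v w.
Proof.
move=> Vu Vv Vw; rewrite /Sdot mulr_sumr -big_split/=; apply: eq_bigr => i _.
rewrite mulr_sumr -big_split/=; apply: eq_bigr => j _.
by apply: dot_ee_lin => //; exact: ee_sqint.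
Qed.

Lemma SdotC u v : Sdot u v = Sdot v u.
Proof. by rewrite /Sdot; apply: eq_bigr => i _; apply: eq_bigr => j _; exact: sqdotC. Qed.

Lemma Sdot_ge0 v : 0 <= Sdot v v.
Proof. by apply: sumr_ge0 => i _; apply: sumr_ge0 => j _; exact: sqdot_ge0. Qed.

Lemma Vdot_lin (a : R) u v w : V Omega u -> V Omega v -> V Omega w ->
  Vdot (a *: u + v) w = a * Vdot u w + Vdot v w.
Proof.
move=> Vu Vv Vw; rewrite /Vdot mulr_sumr -big_split/=; apply: eq_bigr => j _.
rewrite componentD; exact: (H1dot_lin oO bO a (V_H1 j Vu) (V_H1 j Vv) (V_H1 j Vw)).
Qed.

Lemma VdotC u v : Vdot u v = Vdot v u.
Proof. by rewrite /Vdot; apply: eq_bigr => i _; exact: H1dotC. Qed.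

Lemma Vdot_ge0 v : 0 <= Vdot v v.
Proof. by apply: sumr_ge0 => i _; exact: H1dot_ge0. Qed.

Lemma V_normE v : V_norm Omega v = Num.sqrt (Vdot v v).
Proof.
rewrite /V_norm /Vdot; apply: congr1; apply: eq_bigr => j _.
by rewrite H1_normE sqr_sqrtr// H1dot_ge0.
Qed.

Lemma V_norm_triangle u v : V Omega u -> V Omega v ->
  V_norm Omega (u + v) <= V_norm Omega u + V_norm Omega v.
Proof.
move=> Vu Vv; rewrite 3!V_normE.
exact: (@psd_triangle R field (V Omega) Vdot V_lin Vdot_lin
  (fun u1 u2 _ _ => VdotC u1 u2) (fun u1 _ => Vdot_ge0 u1) u v Vu Vv).
Qed.

Lemma V_norm_scale (a : R) u : V Omega u -> V_norm Omega (a *: u) = `|a| * V_norm Omega u.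
Proof.
move=> Vu; rewrite 2!V_normE.
exact: (@psd_scale R field (V Omega) Vdot V_lin Vdot_lin
  (fun u1 u2 _ _ => VdotC u1 u2) a u Vu).
Qed.

Lemma Snorm_triangle u v : V Omega u -> V Omega v -> Snorm (u + v) <= Snorm u + Snorm v.
Proof.
move=> Vu Vv.
exact: (@psd_triangle R field (V Omega) Sdot V_lin Sdot_lin
  (fun u1 u2 _ _ => SdotC u1 u2) (fun u1 _ => Sdot_ge0 u1) u v Vu Vv).
Qed.

Lemma Snorm_scale (a : R) u : V Omega u -> Snorm (a *: u) = `|a| * Snorm u.
Proof.
move=> Vu.
exact: (@psd_scale R field (V Omega) Sdot V_lin Sdot_lin
  (fun u1 u2 _ _ => SdotC u1 u2) a u Vu).
Qed.

Lemma strainE v x i j : strain Omega v x i j = symgrad v i j x.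
Proof. by rewrite /strain mxE /symgrad /grad wpderiv.unlock. Qed.

Lemma divergE v x : diverg Omega v x = divg v x.
Proof. by rewrite /diverg /divg /grad wpderiv.unlock. Qed.

(** Integrability of the sum is part of the conclusion so that the lemma can be applied again to the
    outer one of two nested sums. *)
Lemma Rintegral_sum (I : Type) (s : seq I) (f : I -> fn) :
  (forall i, leb.-integrable Omega (EFin \o f i)) ->
  leb.-integrable Omega (EFin \o (fun x => \sum_(i <- s) f i x)) /\
  \int[leb]_(x in Omega) (\sum_(i <- s) f i x) = \sum_(i <- s) \int[leb]_(x in Omega) f i x.
Proof.
move=> fi; elim: s => [|i s [IH1 IH2]].
  rewrite big_nil; under eq_fun do rewrite big_nil.
  split; first exact: integrable0.
  by rewrite /Rintegral integral0.
rewrite big_cons; under eq_fun do rewrite big_cons; split.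
  exact: (integrableD mO (fi i) IH1).
by rewrite RintegralD// IH2.
Qed.

Lemma strain_normE v : V Omega v -> strain_norm Omega v = Snorm v.
Proof.
move=> Vv; rewrite /strain_norm /Snorm; apply: congr1.
pose f i j x := symgrad v i j x * symgrad v i j x.
have fi i j : leb.-integrable Omega (EFin \o f i j).
  by apply: sqint_mul => //; exact: ee_sqint.
transitivity (\int[leb]_(x in Omega) (\sum_i \sum_j f i j x)).
  apply: eq_Rintegral => x _; rewrite /ddot; apply: eq_bigr => i _; apply: eq_bigr => j _.
  by rewrite !strainE.
rewrite (Rintegral_sum _ _).2.
  rewrite /Sdot sqdot.unlock; apply: eq_bigr => i _.
  by rewrite (Rintegral_sum _ _).2.
by move=> i; have [] := Rintegral_sum (index_enum _) (fi i).
Qed.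

Definition Gsum v : R := \sum_i \sum_j dot (grad v i j) (grad v i j).

Lemma dot_eeE u v i j : V Omega u -> V Omega v -> dot (symgrad u i j) (symgrad v i j) =
  4^-1 * (dot (grad u i j) (grad v i j) + dot (grad u i j) (grad v j i) +
          dot (grad u j i) (grad v i j) + dot (grad u j i) (grad v j i)).
Proof.
move=> Vu Vv; have Su := grad_sqint i j Vu; have Su' := grad_sqint j i Vu.
have Sv := grad_sqint i j Vv; have Sv' := grad_sqint j i Vv.
rewrite /symgrad sqdotZ//; last 2 first.
- exact: sqintD.
- by apply: sqintZ => //; exact: sqintD.
rewrite sqdotC sqdotZ//; last 2 first.
- exact: sqintD.
- exact: sqintD.
rewrite (sqdotD mO Sv Sv'); last exact: sqintD.
rewrite (sqdotC _ _ (grad v i j)) (sqdotC _ _ (grad v j i)).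
rewrite (sqdotD mO Su Su' Sv) (sqdotD mO Su Su' Sv').
move: (dot _ _) (dot _ _) (dot _ _) (dot _ _) => a b c e; by field.
Qed.

(** Expanding the square gives the identity |e(v)|^2 = (|grad v|^2 + |div v|^2)/2: the cross terms
    d_i v_j d_j v_i turn into d_i v_i d_j v_j by [weak_symm]. Dropping the divergence leaves the
    constant 2. *)
Lemma korn v : V Omega v -> Gsum v <= 2 * Sdot v v.
Proof.
move=> Vv.
have SE : Sdot v v = 2^-1 * Gsum v + 2^-1 * dot (divg v) (divg v).
  have -> : dot (divg v) (divg v) = \sum_i \sum_j dot (grad v i j) (grad v j i).
    rewrite {1}/divg sqdot_sum//; last 2 first.
    - by move=> i; exact: grad_sqint.
    - exact: dv_sqint.
    apply: eq_bigr => i _; rewrite sqdotC /divg sqdot_sum//; last 2 first.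
    - by move=> j; exact: grad_sqint.
    - exact: grad_sqint.
    apply: eq_bigr => j _; rewrite sqdotC [RHS]sqdotC.
    exact: (weak_symm oO bO i j (Vv i) (Vv j)).
  transitivity (\sum_i \sum_j (4^-1 * (dot (grad v i j) (grad v i j) + dot (grad v i j) (grad v j i))) +
                \sum_i \sum_j (4^-1 * (dot (grad v j i) (grad v j i) + dot (grad v j i) (grad v i j)))).
    rewrite -big_split/=; apply: eq_bigr => i _; rewrite -big_split/=; apply: eq_bigr => j _.
    rewrite dot_eeE//; move: (dot _ _) (dot _ _) (dot _ _) (dot _ _) => a b c e; ring.
  rewrite [X in _ + X]exchange_big/=.
  have -> : \sum_i \sum_j (4^-1 * (dot (grad v i j) (grad v i j) + dot (grad v i j) (grad v j i))) =
     4^-1 * (Gsum v + \sum_i \sum_j dot (grad v i j) (grad v j i)).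
    rewrite /Gsum -big_split/= mulr_sumr; apply: eq_bigr => i _.
    by rewrite -big_split/= mulr_sumr.
  move: (Gsum v) (\sum_i _) => a b; by field.
rewrite SE; have := sqdot_ge0 leb Omega (divg v); move: (Gsum v) (dot _ _) => a b; lra.
Qed.

(** Entrywise ((a + b)/2)^2 <= (a^2 + b^2)/2, which is the nonnegativity of |a - b|^2; summing over
    both orders of the indices gives the gradient once. *)
Lemma Sdot_le_Gsum v : V Omega v -> Sdot v v <= Gsum v.
Proof.
move=> Vv.
have H i j : dot (symgrad v i j) (symgrad v i j) <=
    2^-1 * dot (grad v i j) (grad v i j) + 2^-1 * dot (grad v j i) (grad v j i).
  have Sij := grad_sqint i j Vv; have Sji := grad_sqint j i Vv.
  have := sqdot_ge0 leb Omega (fun x => grad v i j x - grad v j i x).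
  have -> : dot (fun x => grad v i j x - grad v j i x) (fun x => grad v i j x - grad v j i x) =
     dot (grad v i j) (grad v i j) - dot (grad v i j) (grad v j i) -
     dot (grad v j i) (grad v i j) + dot (grad v j i) (grad v j i).
    have -> : (fun x => grad v i j x - grad v j i x) = (fun x => -1 * grad v j i x + grad v i j x).
      by apply/funext => x; rewrite mulN1r addrC.
    rewrite (sqdot_lin mO (-1) Sji Sij (sqint_lin mO (-1) Sji Sij)).
    rewrite (sqdotC _ _ (grad v j i)) (sqdotC _ _ (grad v i j)).
    rewrite !(sqdot_lin mO (-1) Sji Sij)//.
    move: (dot _ _) (dot _ _) (dot _ _) (dot _ _) => a b c e; ring.
  rewrite dot_eeE//; move: (dot _ _) (dot _ _) (dot _ _) (dot _ _) => a b c e; lra.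
apply: (@le_trans _ _ (\sum_i \sum_j (2^-1 * dot (grad v i j) (grad v i j) +
    2^-1 * dot (grad v j i) (grad v j i)))).
  by apply: ler_sum => i _; apply: ler_sum => j _; exact: H.
rewrite (_ : \sum_i _ = Gsum v)//.
under eq_bigr do rewrite big_split/=.
rewrite big_split/= [X in _ + X]exchange_big/= /Gsum.
rewrite -big_split/=; apply: eq_bigr => i _; rewrite -big_split/=; apply: eq_bigr => j _.
by move: (dot _ _) => a; field.
Qed.

Lemma Vdot_Gsum v : Vdot v v =
  \sum_j dot (component v j) (component v j) + Gsum v.
Proof.
rewrite /Vdot /Gsum exchange_big/= -big_split/=; apply: eq_bigr => j _.
by rewrite H1dot.unlock.
Qed.

Lemma Snorm_le_V v : V Omega v -> Snorm v <= V_norm Omega v.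
Proof.
move=> Vv; rewrite V_normE /Snorm ler_wsqrtr//.
apply: (le_trans (Sdot_le_Gsum Vv)); rewrite Vdot_Gsum lerDr.
by apply: sumr_ge0 => i _; exact: sqdot_ge0.
Qed.

(** In the squared norm, (2 M)^2 comes from Poincare for the values, 1 from the gradient itself, and
    the factor 2 from Korn. *)
Definition korn_const : R := Num.sqrt ((4 * M ^+ 2 + 1) * 2).

Lemma V_norm_le_S v : (0 < n)%N -> V Omega v -> V_norm Omega v <= korn_const * Snorm v.
Proof.
move=> n0 Vv; rewrite V_normE /Snorm /korn_const.
have c0 : 0 <= 4 * M ^+ 2 + 1 by rewrite addr_ge0// mulr_ge0// sqr_ge0.
rewrite -sqrtrM ?mulr_ge0// ler_wsqrtr// -mulrA.
apply: (@le_trans _ _ ((4 * M ^+ 2 + 1) * Gsum v)); last first.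
  by rewrite ler_wpM2l//; exact: korn.
rewrite Vdot_Gsum mulrDl mul1r lerD2r /Gsum.
(* Poincare's inequality is applied to every component in one fixed direction, which exists because
   n > 0. *)
pose i0 := Ordinal n0.
apply: (@le_trans _ _ (4 * M ^+ 2 * \sum_j dot (grad v i0 j) (grad v i0 j))); last first.
  rewrite ler_wpM2l ?mulr_ge0 ?sqr_ge0// [leRHS](bigD1 i0)//= lerDl.
  by apply: sumr_ge0 => i _; apply: sumr_ge0 => j _; exact: sqdot_ge0.
rewrite mulr_sumr; apply: ler_sum => j _.
have := poincare_H10 oO bO M0 i0 (Vv j); rewrite /L2norm -/(grad v i0 j) => H.
rewrite -[leLHS]sqr_sqrtr ?sqdot_ge0// -[dot (grad _ _ _) _]sqr_sqrtr ?sqdot_ge0//.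
have -> : 4 * M ^+ 2 = (2 * M) ^+ 2 by ring.
by rewrite -exprMn ler_sqr ?nnegrE ?mulr_ge0 ?sqrtr_ge0.
Qed.

Lemma L2norm_sqr f : L2norm Omega f ^+ 2 = dot f f.
Proof. by rewrite sqr_sqrtr// sqdot_ge0. Qed.

Lemma sqint_complete_L2norm (F : nat -> fn) : (forall k, L2O (F k)) ->
  (forall e, 0 < e -> exists N, forall m k, (N <= m)%N -> (N <= k)%N ->
     L2norm Omega (fun x => F m x - F k x) <= e) ->
  exists2 f, L2O f & (fun k => dot (fun x => F k x - f x) (fun x => F k x - f x)) @ \oo --> (0 : R).
Proof.
move=> SF cF; apply: sqint_complete => // e e0.
have [N HN] := cF (Num.sqrt e) ltac:(by rewrite sqrtr_gt0).
exists N => m k Nm Nk; have se : Num.sqrt e ^+ 2 = e by rewrite sqr_sqrtr// ltW.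
by rewrite -L2norm_sqr -se ler_sqr ?nnegrE ?sqrtr_ge0// HN.
Qed.

(** Both sides of the integration by parts formula are continuous for L2 convergence, by
    Cauchy-Schwarz against a fixed test function [chi] and its derivative. *)
Lemma is_weak_pderiv_lim i (phi : nat -> fn) f g : (forall k, test_function Omega (phi k)) ->
  L2O f -> L2O g ->
  (fun k => dot (fun x => phi k x - f x) (fun x => phi k x - f x)) @ \oo --> (0 : R) ->
  (fun k => dot (fun x => pderiv i (phi k) x - g x) (fun x => pderiv i (phi k) x - g x)) @ \oo --> (0 : R) ->
  is_weak_pderiv Omega i f g.
Proof.
move=> tp Sf Sg cf cg chi tchi.
have E (a b : fn) : \int[leb]_(x in Omega) (a x * b x) = dot a b by rewrite sqdot.unlock.
rewrite !E; apply/eqP; rewrite -addr_eq0 -normr_le0; apply/ler_addgt0Pr => e e0; rewrite add0r.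
have Sc := test_sqint oO bO tchi; have Sdc := test_sqint oO bO (test_function_pderiv i tchi).
pose K := L2norm Omega (pderiv i chi) + L2norm Omega chi.
have K0 : 0 <= K by rewrite addr_ge0// sqrtr_ge0.
have d0 : 0 < e / (K + 1) by rewrite divr_gt0// ltr_wpDl.
have d2 : 0 < (e / (K + 1)) ^+ 2 by rewrite exprn_gt0.
have [k [Hf Hg]] : exists k, L2norm Omega (fun x => phi k x - f x) <= e / (K + 1) /\
    L2norm Omega (fun x => pderiv i (phi k) x - g x) <= e / (K + 1).
  move/cvgr0Pnorm_le : cf => /(_ _ d2)[k1 _ H1]; move/cvgr0Pnorm_le : cg => /(_ _ d2)[k2 _ H2].
  exists (maxn k1 k2); split.
    have := H1 _ (leq_maxl k1 k2); rewrite /= ger0_norm ?sqdot_ge0// -L2norm_sqr.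
    by rewrite ler_sqr ?nnegrE ?sqrtr_ge0// ltW.
  have := H2 _ (leq_maxr k1 k2); rewrite /= ger0_norm ?sqdot_ge0// -L2norm_sqr.
  by rewrite ler_sqr ?nnegrE ?sqrtr_ge0// ltW.
have Sp := test_sqint oO bO (tp k); have Sdp := test_sqint oO bO (test_function_pderiv i (tp k)).
have W : dot (phi k) (pderiv i chi) = - dot (pderiv i (phi k)) chi.
  by rewrite -!E; exact: (test_weak_pderiv bO i (tp k) tchi).
have SB (a b : fn) h : L2O a -> L2O b -> L2O h -> dot (fun x => a x - b x) h = dot a h - dot b h.
  move=> Sa Sb Sh; have := sqdot_lin mO (-1) Sb Sa Sh; rewrite mulN1r addrC => <-.
  by apply: congr2 => //; apply/funext => x; rewrite mulN1r addrC.
have -> : dot f (pderiv i chi) + dot g chi =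
    - (dot (fun x => phi k x - f x) (pderiv i chi) +
       dot (fun x => pderiv i (phi k) x - g x) chi).
  rewrite !SB// W; move: (dot _ _) (dot _ _) (dot _ _) => a b c; ring.
rewrite normrN; apply: (le_trans (ler_normD _ _)).
apply: (@le_trans _ _ (e / (K + 1) * K)).
  rewrite /K mulrDr; apply: lerD.
    apply: (le_trans (sqdot_CS mO (sqintB mO Sp Sf) Sdc)).
    by apply: ler_wpM2r => //; exact: sqrtr_ge0.
  apply: (le_trans (sqdot_CS mO (sqintB mO Sdp Sg) Sc)).
  by apply: ler_wpM2r => //; exact: sqrtr_ge0.
by rewrite mulrAC ler_pdivrMr ?ltr_wpDl// ler_pM2l// lerDl.
Qed.

(** Each F_k is replaced by a test function within 1/(k + 1). These have classical derivatives,
    whose L2 limits are the weak derivatives of the limit f; and convergence of test functions to f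
    in the H1 norm is what membership of f in [H10] means. *)
Lemma H10_complete (F : nat -> fn) : (forall k, H10 Omega (F k)) ->
  (forall e, 0 < e -> exists N, forall m k, (N <= m)%N -> (N <= k)%N ->
     H1_norm Omega (fun x => F m x - F k x) <= e) ->
  exists2 f, H10 Omega f &
    forall e, 0 < e -> exists N, forall k, (N <= k)%N -> H1_norm Omega (fun x => F k x - f x) <= e.
Proof.
move=> H0F cF; have HF k := H10_H1 (H0F k).
have inv0 (k : nat) : 0 < k.+1%:R^-1 :> R by rewrite invr_gt0.
have /choice[phi Hphi] : forall k : nat, exists phi, test_function Omega phi /\
    H1_norm Omega (fun x => F k x - phi x) <= k.+1%:R^-1.
  by move=> k; have [p tp Hp] := H10_approx (H0F k) (inv0 k); exists p.
have tp k : test_function Omega (phi k) by have [] := Hphi k.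
have Hp k := test_H1 oO bO (tp k).
have small e : 0 < e -> exists N, forall k, (N <= k)%N -> H1_norm Omega (fun x => F k x - phi k x) <= e.
  move=> e0; have [N _ HN] := near_infty_natSinv_lt (PosNum e0).
  by exists N => k /HN /= /ltW; apply: le_trans; have [] := Hphi k.
have tri (a b c : fn) : H1 Omega a -> H1 Omega b -> H1 Omega c ->
    H1_norm Omega (fun x => a x - c x) <=
    H1_norm Omega (fun x => a x - b x) + H1_norm Omega (fun x => b x - c x).
  move=> Ha Hb Hc; have := H1_norm_triangle oO bO (H1B oO bO Ha Hb) (H1B oO bO Hb Hc).
  by rewrite (_ : (fun x => _ + _) = (fun x => a x - c x))//; apply/funext => x; ring.
have cphi e : 0 < e -> exists N, forall m k, (N <= m)%N -> (N <= k)%N ->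
    H1_norm Omega (fun x => phi m x - phi k x) <= e.
  move=> e0; have e3 : 0 < e / 3 by rewrite divr_gt0.
  have [N1 HN1] := cF _ e3; have [N2 HN2] := small _ e3.
  exists (maxn N1 N2) => m k; rewrite !geq_max => /andP[m1 m2] /andP[k1 k2].
  have T1 := tri _ _ _ (Hp m) (HF m) (Hp k).
  have T2 := tri _ _ _ (HF m) (HF k) (Hp k).
  have := HN1 _ _ m1 k1; have := HN2 _ k2; have := HN2 _ m2.
  rewrite (H1_norm_distC oO bO (HF m) (Hp m)).
  move: T1 T2; move: (H1_norm _ _) (H1_norm _ _) (H1_norm _ _) (H1_norm _ _) (H1_norm _ _) => *; lra.
have Sp k := test_sqint oO bO (tp k).
have Sdp i k := test_sqint oO bO (test_function_pderiv i (tp k)).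
have [f Sf cf] : exists2 f, L2O f &
    (fun k => dot (fun x => phi k x - f x) (fun x => phi k x - f x)) @ \oo --> (0 : R).
  apply: sqint_complete_L2norm => // e e0; have [N HN] := cphi e e0; exists N => m k Nm Nk.
  exact: le_trans (L2norm_H1 Omega _) (HN _ _ Nm Nk).
have /choice[g Hg] : forall i, exists g, L2O g /\
    (fun k => dot (fun x => pderiv i (phi k) x - g x) (fun x => pderiv i (phi k) x - g x)) @ \oo --> (0 : R).
  move=> i; suff [g Sg cg] : exists2 g, L2O g &
    (fun k => dot (fun x => pderiv i (phi k) x - g x) (fun x => pderiv i (phi k) x - g x)) @ \oo --> (0 : R).
    by exists g.
  apply: sqint_complete_L2norm => // e e0; have [N HN] := cphi e e0; exists N => m k Nm Nk.
  apply: le_trans (HN _ _ Nm Nk); apply: le_trans (L2norm_weak_H1 Omega i _).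
  rewrite le_eqVlt; apply/orP; left; apply/eqP; apply: (L2norm_ae oO).
  - by apply: sqintB.
  - by have [] := weak_pderivP oO i (H1B oO bO (Hp m) (Hp k)).
  - apply: filterS3 (weak_pderivB_ae oO bO i (Hp m) (Hp k)) (test_weak_pderiv_ae oO bO i (tp m))
      (test_weak_pderiv_ae oO bO i (tp k)) => x E1 E2 E3 Ox.
    by rewrite E1// E2// E3.
have wg i : is_weak_pderiv Omega i f (g i).
  by have [Sg cg] := Hg i; exact: is_weak_pderiv_lim cg.
have Hf : H1 Omega f.
  split; first by apply/(L2P oO).
  by move=> i; exists (g i); split => //; apply/(L2P oO); have [] := Hg i.
have cH : (fun k => H1dot Omega (fun x => phi k x - f x) (fun x => phi k x - f x)) @ \oo --> (0 : R).
  have -> : (fun k => H1dot Omega (fun x => phi k x - f x) (fun x => phi k x - f x)) =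
     (fun k => dot (fun x => phi k x - f x) (fun x => phi k x - f x) +
       \sum_i dot (fun x => pderiv i (phi k) x - g i x) (fun x => pderiv i (phi k) x - g i x)).
    apply/funext => k; rewrite H1dot.unlock; congr (_ + _); apply: eq_bigr => i _.
    have [Sg _] := Hg i.
    have S1 := (weak_pderivP oO i (H1B oO bO (Hp k) Hf)).1.
    have S2 := sqintB mO (Sdp i k) Sg.
    have ae12 : {ae leb, forall x, Omega x -> wpderiv Omega i (fun x => phi k x - f x) x =
        pderiv i (phi k) x - g i x}.
      apply: filterS3 (weak_pderivB_ae oO bO i (Hp k) Hf) (test_weak_pderiv_ae oO bO i (tp k))
        (weak_pderiv_ae oO bO Sg (wg i)).2 => x E1 E2 E3 Ox.
      by rewrite E1// E2// E3.
    exact: (sqdot_ae mO S1 S2 S1 S2 ae12 ae12).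
  rewrite -[X in _ --> X](addr0 (0 : R)); apply: cvgD => //.
  by apply: cvg_sum0 => i; exact: (Hg i).2.
have cN e : 0 < e -> exists N, forall k, (N <= k)%N -> H1_norm Omega (fun x => phi k x - f x) <= e.
  move=> e0; have e2 : 0 < e ^+ 2 by rewrite exprn_gt0.
  move/cvgr0Pnorm_le : cH => /(_ _ e2)[N _ HN]; exists N => k /HN /=.
  rewrite ger0_norm ?H1dot_ge0// H1_normE => H.
  exact: sqrtr_le_sqr (ltW e0) H.
exists f.
  apply: H10_intro => // e e0; have [N HN] := cN e e0; exists (phi N) => //.
  by rewrite (H1_norm_distC oO bO Hf (Hp N)); exact: HN.
move=> e e0; have e2 : 0 < e / 2 by rewrite divr_gt0.
have [N1 HN1] := cN _ e2; have [N2 HN2] := small _ e2.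
exists (maxn N1 N2) => k; rewrite geq_max => /andP[k1 k2].
apply: (le_trans (tri _ _ _ (HF k) (Hp k) Hf)).
by rewrite [leRHS]splitr; apply: lerD; [exact: HN2|exact: HN1].
Qed.

Lemma H1_norm_le_V v j : H1_norm Omega (component v j) <= V_norm Omega v.
Proof.
rewrite H1_normE V_normE ler_wsqrtr// /Vdot (bigD1 j)//= lerDl.
by apply: sumr_ge0 => i _; exact: H1dot_ge0.
Qed.

Lemma V_complete (F : nat -> field) : (forall k, V Omega (F k)) ->
  (forall e, 0 < e -> exists N, forall m k, (N <= m)%N -> (N <= k)%N ->
     V_norm Omega (F m - F k) <= e) ->
  exists2 f, V Omega f &
    forall e, 0 < e -> exists N, forall k, (N <= k)%N -> V_norm Omega (F k - f) <= e.
Proof.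
move=> VF cF.
have compB u v j : component (u - v) j = fun x => component u j x - component v j x.
  by apply/funext => x; rewrite /component !mxE.
have /choice[g Hg] : forall j, exists g, H10 Omega g /\
    forall e, 0 < e -> exists N, forall k, (N <= k)%N ->
      H1_norm Omega (fun x => component (F k) j x - g x) <= e.
  move=> j; have [g H0g Hg] : exists2 f, H10 Omega f &
    forall e, 0 < e -> exists N, forall k, (N <= k)%N -> H1_norm Omega (fun x => component (F k) j x - f x) <= e.
    apply: (@H10_complete (fun k => component (F k) j)) => [k|e e0]; first exact: VF.
    have [N HN] := cF e e0; exists N => m k Nm Nk; rewrite -compB.
    exact: le_trans (H1_norm_le_V _ _) (HN _ _ Nm Nk).
  by exists g.
pose f : field := fun x => \row_j g j x.
have fE j : component f j = g j by apply/funext => x; rewrite /component mxE.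
exists f => [j|e e0]; first by rewrite fE; have [] := Hg j.
(* With this tolerance on each of the n components the squares add up to at most e^2, since n <= (n
   + 1)^2. *)
have d0 : 0 < e / (n%:R + 1) by rewrite divr_gt0// ltr_wpDl.
have /choice[N HN] : forall j, exists N, forall k, (N <= k)%N ->
    H1_norm Omega (fun x => component (F k) j x - g j x) <= e / (n%:R + 1).
  by move=> j; have [_] := Hg j; apply.
exists (\max_j N j)%N => k Nk.
have Hk j : H1dot Omega (component (F k - f) j) (component (F k - f) j) <= (e / (n%:R + 1)) ^+ 2.
  rewrite compB fE -[leLHS]sqr_sqrtr ?H1dot_ge0// -H1_normE.
  rewrite ler_sqr ?nnegrE ?sqrtr_ge0 ?(ltW d0)//; apply: HN.
  by apply: leq_trans Nk; exact: leq_bigmax.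
rewrite V_normE; apply: sqrtr_le_sqr; first exact: ltW.
apply: (@le_trans _ _ (\sum_(j < n) (e / (n%:R + 1)) ^+ 2)); first exact: ler_sum.
rewrite sumr_const card_ord -[leLHS]mulr_natl expr_div_n mulrA ler_pdivrMr ?exprn_gt0 ?ltr_wpDl//.
rewrite mulrC ler_wpM2l ?sqr_ge0// sqrrD expr1n mulr1.
have : 0 <= n%:R :> R by [].
by move: (n%:R : R) => t t0; rewrite -mulr_natl; have := sqr_ge0 t; lra.
Qed.

End vector_fields.

(** * The Lame form *)

(** The coefficients are arguments, so that the form at a parameter and the forms of its directional
    derivatives are instances of one definition. Each coefficient is attached to the first factor: a
    bounded multiple of an L2 function is in L2, and every term is an L2 product. *)
HB.lock Definition lame_form (R : realType) n (Omega : set 'rV[R]_n) (rho sig : 'rV[R]_n -> R)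
    (u v : 'rV[R]_n -> 'rV[R]_n) : R :=
  2 * \sum_i \sum_j sqdot (lebesgue_rV R n) Omega (fun x => rho x * symgrad Omega u i j x) (symgrad Omega v i j) +
  sqdot (lebesgue_rV R n) Omega (fun x => sig x * divg Omega u x) (divg Omega v).

Section forms.
Context (R : realType) (n : nat) (Omega : set 'rV[R]_n) (M : R).
Hypothesis oO : open Omega.
Hypothesis bO : forall x, Omega x -> forall i, `|x ord0 i| <= M.
Local Notation leb := (lebesgue_rV R n).
Local Notation fn := ('rV[R]_n -> R).
Local Notation field := ('rV[R]_n -> 'rV[R]_n).
Local Notation L2O := (sqint leb Omega).
Local Notation dot := (sqdot leb Omega).
Local Notation symgrad := (symgrad Omega).
Local Notation divg := (divg Omega).
Local Notation Snorm := (Snorm Omega).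
Local Notation lame_form := (lame_form Omega).
Implicit Types (u v w : field) (rho sig : fn).

Let mO : measurable Omega := open_measurable_rV oO.

Definition ae_bounded (C : R) rho : Prop :=
  measurable_fun Omega rho /\ {ae leb, forall x, Omega x -> `|rho x| <= C}.

Lemma rho_ee_sqint C rho u i j : ae_bounded C rho -> V Omega u ->
  L2O (fun x => rho x * symgrad u i j x).
Proof. by move=> [mr br] Vu; exact: (sqint_bddM mO (ee_sqint oO i j Vu) mr br). Qed.

Lemma sig_dv_sqint C sig u : ae_bounded C sig -> V Omega u ->
  L2O (fun x => sig x * divg u x).
Proof. by move=> [mr br] Vu; exact: (sqint_bddM mO (dv_sqint oO Vu) mr br). Qed.

Lemma formE C rho sig u v : ae_bounded C rho -> ae_bounded C sig -> V Omega u -> V Omega v ->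
  \int[leb]_(x in Omega) (2 * rho x * ddot (strain Omega u x) (strain Omega v x) +
    sig x * diverg Omega u x * diverg Omega v x) = lame_form rho sig u v.
Proof.
move=> br bs Vu Vv.
pose f i j x := (rho x * symgrad u i j x) * symgrad v i j x.
have fi i j : leb.-integrable Omega (EFin \o f i j).
  exact: (sqint_mul mO (rho_ee_sqint i j br Vu) (ee_sqint oO i j Vv)).
have Fi i := (Rintegral_sum oO (index_enum 'I_n) (fi i)).1.
have FFi := (Rintegral_sum oO (index_enum 'I_n) Fi).1.
pose g x := (sig x * divg u x) * divg v x.
have gi : leb.-integrable Omega (EFin \o g).
  exact: (sqint_mul mO (sig_dv_sqint bs Vu) (dv_sqint oO Vv)).
transitivity (\int[leb]_(x in Omega) (2 * (\sum_i \sum_j f i j x) + g x)).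
  apply: eq_Rintegral => x _; rewrite !divergE -/(g x); congr (_ + _).
  rewrite -mulrA; congr (2 * _).
  rewrite /ddot mulr_sumr; apply: eq_bigr => i _; rewrite mulr_sumr; apply: eq_bigr => j _.
  by rewrite !strainE /f mulrA.
rewrite RintegralD//; last exact: (integrableZl mO 2 FFi).
rewrite RintegralZl// (Rintegral_sum oO _ _).2//.
rewrite lame_form.unlock; congr (2 * _ + _); last by rewrite sqdot.unlock.
apply: eq_bigr => i _; rewrite (Rintegral_sum oO _ _).2//.
by apply: eq_bigr => j _; rewrite sqdot.unlock.
Qed.

Lemma form_lin C rho sig (a : R) u v w : ae_bounded C rho -> ae_bounded C sig ->
  V Omega u -> V Omega v -> V Omega w ->
  lame_form rho sig (a *: u + v) w = a * lame_form rho sig u w + lame_form rho sig v w.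
Proof.
move=> br bs Vu Vv Vw; have Vl := V_lin oO bO a Vu Vv.
have E i j : dot (fun x => rho x * symgrad (a *: u + v) i j x) (symgrad w i j) =
    a * dot (fun x => rho x * symgrad u i j x) (symgrad w i j) + dot (fun x => rho x * symgrad v i j x) (symgrad w i j).
  have Su := rho_ee_sqint i j br Vu; have Sv := rho_ee_sqint i j br Vv.
  have Sl := rho_ee_sqint i j br Vl; have Sw := ee_sqint oO i j Vw.
  rewrite -(sqdot_lin mO a Su Sv Sw).
  apply: (sqdot_ae mO Sl (sqint_lin mO a Su Sv) Sw Sw); last exact: aeW.
  apply: filterS (ee_lin oO bO a i j Vu Vv) => x H Ox; rewrite H//.
  by move: (symgrad _ _ _ x) (symgrad _ _ _ x) => p q; ring.
have D : dot (fun x => sig x * divg (a *: u + v) x) (divg w) =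
    a * dot (fun x => sig x * divg u x) (divg w) + dot (fun x => sig x * divg v x) (divg w).
  have Su := sig_dv_sqint bs Vu; have Sv := sig_dv_sqint bs Vv.
  have Sl := sig_dv_sqint bs Vl; have Sw := dv_sqint oO Vw.
  rewrite -(sqdot_lin mO a Su Sv Sw).
  apply: (sqdot_ae mO Sl (sqint_lin mO a Su Sv) Sw Sw); last exact: aeW.
  apply: filterS (dv_lin oO bO a Vu Vv) => x H Ox; rewrite H//.
  by move: (divg _ x) (divg _ x) => p q; ring.
rewrite lame_form.unlock D.
under eq_bigr do under eq_bigr do rewrite E.
under eq_bigr do rewrite big_split/= -mulr_sumr.
rewrite big_split/= -mulr_sumr.
move: (\sum_i _) (\sum_i _) (dot _ _) (dot _ _) => p q r s; ring.
Qed.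

(** This carries the affine dependence on the parameters over to the form. The coefficient
    identities are required only almost everywhere, because those for the series hold only off a
    null set. *)
Lemma form_coef C rho sig rho1 sig1 rho2 sig2 (t : R) u v :
  ae_bounded C rho -> ae_bounded C sig -> ae_bounded C rho1 -> ae_bounded C sig1 ->
  ae_bounded C rho2 -> ae_bounded C sig2 ->
  {ae leb, forall x, Omega x -> rho2 x = t * rho1 x + rho x} ->
  {ae leb, forall x, Omega x -> sig2 x = t * sig1 x + sig x} ->
  V Omega u -> V Omega v ->
  lame_form rho2 sig2 u v = t * lame_form rho1 sig1 u v + lame_form rho sig u v.
Proof.
move=> br bs br1 bs1 br2 bs2 Er Es Vu Vv.
have E i j : dot (fun x => rho2 x * symgrad u i j x) (symgrad v i j) =
    t * dot (fun x => rho1 x * symgrad u i j x) (symgrad v i j) + dot (fun x => rho x * symgrad u i j x) (symgrad v i j).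
  have S := rho_ee_sqint i j br Vu; have S1 := rho_ee_sqint i j br1 Vu.
  have S2 := rho_ee_sqint i j br2 Vu; have Sv := ee_sqint oO i j Vv.
  rewrite -(sqdot_lin mO t S1 S Sv).
  apply: (sqdot_ae mO S2 (sqint_lin mO t S1 S) Sv Sv); last exact: aeW.
  apply: filterS Er => x H Ox; rewrite H//.
  by move: (symgrad _ _ _ x) => p; ring.
have D : dot (fun x => sig2 x * divg u x) (divg v) =
    t * dot (fun x => sig1 x * divg u x) (divg v) + dot (fun x => sig x * divg u x) (divg v).
  have S := sig_dv_sqint bs Vu; have S1 := sig_dv_sqint bs1 Vu.
  have S2 := sig_dv_sqint bs2 Vu; have Sv := dv_sqint oO Vv.
  rewrite -(sqdot_lin mO t S1 S Sv).
  apply: (sqdot_ae mO S2 (sqint_lin mO t S1 S) Sv Sv); last exact: aeW.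
  apply: filterS Es => x H Ox; rewrite H//.
  by move: (divg _ x) => p; ring.
rewrite lame_form.unlock D.
under eq_bigr do under eq_bigr do rewrite E.
under eq_bigr do rewrite big_split/= -mulr_sumr.
rewrite big_split/= -mulr_sumr.
move: (\sum_i _) (\sum_i _) (dot _ _) (dot _ _) => p q r s; ring.
Qed.

Lemma dot_cst0 (f h : fn) : L2O h -> dot (fun x => cst 0 x * f x) h = 0.
Proof.
move=> Sh; rewrite (_ : (fun x : 'rV[R]_n => cst 0 x * f x) = cst 0) ?sqdot0l//.
by apply/funext => x; rewrite mul0r.
Qed.

(** Cauchy-Schwarz twice: in L2 for each entry (i, j), then for the finite sum over all pairs.
    Divided by 2 mu_min, the constant becomes [b_tilde]. *)
Lemma form_bound_mu C rho u v : 0 <= C -> ae_bounded C rho -> V Omega u -> V Omega v ->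
  `|lame_form rho (cst 0) u v| <= 2 * C * Snorm u * Snorm v.
Proof.
move=> C0 [mr br] Vu Vv; rewrite lame_form.unlock dot_cst0; last exact: dv_sqint.
rewrite addr0 normrM ger0_norm// -!mulrA ler_pM2l//.
pose a i j := Num.sqrt (dot (symgrad u i j) (symgrad u i j)).
pose b i j := Num.sqrt (dot (symgrad v i j) (symgrad v i j)).
have a2 i j : a i j ^+ 2 = dot (symgrad u i j) (symgrad u i j) by rewrite sqr_sqrtr// sqdot_ge0.
have b2 i j : b i j ^+ 2 = dot (symgrad v i j) (symgrad v i j) by rewrite sqr_sqrtr// sqdot_ge0.
apply: (@le_trans _ _ (C * (\sum_(p : 'I_n * 'I_n) a p.1 p.2 * b p.1 p.2))).
  rewrite -(pair_bigA _ (fun i j => a i j * b i j))/= mulr_sumr.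
  apply: (le_trans (ler_norm_sum _ _ _)); apply: ler_sum => i _.
  rewrite mulr_sumr; apply: (le_trans (ler_norm_sum _ _ _)); apply: ler_sum => j _.
  have Su := ee_sqint oO i j Vu; have Sv := ee_sqint oO i j Vv.
  apply: (le_trans (sqdot_CS mO (sqint_bddM mO Su mr br) Sv)).
  rewrite mulrA; apply: ler_wpM2r; first exact: sqrtr_ge0.
  exact: (sqdot_bddM mO C0 Su mr br).
rewrite ler_wpM2l//; apply: (le_trans (ler_norm _)).
apply: (le_trans (sum_CS (fun p => a p.1 p.2) (fun p => b p.1 p.2))).
rewrite -(pair_bigA _ (fun i j => a i j ^+ 2))/= -(pair_bigA _ (fun i j => b i j ^+ 2))/=.
rewrite le_eqVlt; apply/orP; left; apply/eqP.
rewrite -[RHS]/(Num.sqrt (Sdot Omega u u) * Num.sqrt (Sdot Omega v v)) /Sdot.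
by congr (Num.sqrt _ * Num.sqrt _); apply: eq_bigr => i _; apply: eq_bigr => j _.
Qed.

(** The divergence is the sum of the n diagonal entries of the strain, on which symmetrization
    changes nothing. *)
Lemma dv_le_S v : V Omega v -> dot (divg v) (divg v) <= n%:R * Sdot Omega v v.
Proof.
move=> Vv; have Sg i := grad_sqint oO i i Vv.
apply: (le_trans (sqdot_sum_sqr mO Sg)); rewrite ler_wpM2l//.
rewrite /Sdot; apply: ler_sum => i _; rewrite (bigD1 i)//=.
have -> : symgrad v i i = grad Omega v i i.
  apply/funext => x; rewrite -[LHS]/(2^-1 * (grad Omega v i i x + grad Omega v i i x)).
  by move: (grad _ _ _ _ _) => p; field.
by rewrite lerDl; apply: sumr_ge0 => j _; exact: sqdot_ge0.
Qed.

(** Each of the two divergences contributes a factor sqrt n. Division by 2 mu_min turns n C into the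
    d/2 of [b_hat]. *)
Lemma form_bound_lambda C sig u v : 0 <= C -> ae_bounded C sig -> V Omega u -> V Omega v ->
  `|lame_form (cst 0) sig u v| <= n%:R * C * Snorm u * Snorm v.
Proof.
move=> C0 [ms bs] Vu Vv; rewrite lame_form.unlock.
have -> : \sum_i \sum_j dot (fun x => cst 0 x * symgrad u i j x) (symgrad v i j) = 0.
  by apply: big1 => i _; apply: big1 => j _; apply: dot_cst0; exact: ee_sqint.
rewrite mulr0 add0r.
have Su := dv_sqint oO Vu; have Sv := dv_sqint oO Vv.
apply: (le_trans (sqdot_CS mO (sqint_bddM mO Su ms bs) Sv)).
have H w : V Omega w -> Num.sqrt (dot (divg w) (divg w)) <= Num.sqrt n%:R * Snorm w.
  by move=> Vw; rewrite -sqrtrM// ler_wsqrtr// dv_le_S.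
have := sqdot_bddM mO C0 Su ms bs; have := H u Vu; have := H v Vv.
have : n%:R = Num.sqrt n%:R * Num.sqrt n%:R :> R by rewrite -expr2 sqr_sqrtr.
move=> nE Hv Hu Hs; rewrite [in leRHS]nE.
have -> : Num.sqrt n%:R * Num.sqrt n%:R * C * Snorm u * Snorm v =
   C * (Num.sqrt n%:R * Snorm u) * (Num.sqrt n%:R * Snorm v).
  by move: (Snorm u) (Snorm v) (Num.sqrt _) => a b c; ring.
apply: ler_pM => //; try exact: sqrtr_ge0.
by apply: (le_trans Hs); rewrite ler_wpM2l.
Qed.

Lemma form_coercive C rho sig (m : R) u : ae_bounded C rho -> ae_bounded C sig -> V Omega u ->
  (forall x, Omega x -> m <= rho x) -> (forall x, Omega x -> 0 <= sig x) ->
  2 * m * Snorm u ^+ 2 <= lame_form rho sig u u.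
Proof.
move=> br bs Vu mr s0; rewrite -[Snorm u]/(Num.sqrt (Sdot Omega u u)) sqr_sqrtr ?Sdot_ge0//.
rewrite lame_form.unlock -mulrA.
have D : 0 <= dot (fun x => sig x * divg u x) (divg u).
  rewrite sqdot.unlock; apply: Rintegral_ge0 => x Ox.
  by rewrite -mulrA mulr_ge0 ?s0// -expr2 sqr_ge0.
apply: ler_wpDr => //; rewrite ler_pM2l// /Sdot mulr_sumr.
apply: ler_sum => i _; rewrite mulr_sumr; apply: ler_sum => j _.
have Su := ee_sqint oO i j Vu; have Sr := rho_ee_sqint i j br Vu.
rewrite -subr_ge0 addrC -mulNr -(sqdot_lin mO (- m) Su Sr Su) sqdot.unlock.
apply: Rintegral_ge0 => x Ox.
by rewrite -mulrDl -mulrA mulr_ge0 -?expr2 ?sqr_ge0// addrC subr_ge0 mr.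
Qed.

End forms.

(** * Affine coefficients *)

(* Off the set of convergence, measurable by Cauchy's criterion, limn is constant. *)
Lemma measurable_fun_limn d (T : measurableType d) (R : realType) (D : set T)
    (f : nat -> T -> R) : measurable D -> (forall k, measurable_fun D (f k)) ->
  measurable_fun D (fun x => limn (f ^~ x)).
Proof.
move=> mD mf; pose E := D `&` [set x | cvgn (f ^~ x)].
have EE : E = \bigcap_k \bigcup_N \bigcap_m (D `&` [set x | `|f (N + m)%N x - f N x| <= k.+1%:R^-1]).
  apply/seteqP; split => [x [Dx cx] k _|x H].
    have e0 : 0 < k.+1%:R^-1 / 2 :> R by rewrite divr_gt0.
    move/cvgrPdist_le : cx => /(_ _ e0)[N _ HN]; exists N => // m _; split => //=.
    rewrite -(subrK (limn (f ^~ x)) (f (N + m)%N x)) -addrA (le_trans (ler_normD _ _))//.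
    rewrite [leRHS]splitr lerD//; last by apply: HN => /=.
    by rewrite distrC; apply: HN; exact: leq_addr.
  have Dx : D x by have [N _ HN] := H 0%N Logic.I; have [] := HN 0%N Logic.I.
  split => //=; apply: cauchy_cvg; apply: cauchy_exP => e e0.
  have [k _ Hk] := near_infty_natSinv_lt (PosNum e0).
  have [N _ HN] := H k Logic.I.
  exists (f N x); exists N => // m /= Nm; rewrite /ball/= distrC.
  apply: le_lt_trans (Hk k (leqnn k)).
  by have [_] := HN (m - N)%N Logic.I; rewrite /= subnKC.
have mE : measurable E.
  rewrite EE; apply: bigcap_measurableType => k _; apply: bigcup_measurable => N _.
  apply: bigcap_measurableType => m _.
  have := measurable_fun_ler (measurableT_comp (@normr_measurable R setT) (measurable_funB (mf (N + m)%N) (mf N)))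
    (@measurable_cst _ _ _ _ D (k.+1%:R^-1 : R)).
  by move=> /(_ mD [set true] Logic.I).
have DE : D = E `|` (D `\` E) by rewrite setDE setUIr setUCr setIT setUC; apply/esym/setUidPl => x [].
rewrite DE; apply/measurable_funU => //; first exact: measurableD.
split.
  apply/measurable_EFinP; apply: (emeasurable_fun_cvg (fun k => EFin \o f k)).
    by move=> k; apply/measurable_EFinP; apply: measurable_funS (mf k) => // x [].
  by move=> x [_ cx]; apply: cvg_EFin => //; exact: nearW.
apply: (eq_measurable_fun (cst point)); last exact: measurable_cst.
move=> x; rewrite inE => -[Dx nE]; rewrite dvgP// => cx; exact: nE.
Qed.

Section coefficients.
Context (R : realType) (n : nat) (Omega : set 'rV[R]_n) (M : R).
Hypothesis oO : open Omega.
Local Notation leb := (lebesgue_rV R n).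
Local Notation fn := ('rV[R]_n -> R).
Local Notation L2O := (sqint leb Omega).
Implicit Types (az : fn) (a : nat -> fn) (y : nat -> R).

Let mO : measurable Omega := open_measurable_rV oO.

Lemma Linfty_norm_ge0 (f : fn) : (0 <= Linfty_norm Omega f)%E.
Proof. exact: Lnorm_ge0. Qed.

Lemma ae_Linfty (f : fn) : (Linfty_norm Omega f < +oo)%E ->
  {ae leb, forall x, Omega x -> `|f x| <= fine (Linfty_norm Omega f)}.
Proof.
move=> Lf; have Lfin : Linfty_norm Omega f \is a fin_num.
  by rewrite ge0_fin_numE// Linfty_norm_ge0.
(* The infinity norm is the essential supremum only when the whole space has positive measure; in
   the other case every property holds almost everywhere. *)
have [mu0|] := ltP 0%E (leb setT); last first.
  move=> mu0; exists setT; split => //; first by apply/eqP; rewrite eq_le mu0 measure_ge0.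
have := ess_sup_ge leb (abse \o (EFin \o (f \_ Omega))).
rewrite (_ : ess_sup _ _ = Linfty_norm Omega f); last first.
  by rewrite /Linfty_norm unlock mu0.
apply: filterS => x /= + Ox; rewrite -lee_fin fineK// => H.
by apply: le_trans H; rewrite patchE mem_set//= lee_fin.
Qed.

Lemma summable_Linfty a : (\sum_(0 <= j <oo) Linfty_norm Omega (a j) < +oo)%E ->
  [/\ forall j, (Linfty_norm Omega (a j) < +oo)%E &
    cvgn (series (fun j => fine (Linfty_norm Omega (a j))))].
Proof.
move=> Sa.
have fin j : (Linfty_norm Omega (a j) < +oo)%E.
  rewrite ltey; apply/eqP => aj; move: Sa.
  by rewrite (@nneseries_pinfty _ _ xpredT j)// => k _; exact: Linfty_norm_ge0.
split => //; apply: cvg_series_nneseries => [k|]; first by rewrite fine_ge0// Linfty_norm_ge0.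
under eq_eseriesr do rewrite fineK ?ge0_fin_numE ?Linfty_norm_ge0//.
exact: Sa.
Qed.

(** The exceptional set does not depend on y: it is the union over j of the null sets where |a_j|
    exceeds its norm. Elsewhere |y_j| <= 1 makes the norms a summable majorant for all y in [U] at
    once. *)
Lemma ae_cvg_series a : (\sum_(0 <= j <oo) Linfty_norm Omega (a j) < +oo)%E ->
  {ae leb, forall x, Omega x -> forall y, U y -> cvgn (fun N => \sum_(j < N) y j * a j x)}.
Proof.
move=> /summable_Linfty[fin Sa].
have := ae_foralln (fun j => ae_Linfty (fin j)).
apply: filterS => x H Ox y Uy.
rewrite (_ : (fun N => \sum_(j < N) y j * a j x) = series (fun j => y j * a j x)); last first.
  by apply/funext => N; rewrite /series/= big_mkord.
apply: normed_cvg; apply: series_le_cvg Sa => j //=.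
  by rewrite fine_ge0// Linfty_norm_ge0.
rewrite normrM (le_trans _ (H j Ox))// ler_piMl//.
by have := Uy j; rewrite ler_norml; lra.
Qed.

Lemma measurable_affine_coef az a y : measurable_fun Omega az ->
  (forall j, measurable_fun Omega (a j)) -> measurable_fun Omega (affine_coef az a y).
Proof.
move=> m0 ma; apply: measurable_funD => //; apply: measurable_fun_limn => // N.
elim: N => [|N IHN].
  by under eq_fun do rewrite big_ord0; exact: measurable_cst.
under eq_fun do rewrite big_ord_recr/=.
by apply: measurable_funD => //; apply: measurable_funM.
Qed.

Lemma affine_coef_set_coord az a y i t : U y ->
  (\sum_(0 <= j <oo) Linfty_norm Omega (a j) < +oo)%E ->
  {ae leb, forall x, Omega x -> affine_coef az a (set_coord y i t) x =
     (t - y i) * a i x + affine_coef az a y x}.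
Proof.
move=> Uy Sa; apply: filterS (ae_cvg_series Sa) => x H Ox; have cx := H Ox y Uy.
rewrite /affine_coef addrCA; congr (_ + _).
apply: cvg_lim => //.
have G : (fun N => (t - y i) * a i x + \sum_(j < N) y j * a j x) @ \oo -->
    (t - y i) * a i x + limn (fun N => \sum_(j < N) y j * a j x).
  by apply: cvgD; [exact: cvg_cst|exact: cx].
(* The partial sums over j < N contain the changed term once N >= i + 1, and from then on they
   differ by exactly that term. *)
apply: cvg_trans G; apply: near_eq_cvg; exists i.+1 => // N /= iN.
rewrite (bigD1 (Ordinal iN))//= [RHS](bigD1 (Ordinal iN))//=.
rewrite {1}/set_coord eqxx addrA -mulrDl subrK; congr (_ + _).
apply: eq_bigr => j ji; rewrite /set_coord ifN//.
Qed.

End coefficients.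

(** * Difference quotients of solutions of coercive problems *)

Lemma ler_sum_mem (R : numDomainType) (I : eqType) (s : seq I) (a b : I -> R) :
  (forall i, i \in s -> a i <= b i) -> \sum_(i <- s) a i <= \sum_(i <- s) b i.
Proof. by move=> ab; rewrite [leLHS]big_seq [leRHS]big_seq; apply: ler_sum. Qed.

Section difference_quotients.
Context (R : realType) (E : lmodType R) (V : E -> Prop) (S N : E -> R) (Kc : R).
Hypothesis V_lin : forall (a : R) u v, V u -> V v -> V (a *: u + v).
Hypothesis S_ge0 : forall u, 0 <= S u.
Hypothesis S_triangle : forall u v, V u -> V v -> S (u + v) <= S u + S v.
Hypothesis S_scale : forall (a : R) u, V u -> S (a *: u) = `|a| * S u.
Hypothesis N_ge0 : forall u, 0 <= N u.
Hypothesis N_triangle : forall u v, V u -> V v -> N (u + v) <= N u + N v.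
Hypothesis S_le_N : forall u, V u -> S u <= N u.
Hypothesis Kc0 : 0 <= Kc.
Hypothesis N_le_S : forall u, V u -> N u <= Kc * S u.
Hypothesis N_complete : forall F : nat -> E, (forall k, V (F k)) ->
  (forall e, 0 < e -> exists K, forall j k, (K <= j)%N -> (K <= k)%N -> N (F j - F k) <= e) ->
  exists2 w, V w & forall e, 0 < e -> exists K, forall k, (K <= k)%N -> N (F k - w) <= e.
Implicit Types (u v w : E) (g : R -> E).

Lemma V_scale (c : R) u : V u -> V (c *: u).
Proof.
move=> Vu; rewrite (_ : c *: u = (c - 1) *: u + u); first exact: V_lin.
by rewrite scalerBl scale1r subrK.
Qed.

Lemma V_sub u v : V u -> V v -> V (u - v).
Proof. by move=> Vu Vv; rewrite addrC -scaleN1r; exact: V_lin. Qed.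

Lemma S_subC u v : V u -> V v -> S (u - v) = S (v - u).
Proof.
move=> Vu Vv; have -> : u - v = -1 *: (v - u) by rewrite scaleN1r opprB.
rewrite S_scale; last exact: V_sub.
by rewrite normrN1 mul1r.
Qed.

Lemma S_sub_le u v : V u -> V v -> S u <= S (u - v) + S v.
Proof.
by move=> Vu Vv; have := S_triangle (V_sub Vu Vv) Vv; rewrite subrK.
Qed.

Lemma S_sub_le2 u v w : V u -> V v -> V w ->
  S (u - v) <= S (u - w) + S (v - w).
Proof.
move=> Vu Vv Vw; have := S_triangle (V_sub Vu Vw) (V_sub Vw Vv).
by rewrite addrA subrK (S_subC Vw Vv).
Qed.

Definition linear_left (a : E -> E -> R) : Prop :=
  forall (c : R) u v w, V u -> V v -> V w -> a (c *: u + v) w = c * a u w + a v w.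

Lemma linear_leftB a u v w : linear_left a -> V u -> V v -> V w ->
  a (u - v) w = a u w - a v w.
Proof. by move=> la Vu Vv Vw; rewrite addrC -scaleN1r la// mulN1r addrC. Qed.

Lemma linear_leftZ a (c : R) u w : linear_left a -> V u -> V w -> a (c *: u) w = c * a u w.
Proof.
move=> la Vu Vw; rewrite (_ : c *: u = (c - 1) *: u + u); last first.
  by rewrite scalerBl scale1r subrK.
by rewrite la// mulrBl mul1r subrK.
Qed.

Definition form_bounded (a : E -> E -> R) (C : R) : Prop :=
  0 <= C /\ forall u v, V u -> V v -> `|a u v| <= C * S u * S v.

Definition diff_quot g (h : R) : E := h^-1 *: (g h - g 0).

Definition has_derive g w : Prop :=
  V w /\ (fun h => N (diff_quot g h - w)) @ (0 : R)^' --> (0 : R).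

Lemma near0P (P : R -> Prop) : (\forall h \near (0 : R)^', P h) <->
  exists2 e : R, 0 < e & forall h, h != 0 -> `|h| < e -> P h.
Proof.
split=> [[e /= e0 He]|[e e0 He]].
  by exists e => // h h0 he; apply: He => //=; rewrite sub0r normrN.
by exists e => // h /=; rewrite sub0r normrN => he h0; exact: He.
Qed.

Variables (A b : E -> E -> R) (m K B : R).
Hypothesis (A_lin : linear_left A) (b_lin : linear_left b).
Hypothesis A_bounded : form_bounded A K.
Hypothesis b_bounded : form_bounded b (B * m).
Hypothesis m0 : 0 < m.
Hypothesis A_coercive : forall u, V u -> m * S u ^+ 2 <= A u u.

(** Testing with u itself gives m S(u)^2 <= c m S(u). All estimates of solutions, difference
    quotients and derivatives pass through this inequality. *)
Lemma coercive_bound u (c : R) : 0 <= c -> V u ->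
  (forall v, V v -> `|A u v| <= c * m * S v) -> S u <= c.
Proof.
move=> c0 Vu Au; have [->//|S0] := eqVneq (S u) 0.
have Sp : 0 < S u by rewrite lt_neqAle eq_sym S0 S_ge0.
have := le_trans (A_coercive Vu) (le_trans (ler_norm _) (Au u Vu)).
by rewrite [c * m]mulrC -mulrA ler_pM2l// expr2 ler_pM2r.
Qed.

Lemma near_mul_le (X e : R) : 0 <= X -> 0 < e -> \forall h \near (0 : R)^', `|h| * X <= e.
Proof.
move=> X0 ep; apply/near0P; exists (e / (X + 1)); first by rewrite divr_gt0// ltr_wpDl.
move=> h _ /ltW; rewrite ler_pdivlMr ?ltr_wpDl//; apply: le_trans.
by rewrite ler_wpM2l// lerDl.
Qed.

Variables (I : eqType) (L : seq I) (bs : I -> E -> E -> R) (Bs : I -> R).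
Hypothesis bs_lin : forall p, linear_left (bs p).
Hypothesis bs_bounded : forall p, form_bounded (bs p) (Bs p * m).
Variables (g : R -> E) (ws : I -> R -> E) (dws : I -> E) (c : E -> R) (e0 : R).
Hypothesis e0_gt0 : 0 < e0.
Hypothesis Vg : forall h, `|h| < e0 -> V (g h).
Hypothesis Vws : forall p h, p \in L -> `|h| < e0 -> V (ws p h).
Hypothesis g_eq : forall h v, `|h| < e0 -> V v ->
  A (g h) v + h * b (g h) v = c v - \sum_(p <- L) bs p (ws p h) v.
Hypothesis ws_derive : forall p, p \in L -> has_derive (ws p) (dws p).

Let B0 : 0 <= B.
Proof. by have [+ _] := b_bounded; rewrite pmulr_lge0. Qed.

Let Bs0 p : 0 <= Bs p.
Proof. by have [+ _] := bs_bounded p; rewrite pmulr_lge0. Qed.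

Let lt0e0 : `|0 : R| < e0.
Proof. by rewrite normr0. Qed.

Let Vg0 : V (g 0).
Proof. exact: Vg. Qed.

Let Vdq h : `|h| < e0 -> V (diff_quot g h).
Proof. by move=> he; apply: V_scale; apply: V_sub => //; exact: Vg. Qed.

Let Vdqs p h : p \in L -> `|h| < e0 -> V (diff_quot (ws p) h).
Proof. by move=> pL he; apply: V_scale; apply: V_sub; exact: Vws. Qed.

Let Vdws p : p \in L -> V (dws p).
Proof. by move=> /ws_derive[]. Qed.

(** [g_eq] says that g(h) solves the problem with form A + h b, the form at the shifted parameter.
    Subtracting the equation at 0 and dividing by h keeps the form A of the base point on the left;
    b acts on g(h), not on g(0). *)
Let dq_eq h v : h != 0 -> `|h| < e0 -> V v -> A (diff_quot g h) v =
  - b (g h) v - \sum_(p <- L) bs p (diff_quot (ws p) h) v.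
Proof.
move=> h0 he Vv; have Vgh := Vg he.
have -> : \sum_(p <- L) bs p (diff_quot (ws p) h) v =
    h^-1 * (\sum_(p <- L) bs p (ws p h) v - \sum_(p <- L) bs p (ws p 0) v).
  rewrite -sumrB mulr_sumr; apply: eq_big_seq => p pL.
  have V1 := Vws pL he; have V2 := Vws pL lt0e0.
  by rewrite /diff_quot linear_leftZ//; [rewrite linear_leftB|exact: V_sub].
rewrite /diff_quot linear_leftZ//; last exact: V_sub.
rewrite linear_leftB//; have := g_eq he Vv; have := g_eq lt0e0 Vv.
move: (A _ _) (A _ _) (b _ _) (b _ _) (\sum_(p <- L) _) (\sum_(p <- L) _) (c v).
move=> a1 a2 b1 b2 s1 s2 cv E1 E2.
have -> : a1 - a2 = - h * b1 - (s1 - s2) by move: E1 E2; rewrite mul0r addr0 => ->; lra.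
by field.
Qed.

Let sum_bound (x : I -> E) v : (forall p, p \in L -> V (x p)) -> V v ->
  `|\sum_(p <- L) bs p (x p) v| <= (\sum_(p <- L) Bs p * S (x p)) * m * S v.
Proof.
move=> Vx Vv; apply: (le_trans (ler_norm_sum _ _ _)); rewrite !mulr_suml.
apply: ler_sum_mem => p pL; have [_ H] := bs_bounded p.
apply: (le_trans (H _ _ (Vx p pL) Vv)).
by rewrite le_eqVlt; apply/orP; left; apply/eqP; ring.
Qed.

Let b_le u (X : R) v : V u -> V v -> S u <= X -> `|b u v| <= B * X * m * S v.
Proof.
move=> Vu Vv uX; have [Bm0 H] := b_bounded; apply: (le_trans (H u v Vu Vv)).
by rewrite ler_wpM2r// mulrAC ler_wpM2r ?(ltW m0)// ler_wpM2l.
Qed.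

Let sum_le (x : I -> E) (X : R) v : (forall p, p \in L -> V (x p)) -> V v ->
  \sum_(p <- L) Bs p * S (x p) <= X -> `|\sum_(p <- L) bs p (x p) v| <= X * m * S v.
Proof.
move=> Vx Vv xX; apply: (le_trans (sum_bound Vx Vv)).
by rewrite ler_wpM2r// ler_wpM2r ?(ltW m0).
Qed.

(** The weighted error of the difference quotients of the lower-order data; it tends to 0 by
    [ws_derive] and is the part of the right-hand side without an explicit factor h. *)
Let rho h : R := \sum_(p <- L) Bs p * S (diff_quot (ws p) h - dws p).

Let near_lt : \forall h \near (0 : R)^', `|h| < e0.
Proof. by apply/near0P; exists e0. Qed.

Let near_neq0 : \forall h \near (0 : R)^', h != 0.
Proof. by apply/near0P; exists 1. Qed.

Let rho_small e : 0 < e -> \forall h \near (0 : R)^', rho h <= e.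
Proof.
suff H s : {subset s <= L} -> forall e, 0 < e -> \forall h \near (0 : R)^',
    \sum_(p <- s) Bs p * S (diff_quot (ws p) h - dws p) <= e by exact: H.
elim: s {e} => [|p s IHs] sL e ep; first by near=> h; rewrite big_nil ltW.
have e2 : 0 < e / 2 by rewrite divr_gt0.
have H1 : \forall h \near (0 : R)^', \sum_(p <- s) Bs p * S (diff_quot (ws p) h - dws p) <= e / 2.
  by apply: IHs => // q qs; apply: sL; rewrite inE qs orbT.
have pL : p \in L by apply: sL; rewrite mem_head.
have e3 : 0 < e / 2 / (Bs p + 1) by rewrite divr_gt0// ltr_wpDl.
have [_ /cvgr0Pnorm_le/(_ _ e3) H2] := ws_derive pL.
near=> h; rewrite big_cons [leRHS]splitr lerD//; last by near: h.
have he : `|h| < e0 by near: h; exact: near_lt.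
apply: (@le_trans _ _ (Bs p * (e / 2 / (Bs p + 1)))).
  rewrite ler_wpM2l//.
  apply: (le_trans (S_le_N _)); first by apply: V_sub; [exact: Vdqs|exact: Vdws].
  by apply: (le_trans (ler_norm _)); near: h.
by rewrite mulrCA ler_piMr ?(ltW e2)// ler_pdivrMr ?ltr_wpDl// mul1r lerDl.
Unshelve. all: by end_near. Qed.

Let gE h : h != 0 -> g h - g 0 = h *: diff_quot g h.
Proof. by move=> h0; rewrite /diff_quot scalerA mulfV// scale1r. Qed.

Let Sg h : h != 0 -> `|h| < e0 -> S (g h - g 0) = `|h| * S (diff_quot g h).
Proof. by move=> h0 he; rewrite gE// S_scale//; exact: Vdq. Qed.

(** Absorption: S(g h) <= S(g 0) + |h| S(dq), where dq is the quotient itself. Once |h| B <= 1/2,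
    this term moves to the left, whence the factor 2; the 1 in the bound stands for [rho h]. *)
Let dq_bounded : exists2 K1, 0 <= K1 & \forall h \near (0 : R)^', S (diff_quot g h) <= K1.
Proof.
pose T := \sum_(p <- L) Bs p * S (dws p).
have T0 : 0 <= T by apply: sumr_ge0 => p _; rewrite mulr_ge0// S_ge0.
exists (2 * (B * S (g 0) + 1 + T)).
  by rewrite mulr_ge0// !addr_ge0// mulr_ge0// S_ge0.
near=> h.
have h0 : h != 0 by near: h; exact: near_neq0.
have he : `|h| < e0 by near: h; exact: near_lt.
have hB : `|h| * B <= 2^-1 by near: h; apply: near_mul_le.
have rho1 : rho h <= 1 by near: h; exact: rho_small.
have rho0 : 0 <= rho h by apply: sumr_ge0 => p _; rewrite mulr_ge0// S_ge0.
have D0 := S_ge0 (diff_quot g h).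
suff H : S (diff_quot g h) <=
    B * (S (g 0) + `|h| * S (diff_quot g h)) + (rho h + T).
  have H2 := ler_wpM2r D0 hB.
  by move: H H2 rho1; rewrite mulrDr mulrA [B * `|h|]mulrC; lra.
apply: coercive_bound => [||v Vv].
- by rewrite !addr_ge0// mulr_ge0// addr_ge0 ?mulr_ge0 ?S_ge0.
- exact: Vdq.
rewrite dq_eq// -opprD normrN; apply: (le_trans (ler_normD _ _)).
rewrite 2!mulrDl; apply: lerD.
  apply: b_le => //; first exact: Vg.
  by rewrite addrC -Sg//; apply: S_sub_le => //; exact: Vg.
apply: sum_le => // [p pL|]; first exact: Vdqs.
rewrite /rho /T -big_split/=; apply: ler_sum_mem => p pL; rewrite -mulrDr ler_wpM2l//.
by apply: S_sub_le; [exact: Vdqs|exact: Vdws].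
Unshelve. all: by end_near. Qed.

(** The difference of two quotients solves the same kind of equation. Its right-hand side contains
    g(h) - g(k), of size at most (|h| + |k|) K1 by [dq_bounded], and errors bounded by
    [rho h + rho k]; each of the four terms gets e/4. *)
Let dq_cauchy e : 0 < e -> exists2 d, 0 < d <= e0 & forall h k, h != 0 -> `|h| < d ->
  k != 0 -> `|k| < d -> S (diff_quot g h - diff_quot g k) <= e.
Proof.
move=> ep; have [K1 K10 HK] := dq_bounded.
have e4 : 0 < e / 4 by rewrite divr_gt0.
have BK0 : 0 <= B * K1 by rewrite mulr_ge0.
have : \forall h \near (0 : R)^', [/\ S (diff_quot g h) <= K1, rho h <= e / 4 &
    `|h| * (B * K1) <= e / 4].
  near=> h; split; near: h => //; [exact: rho_small|exact: near_mul_le].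
move=> /near0P[d1 d1p Hd]; exists (Num.min d1 e0).
  by rewrite lt_min d1p e0_gt0/= ge_min lexx orbT.
move=> h k h0 hlt k0 klt; move: hlt klt; rewrite !lt_min => /andP[hd he] /andP[kd ke].
have [Kh rh bh] := Hd h h0 hd; have [Kk rk bk] := Hd k k0 kd.
apply: (@le_trans _ _ (B * (`|h| * K1 + `|k| * K1) + (rho h + rho k))); last first.
  move: bh bk rh rk.
  rewrite mulrDr (mulrCA B) (mulrCA B `|k|); move: (`|h| * (B * K1)) (`|k| * (B * K1)) => p q; lra.
have V1 := Vdq he; have V2 := Vdq ke; have Vgh := Vg he; have Vgk := Vg ke.
have rho0 l : 0 <= rho l by apply: sumr_ge0 => p _; rewrite mulr_ge0// S_ge0.
apply: coercive_bound => [||v Vv].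
- by rewrite !addr_ge0// mulr_ge0// addr_ge0 ?mulr_ge0.
- exact: V_sub.
have -> : A (diff_quot g h - diff_quot g k) v =
    - (b (g h - g k) v + \sum_(p <- L) bs p (diff_quot (ws p) h - diff_quot (ws p) k) v).
  rewrite linear_leftB// !dq_eq// linear_leftB//.
  have -> : \sum_(p <- L) bs p (diff_quot (ws p) h - diff_quot (ws p) k) v =
      \sum_(p <- L) bs p (diff_quot (ws p) h) v - \sum_(p <- L) bs p (diff_quot (ws p) k) v.
    rewrite -sumrB; apply: eq_big_seq => p pL.
    by apply: linear_leftB => //; exact: Vdqs.
  move: (b _ _) (b _ _) (\sum_(p <- L) _) (\sum_(p <- L) _) => *; ring.
rewrite normrN; apply: (le_trans (ler_normD _ _)).
rewrite 2!mulrDl; apply: lerD.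
  apply: b_le => //; first exact: V_sub.
  apply: (le_trans (S_sub_le2 Vgh Vgk Vg0)).
  by rewrite !Sg// lerD// ler_wpM2l.
apply: sum_le => // [p pL|]; first by apply: V_sub; exact: Vdqs.
rewrite /rho -big_split/=; apply: ler_sum_mem => p pL; rewrite -mulrDr ler_wpM2l//.
by apply: S_sub_le2; [exact: Vdqs|exact: Vdqs|exact: Vdws].
Unshelve. all: by end_near. Qed.

(* Coercivity and completeness make this independent of any solvability result for A. *)
Lemma diff_quot_cvg : exists w, has_derive g w.
Proof.
have cauchyV e : 0 < e -> exists2 d, 0 < d <= e0 & forall h k, h != 0 -> `|h| < d ->
    k != 0 -> `|k| < d -> N (diff_quot g h - diff_quot g k) <= e.
  move=> ep; have ek : 0 < e / (Kc + 1) by rewrite divr_gt0// ltr_wpDl.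
  have [d /andP[d0 de] Hd] := dq_cauchy ek; exists d; first by rewrite d0.
  move=> h k h0 hd k0 kd.
  have V1 := Vdq (lt_le_trans hd de); have V2 := Vdq (lt_le_trans kd de).
  apply: (le_trans (N_le_S (V_sub V1 V2))).
  apply: (le_trans (ler_wpM2l Kc0 (Hd _ _ h0 hd k0 kd))).
  by rewrite mulrCA ler_piMr ?(ltW ep)// ler_pdivrMr ?ltr_wpDl// mul1r lerDl.
(* The denominator starts at 2, so that every step is strictly below [e0], where g is known to lie
   in [V]. *)
pose hs (k : nat) : R := e0 * k.+2%:R^-1.
have hs0 k : 0 < hs k by rewrite mulr_gt0.
have hse k : `|hs k| < e0.
  by rewrite gtr0_norm// /hs gtr_pMr// invf_lt1// ltr1n.
have hsd d : 0 < d -> exists K', forall k, (K' <= k)%N -> `|hs k| < d.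
  move=> d0; have de : 0 < d / e0 by rewrite divr_gt0.
  have [j _ HN] := near_infty_natSinv_lt (PosNum de).
  exists j => k Nk; rewrite gtr0_norm// /hs mulrC -ltr_pdivlMr//.
  by apply: (HN k.+1 (leqW Nk)).
have [w Vw Hw] : exists2 f, V f & forall e, 0 < e -> exists K', forall k, (K' <= k)%N ->
    N (diff_quot g (hs k) - f) <= e.
  apply: (N_complete) => [k|e ep]; first by apply: Vdq; exact: hse.
  have [d /andP[d0 de] Hd] := cauchyV e ep; have [i HN] := hsd d d0.
  exists i => j k Nj Nk; apply: Hd; rewrite ?gt_eqF//; exact: HN.
exists w; split => //; apply/cvgr0Pnorm_le => e ep.
have e2 : 0 < e / 2 by rewrite divr_gt0.
have [d /andP[d0 de] Hd] := cauchyV _ e2; have [N1 HN1] := hsd d d0; have [N2 HN2] := Hw _ e2.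
apply/near0P; exists d => // h h0 hd; rewrite ger0_norm ?N_ge0//.
pose k := maxn N1 N2.
have V1 := Vdq (lt_le_trans hd de); have V2 := Vdq (hse k).
have := N_triangle (V_sub V1 V2) (V_sub V2 Vw).
rewrite addrA subrK => /le_trans; apply.
rewrite [leRHS]splitr; apply: lerD; last by apply: HN2; rewrite leq_maxr.
by apply: Hd => //; [rewrite gt_eqF|apply: HN1; rewrite leq_maxl].
Qed.

(** The limit of the equation for the quotients. At one sufficiently small h the defect is a sum of
    three terms, from A, b and the lower-order data, each at most e/3. *)
Lemma derive_eq w v : has_derive g w -> V v ->
  A w v = - b (g 0) v - \sum_(p <- L) bs p (dws p) v.
Proof.
move=> [Vw cw] Vv; apply/eqP; rewrite -subr_eq0 -normr_le0; apply/ler_addgt0Pr => e ep.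
rewrite add0r; have [K1 K10 HK] := dq_bounded; have [K0 AK] := A_bounded.
have S0 := S_ge0 v.
have e3 : 0 < e / 3 by rewrite divr_gt0.
have eA : 0 < e / 3 / (K * S v + 1) by rewrite divr_gt0// ltr_wpDl// mulr_ge0.
have eR : 0 < e / 3 / (m * S v + 1) by rewrite divr_gt0// ltr_wpDl// mulr_ge0// ltW.
have BmK0 : 0 <= K1 * (B * m * S v) by rewrite !mulr_ge0// ltW.
move/cvgr0Pnorm_le : cw => /(_ _ eA) Hw.
near (0 : R)^' => h.
have h0 : h != 0 by near: h; exact: near_neq0.
have he : `|h| < e0 by near: h; exact: near_lt.
have Kh : S (diff_quot g h) <= K1 by near: h.
have rh : rho h <= e / 3 / (m * S v + 1) by near: h; exact: rho_small.
have bh : `|h| * (K1 * (B * m * S v)) <= e / 3 by near: h; exact: near_mul_le.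
have wh : N (diff_quot g h - w) <= e / 3 / (K * S v + 1).
  by apply: (le_trans (ler_norm _)); near: h.
have Vd := Vdq he; have Vgh := Vg he.
have -> : A w v - (- b (g 0) v - \sum_(p <- L) bs p (dws p) v) =
    - (A (diff_quot g h - w) v + b (g h - g 0) v +
       \sum_(p <- L) bs p (diff_quot (ws p) h - dws p) v).
  rewrite (linear_leftB A_lin)// dq_eq// (linear_leftB b_lin)//.
  have -> : \sum_(p <- L) bs p (diff_quot (ws p) h - dws p) v =
      \sum_(p <- L) bs p (diff_quot (ws p) h) v - \sum_(p <- L) bs p (dws p) v.
    rewrite -sumrB; apply: eq_big_seq => p pL.
    by apply: linear_leftB => //; [exact: Vdqs|exact: Vdws].
  move: (A _ _) (b _ _) (b _ _) (\sum_(p <- L) _) (\sum_(p <- L) _) => *; ring.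
rewrite normrN; apply: (le_trans (ler_normD _ _)).
have -> : e = e / 3 + e / 3 + e / 3 by field.
apply: lerD; last first.
  apply: (le_trans (sum_bound (fun p pL => V_sub (Vdqs pL he) (Vdws pL)) Vv)).
  rewrite -/(rho h) -mulrA.
  have mS0 : 0 <= m * S v by rewrite mulr_ge0// ltW.
  apply: (le_trans (ler_wpM2r mS0 rh)).
  by rewrite mulrAC ler_pdivrMr ?ltr_wpDl// ler_pM2l// lerDl.
apply: (le_trans (ler_normD _ _)); apply: lerD.
  apply: (le_trans (AK _ _ (V_sub Vd Vw) Vv)).
  have KS0 : 0 <= K * S v by rewrite mulr_ge0.
  rewrite mulrAC.
  apply: (le_trans (ler_wpM2l KS0 (le_trans (S_le_N (V_sub Vd Vw)) wh))).
  by rewrite mulrC mulrAC ler_pdivrMr ?ltr_wpDl// ler_pM2l// lerDl.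
have [Bm0 H] := b_bounded; apply: (le_trans (H _ _ (V_sub Vgh Vg0) Vv)).
rewrite Sg//; apply: le_trans bh; rewrite mulrAC mulrCA ler_wpM2l// mulrC.
by rewrite ler_wpM2r// mulr_ge0.
Unshelve. all: by end_near. Qed.

End difference_quotients.

(** * Derivatives of all orders *)

Section minors.
Context (I : eqType).

(** Entries are removed by position, so a direction that occurs alpha_j times yields alpha_j pairs:
    these are the multiplicities in Leibniz' rule. *)
Fixpoint minors (s : seq I) : seq (I * seq I) :=
  if s is i :: s' then (i, s') :: [seq (q.1, i :: q.2) | q <- minors s'] else [::].

Lemma size_minors s : size (minors s) = size s.
Proof. by elim: s => //= i s <-; rewrite size_map. Qed.

Lemma perm_minors s q : q \in minors s -> perm_eq (q.1 :: q.2) s.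
Proof.
elim: s q => //= i s IHs q; rewrite inE => /predU1P[->|]; first exact: perm_refl.
move=> /mapP[r /IHs rs ->] /=; apply: (@perm_trans _ (i :: r.1 :: r.2)).
  exact: (permEl (perm_catCA [:: r.1] [:: i] r.2)).
by rewrite perm_cons.
Qed.

End minors.

Section parametric_derivatives.
Context (R : realType) (E : lmodType R) (V : E -> Prop) (S N : E -> R) (Kc : R).
Hypothesis V_lin : forall (a : R) u v, V u -> V v -> V (a *: u + v).
Hypothesis S_ge0 : forall u, 0 <= S u.
Hypothesis S_triangle : forall u v, V u -> V v -> S (u + v) <= S u + S v.
Hypothesis S_scale : forall (a : R) u, V u -> S (a *: u) = `|a| * S u.
Hypothesis N_ge0 : forall u, 0 <= N u.
Hypothesis N_triangle : forall u v, V u -> V v -> N (u + v) <= N u + N v.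
Hypothesis S_le_N : forall u, V u -> S u <= N u.
Hypothesis Kc0 : 0 <= Kc.
Hypothesis N_le_S : forall u, V u -> N u <= Kc * S u.
Hypothesis N_complete : forall F : nat -> E, (forall k, V (F k)) ->
  (forall e, 0 < e -> exists K, forall j k, (K <= j)%N -> (K <= k)%N -> N (F j - F k) <= e) ->
  exists2 w, V w & forall e, 0 < e -> exists K, forall k, (K <= k)%N -> N (F k - w) <= e.

Variables (I : eqType) (P : Type) (W : P -> Prop) (shift : I -> P -> R -> P).
Hypothesis shift0 : forall i p, shift i p 0 = p.
Hypothesis shift_open : forall i p, W p ->
  exists2 e : R, 0 < e & forall h, `|h| < e -> W (shift i p h).
Variables (der : I -> (P -> E) -> P -> E).
Hypothesis derP : forall i F p, (exists w, has_derive V N (fun h => F (shift i p h)) w) ->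
  has_derive V N (fun h => F (shift i p h)) (der i F p).

Variables (A : P -> E -> E -> R) (b : I -> E -> E -> R) (m : R) (B : I -> R).
Variables (f : E -> R) (u : P -> E).
Hypothesis m0 : 0 < m.
Hypothesis A_lin : forall p, W p -> linear_left V (A p).
Hypothesis b_lin : forall i, linear_left V (b i).
Hypothesis A_bounded : forall p, W p -> exists K, form_bounded V S (A p) K.
Hypothesis b_bounded : forall i, form_bounded V S (b i) (B i * m).
Hypothesis A_coercive : forall p v, W p -> V v -> m * S v ^+ 2 <= A p v v.
Hypothesis A_shift : forall i p h v w, W p -> W (shift i p h) -> V v -> V w ->
  A (shift i p h) v w = h * b i v w + A p v w.
Hypothesis Vu : forall p, W p -> V (u p).
Hypothesis uE : forall p v, W p -> V v -> A p (u p) v = f v.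

Definition ders (s : seq I) : P -> E := foldr der u s.

Let B0 i : 0 <= B i.
Proof. by have [+ _] := b_bounded i; rewrite pmulr_lge0. Qed.

(* Leibniz' rule for an affine A: each derivative falls on A at most once. *)
Lemma ders_bound s p : W p ->
  [/\ V (ders s p),
    forall v, V v -> A p (ders s p) v = (if s is [::] then f v else 0) -
      \sum_(q <- minors s) b q.1 (ders q.2 p) v,
    S (ders s p) <= (size s)`!%:R * \prod_(i <- s) B i * S (u p) &
    if s is i :: s' then exists w, has_derive V N (fun h => ders s' (shift i p h)) w else True].
Proof.
(* The induction is on a bound for the length, because the lists in [minors] and their extensions by
   i are not tails of s. *)
move: {2}(size s) (leqnn (size s)) p => k; elim: k s => [|k IHk] [|i s] //= sk p Wp.
1,2: by split => //; rewrite ?big_nil ?mul1r //; [exact: Vu|move=> v Vv; rewrite big_nil subr0 uE].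
have [e0 e00 We] := shift_open i Wp.
have Wm h : `|h| < e0 -> W (shift i p h) by exact: We.
have Lsize q : q \in minors s -> (size q.2 < size s)%N.
  by move=> /perm_minors/perm_size <-.
have Vg h : `|h| < e0 -> V (ders s (shift i p h)) by move=> /Wm Wh; have [] := IHk s sk _ Wh.
have Vws q h : q \in minors s -> `|h| < e0 -> V (ders q.2 (shift i p h)).
  move=> /Lsize qs /Wm Wh; have qk : (size q.2 <= k)%N := leq_trans (ltnW qs) sk.
  by have [] := IHk q.2 qk _ Wh.
(* The load f occurs at order 0 only: it does not depend on the parameters, so one differentiation
   removes it. *)
pose c v := if s is [::] then f v else 0.
have g_eq : forall h v, `|h| < e0 -> V v -> A p (ders s (shift i p h)) v + h * b i (ders s (shift i p h)) v =
    c v - \sum_(q <- minors s) b q.1 (ders q.2 (shift i p h)) v.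
  move=> h v he Vv; have Wh := Wm h he; have [_ E1 _ _] := IHk s sk _ Wh.
  by rewrite -(E1 v Vv) addrC A_shift//; exact: Vg.
(* A minor of s extended by i has at most the length of s, so the induction hypothesis already
   supplies its derivative along i. *)
have ws_derive q : q \in minors s ->
    has_derive V N (fun h => ders q.2 (shift i p h)) (ders (i :: q.2) p).
  move=> qs; apply: derP; have qk : (size (i :: q.2) <= k)%N := leq_trans (Lsize q qs) sk.
  by have [] := IHk (i :: q.2) qk _ Wp.
have [K AK] := A_bounded Wp.
have ex := diff_quot_cvg V_lin S_ge0 S_triangle S_scale N_ge0 N_triangle S_le_N Kc0 N_le_S
  N_complete (A_lin Wp) (b_lin i) (b_bounded i) m0 (fun v => A_coercive Wp)
  (fun q : I * seq I => b_lin q.1) (fun q : I * seq I => b_bounded q.1) e00 Vg Vws g_eq ws_derive.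
have Hd := derP ex.
have [VD _] := Hd; rewrite -/(ders (i :: s) p) in VD.
(* The derivative falling on A gives the pair (i, s); those falling on the lower-order terms put i
   in front of each remaining list. This is the recursion that defines [minors]. *)
have EQ v : V v -> A p (ders (i :: s) p) v =
    0 - \sum_(q <- minors (i :: s)) b q.1 (ders q.2 p) v.
  move=> Vv; have := derive_eq V_lin S_ge0 S_triangle S_scale S_le_N
    (A_lin Wp) (b_lin i) AK (b_bounded i) m0 (fun v => A_coercive Wp)
    (fun q : I * seq I => b_lin q.1) (fun q : I * seq I => b_bounded q.1) e00 Vg Vws g_eq ws_derive
    Hd Vv.
  by rewrite shift0 => ->; rewrite /= big_cons big_map sub0r opprD.
split => //.
have Q q : q \in minors (i :: s) -> V (ders q.2 p) /\
    B q.1 * S (ders q.2 p) <= (size s)`!%:R * \prod_(j <- i :: s) B j * S (u p).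
  move=> /perm_minors qs; have sq : size q.2 = size s by have /= [] := perm_size qs.
  have qk : (size q.2 <= k)%N by rewrite sq.
  have [Vq _ Sq _] := IHk q.2 qk p Wp.
  have EP : \prod_(j <- i :: s) B j = B q.1 * \prod_(j <- q.2) B j.
    by rewrite -(perm_big _ qs) big_cons.
  split => //; rewrite EP.
  apply: (le_trans (ler_wpM2l (B0 q.1) Sq)); rewrite sq.
  by rewrite le_eqVlt; apply/orP; left; apply/eqP; ring.
apply: (@le_trans _ _ (\sum_(q <- minors (i :: s)) B q.1 * S (ders q.2 p))); last first.
  apply: (le_trans (ler_sum_mem (fun q qs => (Q q qs).2))).
  (* All size s + 1 pairs have the same bound, because the removed entry restores the full product;
     size s + 1 times (size s)! is the next factorial. *)
  rewrite big_const_seq count_predT size_minors iter_addr_0 /= factS natrM -[leLHS]mulr_natl.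
  by rewrite !mulrA.
apply: (coercive_bound S_ge0 m0 (fun v => A_coercive Wp)) => //.
  by apply: sumr_ge0 => q _; rewrite mulr_ge0.
move=> v Vv; rewrite EQ// sub0r normrN; apply: (le_trans (ler_norm_sum _ _ _)).
rewrite !mulr_suml; apply: ler_sum_mem => q qs; have [_ H] := b_bounded q.1.
apply: (le_trans (H _ _ (Q q qs).1 Vv)).
by rewrite le_eqVlt; apply/orP; left; apply/eqP; ring.
Qed.

End parametric_derivatives.

(** * Parameters and multi-indices *)

Lemma bounded_set_coord (R : realType) n (Omega : set 'rV[R]_n) : bounded_set Omega ->
  exists2 M : R, 0 <= M & forall x, Omega x -> forall i, `|x ord0 i| <= M.
Proof.
move=> [r [_ Hr]]; exists (`|r| + 1); first by rewrite addr_ge0.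
move=> x Ox i; have rlt : r < `|r| + 1 by rewrite (le_lt_trans (ler_norm r))// ltrDl.
apply: (@le_trans _ _ (mx_norm x)); last exact: (Hr _ rlt x Ox).
rewrite mx_normrE.
exact: (le_bigmax _ (fun ij : 'I_1 * 'I_n => `|x ij.1 ij.2|) (ord0, i)).
Qed.

Section multi_indices.
Context (R : realType).
Implicit Types alpha beta : multi_index.

Lemma size_mi_directions alpha beta :
  size (mi_directions alpha beta) = (mi_order alpha + mi_order beta)%N.
Proof.
rewrite size_cat !size_flatten /shape -!map_comp !sumnE !big_map.
by congr (_ + _)%N; apply: eq_bigr => j _ /=; rewrite size_nseq.
Qed.

Lemma prod_mi_directions alpha beta (B : direction -> R) :
  \prod_(i <- mi_directions alpha beta) B i =
  mi_pow (fun j => B (inl j)) alpha * mi_pow (fun j => B (inr j)) beta.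
Proof.
rewrite big_cat/= !big_flatten/= !big_map.
by congr (_ * _); apply: eq_bigr => j _; rewrite big_nseq GRing.iter_mulr_1.
Qed.

Lemma set_coord_id (y : nat -> R) j : set_coord y j (y j) = y.
Proof. by apply/funext => k; rewrite /set_coord; case: eqP => // ->. Qed.

Lemma U_set_coord (y : nat -> R) j : U y ->
  exists2 e : R, 0 < e & forall h, `|h| < e -> U (set_coord y j (y j + h)).
Proof.
move=> Uy; have /andP[y1 y2] := Uy j.
exists (Num.min (y j + 2^-1) (2^-1 - y j)); first by rewrite lt_min; apply/andP; split; lra.
move=> h; rewrite lt_min !ltr_norml => /andP[/andP[h1 h2] /andP[h3 h4]] k.
by rewrite /set_coord; case: eqP => [_|_]; [apply/andP; split; lra|exact: Uy].
Qed.

Definition param_shift (i : direction) (p : (nat -> R) * (nat -> R)) (h : R) :=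
  match i with
  | inl j => (set_coord p.1 j (p.1 j + h), p.2)
  | inr j => (p.1, set_coord p.2 j (p.2 j + h))
  end.

Definition param_dom (p : (nat -> R) * (nat -> R)) : Prop := U p.1 /\ U p.2.

Lemma param_shift0 i p : param_shift i p 0 = p.
Proof. by case: i p => j [y z]; rewrite /= addr0 set_coord_id. Qed.

Lemma param_shift_open i p : param_dom p ->
  exists2 e : R, 0 < e & forall h, `|h| < e -> param_dom (param_shift i p h).
Proof.
case: i p => j [y z] [/= Uy Uz].
  by have [e e0 He] := U_set_coord j Uy; exists e => // h /He.
by have [e e0 He] := U_set_coord j Uz; exists e => // h /He.
Qed.

Section V_valued.
Context n (Omega : set 'rV[R]_n).
Local Notation field := ('rV[R]_n -> 'rV[R]_n).

Lemma V_is_deriveP (g : R -> field) t w : V_is_derive Omega g t w <->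
  has_derive (V Omega) (V_norm Omega) (fun h => g (t + h)) w.
Proof. by rewrite /V_is_derive /has_derive /diff_quot addr0. Qed.

(** The uncurried form of [partial], as the abstract induction works with a single parameter p. *)
Definition param_partial (i : direction) (F : (nat -> R) * (nat -> R) -> field) p : field :=
  partial Omega i (fun y z => F (y, z)) p.1 p.2.

Lemma slice_shift i (F : (nat -> R) -> (nat -> R) -> field) y z :
  (fun h => slice F i y z (coordinate i y z + h)) =
  (fun h => (fun p => F p.1 p.2) (param_shift i (y, z) h)).
Proof. by case: i => j. Qed.

Lemma param_partialP i F p :
  (exists w, has_derive (V Omega) (V_norm Omega) (fun h => F (param_shift i p h)) w) ->
  has_derive (V Omega) (V_norm Omega) (fun h => F (param_shift i p h)) (param_partial i F p).
Proof.
case: p => y z.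
pose g := slice (fun y z => F (y, z)) i y z; pose t := coordinate i y z.
have -> : (fun h => F (param_shift i (y, z) h)) = (fun h => g (t + h)).
  by rewrite /g /t slice_shift; apply/funext => h; case: (param_shift _ _ _).
move=> [w Hw]; have Hw' := (V_is_deriveP g t w).2 Hw.
exact: ((V_is_deriveP g t (V_derive Omega g t)).1 (xgetPex (cst 0) (ex_intro _ w Hw'))).
Qed.

Lemma dersE s (u : (nat -> R) -> (nat -> R) -> field) y z :
  ders param_partial (fun p => u p.1 p.2) s (y, z) = partials Omega s u y z.
Proof.
elim: s y z => [|i s IHs] y z; first exact: erefl.
have E : (fun y z => ders param_partial (fun p => u p.1 p.2) s (y, z)) = partials Omega s u.
  by apply/funext => y'; apply/funext => z'; exact: IHs.
transitivity (partial Omega i (fun y z => ders param_partial (fun p => u p.1 p.2) s (y, z)) y z).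
  exact: erefl.
by rewrite E.
Qed.

Lemma V_norm_ge0 v : 0 <= V_norm Omega v.
Proof. by rewrite /V_norm sqrtr_ge0. Qed.

(** Normalize v and use homogeneity of f. The bound M' |v| contained in [V_dual] is used twice: it
    makes the supremum a true one, and it treats fields of norm 0, which cannot be normalized. *)
Lemma V_dual_norm_bound (M : R) (f : field -> R) v : open Omega ->
  (forall x, Omega x -> forall i, `|x ord0 i| <= M) -> V_dual Omega f -> V Omega v ->
  0 <= V_dual_norm Omega f /\ `|f v| <= V_dual_norm Omega f * V_norm Omega v.
Proof.
move=> oO bO [f_lin [K fK]] Vv.
have Vsc (c : R) : V Omega (c *: v) by apply: (V_scale (V_lin oO bO)).
have f_scale (c : R) : f (c *: v) = c * f v.
  rewrite (_ : c *: v = (c - 1) *: v + v); last by rewrite scalerBl scale1r subrK.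
  by rewrite [LHS](f_lin _ _ _ Vv Vv) mulrBl mul1r subrK.
have N0 := V_norm_ge0.
have ub : has_ubound [set `|f w| | w in [set w | V Omega w /\ V_norm Omega w <= 1]].
  exists `|K| => _ [w [Vw Nw] <-]; apply: (le_trans (fK w Vw)).
  apply: (@le_trans _ _ (`|K| * V_norm Omega w)).
    exact: (ler_wpM2r (N0 w) (ler_norm K)).
  by rewrite -[leRHS]mulr1; exact: (ler_wpM2l (normr_ge0 K) Nw).
have mem w : V Omega w -> V_norm Omega w <= 1 -> `|f w| <= V_dual_norm Omega f.
  by move=> Vw Nw; exact: (ub_le_sup ub (ex_intro2 _ _ w (conj Vw Nw) erefl)).
have D0 : 0 <= V_dual_norm Omega f.
  apply: (le_trans (normr_ge0 (f (0 *: v)))); apply: mem; first exact: Vsc.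
  by rewrite (V_norm_scale oO bO 0 Vv) normr0 mul0r ler01.
split; first exact: D0.
have [Nv0|Nv0] := eqVneq (V_norm Omega v) 0.
  by have := fK v Vv; rewrite Nv0 !mulr0.
have Np : 0 < V_norm Omega v by rewrite lt_neqAle eq_sym Nv0 N0.
have Ni : 0 <= (V_norm Omega v)^-1 by rewrite invr_ge0 N0.
rewrite -(ler_pdivrMr _ _ Np).
have -> : `|f v| / V_norm Omega v = `|f ((V_norm Omega v)^-1 *: v)|.
  by rewrite f_scale normrM (ger0_norm Ni) mulrC.
apply: mem; first exact: Vsc.
by rewrite (V_norm_scale oO bO _ Vv) (ger0_norm Ni) (mulVf Nv0) lexx.
Qed.

End V_valued.
End multi_indices.

Lemma ae_bounded_le (R : realType) n (Omega : set 'rV[R]_n) (C C' : R) rho :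
  C <= C' -> ae_bounded Omega C rho -> ae_bounded Omega C' rho.
Proof.
move=> CC' [mr br]; split => //; apply: filterS br => x H Ox.
exact: le_trans (H Ox) CC'.
Qed.

(** * The Lame problem *)

Lemma Snorm_ge0 (R : realType) n (Omega : set 'rV[R]_n) v : 0 <= Snorm Omega v.
Proof. exact: sqrtr_ge0. Qed.

Lemma korn_const_ge0 (R : realType) (M : R) : 0 <= korn_const M.
Proof. exact: sqrtr_ge0. Qed.

Section lame_problem.
Context (R : realType) (n : nat) (Omega : set 'rV[R]_n) (M : R).
Hypothesis oO : open Omega.
Hypothesis bO : forall x, Omega x -> forall i, `|x ord0 i| <= M.
Hypothesis M0 : 0 <= M.
Hypothesis n0 : (0 < n)%N.
Local Notation fn := ('rV[R]_n -> R).
Local Notation field := ('rV[R]_n -> 'rV[R]_n).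
Variables (mu0 lambda0 : fn) (psi phi : nat -> fn) (mu_min mu_max lambda_max : R).
Hypothesis mu0_meas : measurable_fun Omega mu0.
Hypothesis lambda0_meas : measurable_fun Omega lambda0.
Hypothesis psi_meas : forall j, measurable_fun Omega (psi j).
Hypothesis phi_meas : forall j, measurable_fun Omega (phi j).
Hypothesis mu_min0 : 0 < mu_min.
Hypothesis mu_bnd : forall x y, Omega x -> U y -> mu_min <= affine_coef mu0 psi y x <= mu_max.
Hypothesis lambda_bnd : forall x z, Omega x -> U z ->
  0 <= affine_coef lambda0 phi z x <= lambda_max.
Hypothesis psi_sum : (\sum_(0 <= j <oo) Linfty_norm Omega (psi j) < +oo)%E.
Hypothesis phi_sum : (\sum_(0 <= j <oo) Linfty_norm Omega (phi j) < +oo)%E.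
Hypothesis mu_max0 : 0 < mu_max.
Hypothesis lambda_max0 : 0 < lambda_max.
Variables (f : field -> R) (u : (nat -> R) -> (nat -> R) -> field).
Hypothesis f_dual : V_dual Omega f.
Hypothesis u_sol : forall y z, U y -> U z ->
  weak_solution Omega (affine_coef mu0 psi y) (affine_coef lambda0 phi z) f (u y z).

Local Notation mu := (affine_coef mu0 psi).
Local Notation lambda := (affine_coef lambda0 phi).
Local Notation Linf g := (fine (Linfty_norm Omega g)).

Definition lame_param p : field -> field -> R := lame_form Omega (mu p.1) (lambda p.2).

Definition lame_dir (i : direction) : field -> field -> R :=
  match i with
  | inl j => lame_form Omega (psi j) (cst 0)
  | inr j => lame_form Omega (cst 0) (phi j)
  end.

(** The bounds 2 |psi_j| and d |phi_j| of the derivative forms, divided by the coercivity constant 2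
    mu_min. *)
Definition dir_bound (i : direction) : R :=
  match i with
  | inl j => Linf (psi j) / mu_min
  | inr j => n%:R / 2 * (Linf (phi j) / mu_min)
  end.

Let Linf_ge0 g : 0 <= Linf g.
Proof. by rewrite fine_ge0// Linfty_norm_ge0. Qed.

Let mu_ae y : U y -> ae_bounded Omega mu_max (mu y).
Proof.
move=> Uy; split; first exact: measurable_affine_coef.
apply: aeW => x Ox; have /andP[H1 H2] := mu_bnd Ox Uy.
by rewrite ger0_norm// (le_trans _ H1)// ltW.
Qed.

Let lambda_ae z : U z -> ae_bounded Omega lambda_max (lambda z).
Proof.
move=> Uz; split; first exact: measurable_affine_coef.
by apply: aeW => x Ox; have /andP[H1 H2] := lambda_bnd Ox Uz; rewrite ger0_norm.
Qed.

Let psi_ae j : ae_bounded Omega (Linf (psi j)) (psi j).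
Proof. by split; [exact: psi_meas|have [+ _] := summable_Linfty psi_sum; move=> /(_ j)/ae_Linfty]. Qed.

Let phi_ae j : ae_bounded Omega (Linf (phi j)) (phi j).
Proof. by split; [exact: phi_meas|have [+ _] := summable_Linfty phi_sum; move=> /(_ j)/ae_Linfty]. Qed.

Let cst0_ae : ae_bounded Omega 0 (cst 0).
Proof. by split; [exact: measurable_cst|apply: aeW => x _; rewrite /= normr0]. Qed.

(** The lemmas on forms take a single constant for all their coefficients; [C0], increased by the
    norm of one psi_j or phi_j, bounds all those that occur together. *)
Let C0 : R := mu_max + lambda_max.

Let C00 : 0 <= C0. Proof. by rewrite addr_ge0// ltW. Qed.

Let muC0 y C : 0 <= C -> U y -> ae_bounded Omega (C0 + C) (mu y).
Proof.
by move=> C_ge0 Uy; apply: ae_bounded_le (mu_ae Uy); rewrite /C0 -addrA lerDl addr_ge0// ltW.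
Qed.

Let lambdaC0 z C : 0 <= C -> U z -> ae_bounded Omega (C0 + C) (lambda z).
Proof.
by move=> C_ge0 Uz; apply: ae_bounded_le (lambda_ae Uz); rewrite /C0 addrAC lerDr addr_ge0// ltW.
Qed.

Let psiC0 j : ae_bounded Omega (C0 + Linf (psi j)) (psi j).
Proof. by apply: ae_bounded_le (psi_ae j); rewrite lerDr. Qed.

Let phiC0 j : ae_bounded Omega (C0 + Linf (phi j)) (phi j).
Proof. by apply: ae_bounded_le (phi_ae j); rewrite lerDr. Qed.

Let cstC0 C : 0 <= C -> ae_bounded Omega (C0 + C) (cst 0).
Proof. by move=> C_ge0; apply: ae_bounded_le cst0_ae; rewrite addr_ge0. Qed.

Lemma lame_param_lin p : param_dom p -> linear_left (V Omega) (lame_param p).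
Proof.
move=> [Uy Uz] c v w x Vv Vw Vx.
exact: (form_lin oO bO c (muC0 (lexx 0) Uy) (lambdaC0 (lexx 0) Uz) Vv Vw Vx).
Qed.

Lemma lame_dir_lin i : linear_left (V Omega) (lame_dir i).
Proof.
case: i => j c v w x Vv Vw Vx.
  exact: (form_lin oO bO c (psiC0 j) (cstC0 (Linf_ge0 (psi j))) Vv Vw Vx).
exact: (form_lin oO bO c (cstC0 (Linf_ge0 (phi j))) (phiC0 j) Vv Vw Vx).
Qed.

Lemma lame_dir_bounded i :
  form_bounded (V Omega) (Snorm Omega) (lame_dir i) (dir_bound i * (2 * mu_min)).
Proof.
case: i => j; rewrite /dir_bound.
  have -> : Linf (psi j) / mu_min * (2 * mu_min) = 2 * Linf (psi j).
    by field; rewrite gt_eqF.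
  split; first by rewrite mulr_ge0.
  move=> v w Vv Vw; exact: (form_bound_mu oO (Linf_ge0 (psi j)) (psi_ae j) Vv Vw).
have -> : n%:R / 2 * (Linf (phi j) / mu_min) * (2 * mu_min) = n%:R * Linf (phi j).
  by field; rewrite gt_eqF.
split; first by rewrite mulr_ge0.
move=> v w Vv Vw; exact: (form_bound_lambda oO (Linf_ge0 (phi j)) (phi_ae j) Vv Vw).
Qed.

Lemma lame_param_bounded p : param_dom p ->
  exists K, form_bounded (V Omega) (Snorm Omega) (lame_param p) K.
Proof.
move=> [Uy Uz]; exists (2 * mu_max + n%:R * lambda_max); split.
  by rewrite addr_ge0// mulr_ge0// ltW.
move=> v w Vv Vw.
(* The form is split into its mu part and its lambda part by [form_coef] with t = 1, one coefficient
   being 0 in each; the two bounds then add. *)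
have E1 : {ae lebesgue_rV R n, forall x, Omega x -> mu p.1 x = 1 * mu p.1 x + cst 0 x}.
  by apply: aeW => x _; rewrite mul1r addr0.
have E2 : {ae lebesgue_rV R n, forall x, Omega x -> lambda p.2 x = 1 * cst 0 x + lambda p.2 x}.
  by apply: aeW => x _; rewrite mulr0 add0r.
have z0 := lexx (0 : R).
rewrite /lame_param (form_coef oO (cstC0 z0) (lambdaC0 z0 Uz) (muC0 z0 Uy) (cstC0 z0)
  (muC0 z0 Uy) (lambdaC0 z0 Uz) E1 E2 Vv Vw) mul1r.
apply: (le_trans (ler_normD _ _)); rewrite 2!mulrDl; apply: lerD.
  exact: (form_bound_mu oO (ltW mu_max0) (mu_ae Uy) Vv Vw).
exact: (form_bound_lambda oO (ltW lambda_max0) (lambda_ae Uz) Vv Vw).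
Qed.

Lemma lame_param_coercive p v : param_dom p -> V Omega v ->
  2 * mu_min * Snorm Omega v ^+ 2 <= lame_param p v v.
Proof.
move=> [Uy Uz] Vv; have z0 := lexx (0 : R).
apply: (form_coercive oO (muC0 z0 Uy) (lambdaC0 z0 Uz) Vv).
  by move=> x Ox; have /andP[] := mu_bnd Ox Uy.
by move=> x Ox; have /andP[] := lambda_bnd Ox Uz.
Qed.

Lemma lame_param_shift i p h v w : param_dom p -> param_dom (param_shift i p h) -> V Omega v -> V Omega w ->
  lame_param (param_shift i p h) v w = h * lame_dir i v w + lame_param p v w.
Proof.
case: i => j [Uy Uz] [Uy' Uz'] Vv Vw.
  have G := Linf_ge0 (psi j).
  have E1 : {ae lebesgue_rV R n, forall x, Omega x ->
      mu (set_coord p.1 j (p.1 j + h)) x = h * psi j x + mu p.1 x}.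
    apply: filterS (affine_coef_set_coord mu0 j (p.1 j + h) Uy psi_sum) => x H Ox.
    by rewrite H// addrAC subrr add0r.
  have E2 : {ae lebesgue_rV R n, forall x, Omega x -> lambda p.2 x = h * cst 0 x + lambda p.2 x}.
    by apply: aeW => x _; rewrite mulr0 add0r.
  exact: (form_coef oO (muC0 G Uy) (lambdaC0 G Uz) (psiC0 j) (cstC0 G) (muC0 G Uy')
    (lambdaC0 G Uz) E1 E2 Vv Vw).
have G := Linf_ge0 (phi j).
have E1 : {ae lebesgue_rV R n, forall x, Omega x ->
    lambda (set_coord p.2 j (p.2 j + h)) x = h * phi j x + lambda p.2 x}.
  apply: filterS (affine_coef_set_coord lambda0 j (p.2 j + h) Uz phi_sum) => x H Ox.
  by rewrite H// addrAC subrr add0r.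
have E2 : {ae lebesgue_rV R n, forall x, Omega x -> mu p.1 x = h * cst 0 x + mu p.1 x}.
  by apply: aeW => x _; rewrite mulr0 add0r.
exact: (form_coef oO (muC0 G Uy) (lambdaC0 G Uz) (cstC0 G) (phiC0 j) (muC0 G Uy)
  (lambdaC0 G Uz') E2 E1 Vv Vw).
Qed.

Lemma lame_solution p v : param_dom p -> V Omega v -> lame_param p (u p.1 p.2) v = f v.
Proof.
move=> [Uy Uz] Vv; have [Vu <-//] := u_sol Uy Uz; have z0 := lexx (0 : R).
by rewrite (formE oO (muC0 z0 Uy) (lambdaC0 z0 Uz) Vu Vv).
Qed.

Lemma lame_ders_bound s y z : U y -> U z ->
  [/\ V Omega (partials Omega s u y z),
    Snorm Omega (partials Omega s u y z) <=
      (size s)`!%:R * \prod_(i <- s) dir_bound i * Snorm Omega (u y z) &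
    if s is i :: s' then V_derivable Omega (slice (partials Omega s' u) i y z) (coordinate i y z)
    else True].
Proof.
move=> Uy Uz; have Up : param_dom (y, z) by [].
have m20 : 0 < 2 * mu_min by rewrite mulr_gt0.
have [H1 _ H3 H4] := ders_bound (V_lin oO bO) (Snorm_ge0 Omega) (Snorm_triangle oO bO)
  (Snorm_scale oO bO) (V_norm_ge0 Omega) (V_norm_triangle oO bO) (Snorm_le_V oO)
  (korn_const_ge0 M) (fun v => V_norm_le_S oO bO M0 n0) (V_complete oO bO) (@param_shift0 R)
  (@param_shift_open R) (@param_partialP R n Omega) m20 lame_param_lin lame_dir_lin
  lame_param_bounded lame_dir_bounded lame_param_coercive lame_param_shift
  (fun p (Up : param_dom p) => (u_sol Up.1 Up.2).1) lame_solution s Up.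
rewrite dersE in H1 H3; split; [exact: H1|exact: H3|].
case: s {H1 H3} H4 => [//|i s] [w Hw]; exists w; apply/V_is_deriveP.
rewrite slice_shift; have -> // : (fun h => (fun p => partials Omega s u p.1 p.2) (param_shift i (y, z) h)) =
    (fun h => ders (@param_partial R n Omega) (fun p => u p.1 p.2) s (param_shift i (y, z) h)).
apply/funext => h; case: (param_shift i (y, z) h) => y' z'; exact: (esym (dersE Omega s u y' z')).
Qed.

Lemma lame_partials_exist s : partials_exist Omega s u.
Proof.
elim: s => [//|i s IHs]; split; first exact: IHs.
by move=> y z Uy Uz; have [_ _] := lame_ders_bound (i :: s) Uy Uz.
Qed.

(** The dual norm is taken with respect to the norm of V, while coercivity controls the strain;
    Korn's constant converts the bound on f. *)
Lemma lame_solution_bound y z : U y -> U z ->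
  Snorm Omega (u y z) <= V_dual_norm Omega f * korn_const M / (2 * mu_min).
Proof.
move=> Uy Uz; have Up : param_dom (y, z) by [].
have [Vu _] := u_sol Uy Uz.
have m20 : 0 < 2 * mu_min by rewrite mulr_gt0.
have [F0 _] := V_dual_norm_bound oO bO f_dual Vu.
have K0 := korn_const_ge0 M.
apply: (coercive_bound (Snorm_ge0 Omega) m20 (fun v => lame_param_coercive Up) _ Vu).
  by rewrite divr_ge0 ?mulr_ge0// ltW.
move=> v Vv; rewrite (lame_solution Up Vv) divfK ?(gt_eqF m20)//.
have [_ H] := V_dual_norm_bound oO bO f_dual Vv; apply: (le_trans H).
by rewrite -mulrA; exact: (ler_wpM2l F0 (V_norm_le_S oO bO M0 n0 Vv)).
Qed.

Lemma lame_ders_V_bound s y z : U y -> U z ->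
  V_norm Omega (partials Omega s u y z) <=
    (korn_const M ^+ 2 + 1) / mu_min * (size s)`!%:R * \prod_(i <- s) dir_bound i *
    V_dual_norm Omega f.
Proof.
move=> Uy Uz; have [Vw Sw _] := lame_ders_bound s Uy Uz; have [Vu _] := u_sol Uy Uz.
have Su := lame_solution_bound Uy Uz; have K0 := korn_const_ge0 M.
have [F0 _] := V_dual_norm_bound oO bO f_dual Vu.
have P0 : 0 <= \prod_(i <- s) dir_bound i.
  apply: prodr_ge0 => -[j|j] _ /=; first by rewrite divr_ge0// ltW.
  by rewrite mulr_ge0 ?divr_ge0// ltW.
apply: (le_trans (V_norm_le_S oO bO M0 n0 Vw)); apply: (le_trans (ler_wpM2l K0 Sw)).
have X0 : 0 <= (size s)`!%:R * \prod_(i <- s) dir_bound i by rewrite mulr_ge0.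
apply: (le_trans (ler_wpM2l K0 (ler_wpM2l X0 Su))).
move: (korn_const M) (V_dual_norm _ _) (\prod_(i <- s) _) ((size s)`!%:R) K0 F0 X0 {P0 Sw Su}.
move=> K F P N K0 F0 X0.
(* One K comes from the derivative and one from the bound on u, the 2 from the coercivity constant;
   K^2/2 is then enlarged to K^2 + 1. *)
have -> : K * (N * P * (F * K / (2 * mu_min))) = (K ^+ 2 / 2 / mu_min) * (N * P * F).
  by field; rewrite gt_eqF.
have -> : (K ^+ 2 + 1) / mu_min * N * P * F = (K ^+ 2 + 1) / mu_min * (N * P * F) by ring.
apply: ler_wpM2r; first by rewrite mulr_ge0.
rewrite ler_pM2r ?invr_gt0//; have := sqr_ge0 K; lra.
Qed.

End lame_problem.

Theorem theorem3p3 (R : realType) (d : nat) (hd : d = 2%N \/ d = 3%N)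
    (Omega : set 'rV[R]_d) (hOmega : bounded_polyhedral_domain Omega) :
  exists C : R, 0 < C /\
  forall (mu0 lambda0 : 'rV[R]_d -> R) (psi phi : nat -> 'rV[R]_d -> R)
    (mu_min mu_max lambda_max : R),
  measurable_fun Omega mu0 -> measurable_fun Omega lambda0 ->
  L2_orthogonal_basis Omega psi -> L2_orthogonal_basis Omega phi ->
  0 < mu_min -> 0 < mu_max -> 0 < lambda_max ->
  (forall x y, Omega x -> U y -> mu_min <= affine_coef mu0 psi y x <= mu_max) ->
  (forall x z, Omega x -> U z -> 0 <= affine_coef lambda0 phi z x <= lambda_max) ->
  (forall j, (Linfty_norm Omega (psi j.+1) <= Linfty_norm Omega (psi j))%E) ->
  (forall j, (Linfty_norm Omega (phi j.+1) <= Linfty_norm Omega (phi j))%E) ->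
  (\sum_(0 <= j <oo) Linfty_norm Omega (psi j) < +oo)%E ->
  (\sum_(0 <= j <oo) Linfty_norm Omega (phi j) < +oo)%E ->
  let b_tilde j := fine (Linfty_norm Omega (psi j)) / mu_min in
  let b_hat j := d%:R / 2 * (fine (Linfty_norm Omega (phi j)) / mu_min) in
  forall (f : ('rV[R]_d -> 'rV[R]_d) -> R)
    (u : (nat -> R) -> (nat -> R) -> 'rV[R]_d -> 'rV[R]_d),
  V_dual Omega f ->
  (forall y z, U y -> U z ->
     weak_solution Omega (affine_coef mu0 psi y) (affine_coef lambda0 phi z)
       f (u y z)) ->
  forall (alpha beta : multi_index) (s : seq direction),
  perm_eq s (mi_directions alpha beta) ->
  partials_exist Omega s u /\
  forall y z, U y -> U z ->
    strain_norm Omega (partials Omega s u y z) <=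
      (mi_order alpha + mi_order beta)`!%:R * mi_pow b_tilde alpha *
      mi_pow b_hat beta * strain_norm Omega (u y z) /\
    V_norm Omega (partials Omega s u y z) <=
      C / mu_min * (mi_order alpha + mi_order beta)`!%:R *
      mi_pow b_tilde alpha * mi_pow b_hat beta * V_dual_norm Omega f.
Proof.
have [_ oO _ bdO _] := hOmega; have [M M0 bO] := bounded_set_coord bdO.
have n0 : (0 < d)%N by case: hd => ->.
(* The constant depends on the domain only through the bound M on its coordinates; the added 1 makes
   positivity evident. *)
exists (korn_const M ^+ 2 + 1); split; first by rewrite ltr_wpDl// sqr_ge0.
move=> mu0 lambda0 psi phi mu_min mu_max lambda_max mmu mlambda [psi_L2 _ _ _] [phi_L2 _ _ _].
move=> mu_min0 mu_max0 lambda_max0 mu_bnd lambda_bnd _ _ psi_sum phi_sum b_tilde b_hat f u.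
move=> f_dual u_sol alpha beta s ps.
have mpsi j : measurable_fun Omega (psi j) by have /(L2P oO)[] := psi_L2 j.
have mphi j : measurable_fun Omega (phi j) by have /(L2P oO)[] := phi_L2 j.
have sE : size s = (mi_order alpha + mi_order beta)%N.
  by rewrite (perm_size ps) size_mi_directions.
(* Length and product are invariant under permutation, so the estimate is the same for every order
   of differentiation. *)
have pE : \prod_(i <- s) dir_bound Omega psi phi mu_min i =
    mi_pow b_tilde alpha * mi_pow b_hat beta.
  by rewrite (perm_big _ ps) prod_mi_directions.
split.
  exact: (lame_partials_exist oO bO M0 n0 mmu mlambda mpsi mphi mu_min0 mu_bnd lambda_bnd
    psi_sum phi_sum mu_max0 lambda_max0 u_sol).
move=> y z Uy Uz.
have [Vw Sw _] := lame_ders_bound oO bO M0 n0 mmu mlambda mpsi mphi mu_min0 mu_bnd lambda_bnd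
  psi_sum phi_sum mu_max0 lambda_max0 u_sol s Uy Uz.
have Nw := lame_ders_V_bound oO bO M0 n0 mmu mlambda mpsi mphi mu_min0 mu_bnd lambda_bnd
  psi_sum phi_sum mu_max0 lambda_max0 f_dual u_sol s Uy Uz.
have [Vu _] := u_sol y z Uy Uz.
move: Sw Nw; rewrite sE pE !mulrA (strain_normE oO Vw) (strain_normE oO Vu) => Sw Nw.
by split; [exact: Sw|exact: Nw].
Qed.
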